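(* Let $(\vartheta_0,D)$ be one of the pairs $(0.729,2)$, $(0.616,6)$, $(0.554,8)$, $(0.515,12)$, and suppose some $\vartheta>\vartheta_0$ satisfies both conditions (A) and (B) below. Then there exists an integer $d$ with $0<|d|\le D$ such that $\lambda(p+d)=-1$ for infinitely many primes $p$.
   Context: $\Omega(n)$ is the number of prime factors of $n$ counted with multiplicity and $\lambda(n)=(-1)^{\Omega(n)}$. Condition (A): for every $\varepsilon>0$, $A>0$, $\sum_{q\le N^{\vartheta-\varepsilon}}\max_{a:(a,q)=1}\bigl|\sum_{p\le N,\,p\equiv a\ (\mathrm{mod}\ q)}\log p-\frac{N}{\varphi(q)}\bigr|\ll_{\varepsilon,A}\frac{N}{(\log N)^A}$ ($p$ over primes). Condition (B): for every $\varepsilon>0$, $A>0$, $\sum_{q\le N^{\vartheta-\varepsilon}}\max_{y\le N}\max_a\bigl|\sum_{n\le y,\,n\equiv a\ (\mathrm{mod}\ q)}\lambda(n)\bigr|\ll_{\varepsilon,A}\frac{N}{(\log N)^A}$. *)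

(* Defs.v *)
From Stdlib Require Import Reals ZArith.
From mathcomp Require Import all_boot.
Local Open Scope R_scope.

Set Implicit Arguments.
Unset Strict Implicit.
Unset Printing Implicit Defensive.

Definition bigOmega (n : nat) : nat := \sum_(p <- primes n) logn p n.

Definition liouville (n : nat) : R := pow (-1) (bigOmega n).

(* The moduli q with 1 <= q <= X (X real); the range bound up X > X is only
   a finite enumeration bound, the actual condition is INR q <= X. *)
Definition le_real (q : nat) (X : R) : bool :=
  if Rle_dec (INR q) X then true else false.

Definition errA (N q : nat) : R :=
  \big[Rmax/R0]_(a < q | coprime a q)
    Rabs (Rminus (\big[Rplus/R0]_(p < N.+1 | prime p && (p %% q == a))
                      ln (INR p))
                 (Rdiv (INR N) (INR (totient q)))).

Definition sumA (theta eps : R) (N : nat) : R :=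
  let X := Rpower (INR N) (theta - eps) in
  \big[Rplus/R0]_(q < Z.to_nat (up X) | (0 < q)%N && le_real q X) errA N q.

Definition condA (theta : R) : Prop :=
  forall eps A : R, (0 < eps) -> (0 < A) ->
  exists (C : R) (N0 : nat), forall N : nat, (N0 <= N)%N ->
    (sumA theta eps N <= C * INR N / Rpower (ln (INR N)) A).

(* Condition (B), the summand for modulus q:
   max_{y <= N} max_a | sum_{1 <= n <= y, n = a mod q} lambda(n) |.
   The inner sum depends only on floor(y), so y ranges over 0..N. *)
Definition errB (N q : nat) : R :=
  \big[Rmax/R0]_(y < N.+1)
    \big[Rmax/R0]_(a < q)
      Rabs (\big[Rplus/R0]_(1 <= n < y.+1 | n %% q == a) liouville n).

Definition sumB (theta eps : R) (N : nat) : R :=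
  let X := Rpower (INR N) (theta - eps) in
  \big[Rplus/R0]_(q < Z.to_nat (up X) | (0 < q)%N && le_real q X) errB N q.

Definition condB (theta : R) : Prop :=
  forall eps A : R, (0 < eps) -> (0 < A) ->
  exists (C : R) (N0 : nat), forall N : nat, (N0 <= N)%N ->
    (sumB theta eps N <= C * INR N / Rpower (ln (INR N)) A).

(* Main.v *)
(** Suppose that, for all large primes p, lambda(p+d) = 1 whenever 0 < |d| <= D.
    Let H be the first k elements of (0, 2, 6, 8, 12), with D the last one.  For
    large n at most one n+h (h in H) is prime, for a second one n+h' would have
    lambda(n+h') = -1; and if one of them is prime then lambda(n+1) = 1, because
    1 is not in H.  Hence
      sum_(h in H) 1_prime(n+h) <= (1 + lambda(n+1)) / 2.
    Average this over N < n <= 2N with the Selberg weights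
    w_n = (sum_(d | prod (n+h)) lambda_d)^2, d <= N^(tau/2), theta0 < tau < theta.
    By (B) lambda(n+1) averages to zero, and by (A) the left-hand side is a
    quadratic form that can be evaluated.  With the diagonal variables
    y_r = L + c (L - log r), L = (tau/2) log N, the left-hand side is asymptotically
    tau k G / (2F) times the total weight, where F and G are explicit rational
    functions of k and c.  The right-hand side is half the total weight, so that
    tau k G > F is absurd; (k, c) = (2,1), (3,3), (4,6), (5,9) give the four pairs.

    Squarefree d are encoded as sets of primes: products of multiplicative
    functions are then products over sets, and lcm is union.  Sifting by the primes
    p <= w beforehand (n is fixed modulo w!) makes all local factors 1 + O(1/w),
    and only an upper bound for sum w_n and a lower bound for the prime sum are
    needed, both of which follow from sum_(n <= x, (n,w!)=1) 1/n. *)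

Require Import Defs.
From Stdlib Require Import Reals ZArith Classical.
From mathcomp Require Import all_boot all_order all_algebra.
From mathcomp Require Import Rstruct ring lra zify.

Set Implicit Arguments.
Unset Strict Implicit.
Unset Printing Implicit Defensive.
Import Order.TTheory GRing.Theory Num.Theory.
Local Open Scope ring_scope.

Notation R := Rdefinitions.R.
(* Functions with an argument in R would otherwise parse it in R_scope. *)
Bind Scope ring_scope with Rdefinitions.R.
(* all_algebra has rebound the key Z to int_scope. *)
Delimit Scope Z_scope with Z.


(** The prime sum carries the weight log p, and log N = 2L/tau, so the averaged inequality compares
    k G L^(k+3) with (L/tau) F L^(k+2). Here tau is limited by theta because the moduli are w! times
    the lcm of two d up to N^(tau/2). Constant diagonal variables (c = 0) would give F/(kG) =
    (k+1)/(2k), that is 3/4 for k = 2 and 3/5 for k = 5; the linear term is what brings the ratio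
    below the stated exponents.

    No singular series appears: with V = phi(w!)/w!, the total weight has the factor V^k N/w! and
    the prime sum the factor V^(k+1) N/phi(w!), and these are equal. The only loss in the main terms
    is [Kw k w], which tends to 1 as w grows. This fixes the order of choices: w so large that
    [Kw k w] F is still below tau k G, then the class b modulo w!, and N last. All error constants
    may therefore depend on w. *)

(** * Logarithms of natural numbers *)

Definition lg (n : nat) : R := ln n%:R.

(** [ln] takes the default value 0 outside the positive reals, so [lg] is nonnegative on all of
    [nat]. *)
Lemma lg0 : lg 0 = 0.
Proof.
by rewrite /lg /ln; case: Rlt_dec => // h; exfalso; have /RltP := h; rewrite ltxx.
Qed.

Lemma lg1 : lg 1 = 0.
Proof. exact: ln_1. Qed.

Lemma natr_gt0R (n : nat) : (0 < n)%N -> Rlt 0%R n%:R.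
Proof. by move=> n0; apply/RltP; rewrite ltr0n. Qed.

Lemma lgM (m n : nat) : (0 < m)%N -> (0 < n)%N -> lg (m * n) = lg m + lg n.
Proof. by move=> m0 n0; rewrite /lg natrM ln_mult //; exact: natr_gt0R. Qed.

Lemma ler_lg (m n : nat) : (0 < m)%N -> (m <= n)%N -> lg m <= lg n.
Proof.
move=> m0; rewrite leq_eqVlt => /orP[/eqP-> //|mn].
apply/RleP/Rlt_le/ln_increasing; first exact: natr_gt0R.
by apply/RltP; rewrite ltr_nat.
Qed.

Lemma lg_ge0 (n : nat) : 0 <= lg n.
Proof. by case: n => [|n]; [rewrite lg0 | rewrite -lg1 ler_lg]. Qed.

Lemma ltr_lg (m n : nat) : (0 < m)%N -> (m < n)%N -> lg m < lg n.
Proof.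
move=> m0 mn; apply/RltP/ln_increasing; first exact: natr_gt0R.
by apply/RltP; rewrite ltr_nat.
Qed.

Lemma ln_le_sub1 (x : R) : 0 < x -> ln x <= x - 1.
Proof.
move=> /RltP x0; have := exp_ineq1_le (ln x); rewrite exp_ln //.
by move/RleP; rewrite RplusE => h; rewrite lerBrDl.
Qed.

Lemma lgS_le (n : nat) : (0 < n)%N -> lg n.+1 - lg n <= n%:R^-1.
Proof.
move=> n0; have n0R : 0 < n%:R :> R by rewrite ltr0n.
have s0R : 0 < n.+1%:R :> R by rewrite ltr0n.
have := ln_le_sub1 (divr_gt0 s0R n0R).
have -> : ln (n.+1%:R / n%:R) = lg n.+1 - lg n.
  by rewrite ln_mult ?ln_Rinv //; apply/RltP; rewrite ?invr_gt0.
by rewrite -natr1 mulrDl divff ?gt_eqF // mul1r [1 + _]addrC addrK.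
Qed.

Lemma lgS_ge (n : nat) : (0 < n)%N -> n.+1%:R^-1 <= lg n.+1 - lg n.
Proof.
move=> n0; have n0R : 0 < n%:R :> R by rewrite ltr0n.
have s0R : 0 < n.+1%:R :> R by rewrite ltr0n.
have := ln_le_sub1 (divr_gt0 n0R s0R).
have -> : ln (n%:R / n.+1%:R) = lg n - lg n.+1.
  by rewrite ln_mult ?ln_Rinv //; apply/RltP; rewrite ?invr_gt0.
have -> : n%:R / n.+1%:R - 1 = - n.+1%:R^-1 :> R.
  by rewrite -natr1; field; rewrite natr1 gt_eqF.
by rewrite lerNr opprB.
Qed.

(** * Truncated powers and logarithmic sums *)

(* The kernels E_j(u) = u_+^j / j! satisfy E_(j+1)' = E_j, so that summing E_j(u - log n) / n
   over n raises j by one; this replaces all integrals below. *)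
Definition trunc_pow (j : nat) (u : R) : R := if 0 <= u then u ^+ j / j`!%:R else 0.

Local Notation E := trunc_pow.

Lemma factr_gt0 (j : nat) : 0 < j`!%:R :> R.
Proof. by rewrite ltr0n fact_gt0. Qed.

Lemma E_ge0 j u : 0 <= E j u.
Proof.
rewrite /E; case: ifP => // u0.
by rewrite divr_ge0 ?exprn_ge0 // ltW // factr_gt0.
Qed.

Lemma E_pos j u : 0 <= u -> E j u = u ^+ j / j`!%:R.
Proof. by rewrite /E => ->. Qed.

Lemma E_neg j u : u < 0 -> E j u = 0.
Proof. by rewrite /E leNgt => ->. Qed.

Lemma E_le j u v : u <= v -> E j u <= E j v.
Proof.
move=> uv; rewrite {1}/E; case: ifP => [u0|_]; last exact: E_ge0.
rewrite E_pos ?(le_trans u0) // ler_pM2r ?invr_gt0 ?factr_gt0 //.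
by rewrite lerXn2r // nnegrE // (le_trans u0).
Qed.

Lemma E_le_exp j u : 0 <= u -> E j u <= u ^+ j.
Proof.
move=> u0; rewrite E_pos // ler_pdivrMr ?factr_gt0 // ler_peMr ?exprn_ge0 //.
by rewrite ler1n fact_gt0.
Qed.

(** Products of kernels are multiples of kernels, so the squares of the linear diagonal variables
    lead back to sums of a single kernel. *)
Lemma EM i j u : E i u * E j u = 'C(i + j, i)%:R * E (i + j) u.
Proof.
have [u0|u0] := leP 0 u; last by rewrite !E_neg // !mulr0.
rewrite !E_pos // exprD.
have /(congr1 (fun n => n%:R : R)) := bin_fact (leq_addr j i).
rewrite addKn 2!natrM => <-.
by field; rewrite !gt_eqF ?factr_gt0 // ltr0n bin_gt0 leq_addr.
Qed.

Lemma expr_diff_le (a b : R) j : 0 <= b -> b <= a ->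
  a ^+ j.+1 - b ^+ j.+1 <= j.+1%:R * (a - b) * a ^+ j.
Proof.
move=> b0 ba; rewrite subrXX [j.+1%:R * _]mulrC -mulrA ler_wpM2l ?subr_ge0 //.
have -> : j.+1%:R * a ^+ j = \sum_(i < j.+1) a ^+ j.
  by rewrite sumr_const card_ord mulr_natl.
apply: ler_sum => i _; rewrite -[leRHS](_ : a ^+ (j - i) * a ^+ i = _); last first.
  by rewrite -exprD subnK // -ltnS.
rewrite /= ler_wpM2l ?exprn_ge0 ?(le_trans b0) //.
by rewrite lerXn2r // nnegrE // (le_trans b0).
Qed.

Lemma expr_diff_ge (a b : R) j : 0 <= b -> b <= a ->
  j.+1%:R * (a - b) * b ^+ j <= a ^+ j.+1 - b ^+ j.+1.
Proof.
move=> b0 ba; rewrite subrXX [j.+1%:R * _]mulrC -mulrA ler_wpM2l ?subr_ge0 //.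
have -> : j.+1%:R * b ^+ j = \sum_(i < j.+1) b ^+ j.
  by rewrite sumr_const card_ord mulr_natl.
apply: ler_sum => i _; rewrite -[leLHS](_ : b ^+ (j - i) * b ^+ i = _); last first.
  by rewrite -exprD subnK // -ltnS.
rewrite /= ler_wpM2r ?exprn_ge0 //.
by rewrite lerXn2r // nnegrE // (le_trans b0).
Qed.

Lemma factS_div j (x : R) : x / (j.+1)`!%:R = x / j.+1%:R / j`!%:R.
Proof. by rewrite factS natrM invfM mulrA. Qed.

(** Mean value inequality for E_(j+1), whose derivative E_j is nondecreasing. Across the kink, for b
    < 0 <= a, it reduces to a <= a - b. *)
Lemma E_diff_le (a b : R) j : b <= a -> E j.+1 a - E j.+1 b <= (a - b) * E j a.
Proof.
move=> ba; have [a0|a0] := leP 0 a; last first.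
  by rewrite !E_neg ?(le_lt_trans ba) // mulr0 subrr.
have j0 : 0 < j.+1%:R :> R by rewrite ltr0n.
have [b0|b0] := leP 0 b.
  rewrite !E_pos // -mulrBl factS_div mulrA ler_pM2r ?invr_gt0 ?factr_gt0 //.
  rewrite ler_pdivrMr // [leRHS]mulrC mulrA; exact: expr_diff_le.
rewrite (E_neg _ b0) subr0 !E_pos // factS_div mulrA.
rewrite ler_pM2r ?invr_gt0 ?factr_gt0 // exprS.
rewrite ler_pdivrMr // -mulrA [_ * j.+1%:R]mulrC mulrA ler_wpM2r ?exprn_ge0 //.
have : a <= a - b by lra.
move/le_trans; apply; rewrite ler_peMr ?ler1n //; lra.
Qed.

Lemma E_diff_ge (a b : R) j : b <= a -> (a - b) * E j b <= E j.+1 a - E j.+1 b.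
Proof.
move=> ba; have [b0|b0] := leP 0 b; last first.
  by rewrite !(E_neg _ b0) mulr0 subr0 E_ge0.
have a0 := le_trans b0 ba.
have j0 : 0 < j.+1%:R :> R by rewrite ltr0n.
rewrite !E_pos // -mulrBl factS_div mulrA ler_pM2r ?invr_gt0 ?factr_gt0 //.
rewrite ler_pdivlMr // mulrC mulrA; exact: expr_diff_ge.
Qed.

(** As 1/n >= log(n+1) - log n, each term dominates a difference of E_(j+1), and these telescope.
    The hypothesis on u makes the last value E_(j+1)(u - log(X+1)) vanish. *)
Lemma sum_inv_E_ge (X j : nat) (u : R) : u < lg X.+1 ->
  E j.+1 u <= \sum_(1 <= n < X.+1) n%:R^-1 * E j (u - lg n).
Proof.
move=> uX.
have -> : E j.+1 u = \sum_(1 <= n < X.+1) (E j.+1 (u - lg n) - E j.+1 (u - lg n.+1)).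
  under eq_bigr => n _ do rewrite -opprB; rewrite sumrN telescope_sumr //.
  by rewrite lg1 subr0 opprB (E_neg _ (_ : u - lg X.+1 < 0)) ?subr0 //; lra.
rewrite big_nat_cond [leRHS]big_nat_cond; apply: ler_sum => n /andP[/andP[n0 _] _].
apply: le_trans (E_diff_le _ _) _; first by have := @ler_lg n n.+1 n0 (leqnSn _); lra.
rewrite ler_wpM2r ?E_ge0 //; have := lgS_le n0; lra.
Qed.

(** The same telescoping with 1/(n+1) <= log(n+1) - log n; the term n = 1 has no predecessor to be
    compared with and remains as E_j(u). *)
Lemma sum_inv_E_le (X j : nat) (u : R) :
  \sum_(1 <= n < X.+1) n%:R^-1 * E j (u - lg n) <= E j u + E j.+1 u.
Proof.
case: X => [|X]; first by rewrite big_geq // addr_ge0 ?E_ge0.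
rewrite big_nat_recl // lg1 subr0 invr1 mul1r lerD2l.
apply: (@le_trans _ _ (\sum_(1 <= n < X.+1) (E j.+1 (u - lg n) - E j.+1 (u - lg n.+1)))).
  rewrite big_nat_cond [leRHS]big_nat_cond; apply: ler_sum => n /andP[/andP[n0 _] _].
  apply: le_trans (E_diff_ge _ _); last by have := @ler_lg n n.+1 n0 (leqnSn _); lra.
  rewrite (_ : u - lg n - (u - lg n.+1) = lg n.+1 - lg n); last by ring.
  by rewrite ler_wpM2r ?E_ge0 // lgS_ge.
under eq_bigr => n _ do rewrite -opprB; rewrite sumrN telescope_sumr //.
by rewrite lg1 subr0 opprB lerBlDr lerDl E_ge0.
Qed.

(** * Sums over integers coprime to a modulus and over smooth integers *)

Lemma ler_sum_inj (I J : finType) (P : pred I) (Q : pred J) (f : I -> R)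
    (g : J -> R) (h : I -> J) :
  (forall i i', P i -> P i' -> h i = h i' -> i = i') ->
  (forall i, P i -> Q (h i)) ->
  (forall i, P i -> f i <= g (h i)) -> (forall j, Q j -> 0 <= g j) ->
  \sum_(i | P i) f i <= \sum_(j | Q j) g j.
Proof.
move=> hinj hQ fg g0.
apply: (@le_trans _ _ (\sum_(i | P i) g (h i))); first exact: ler_sum.
have -> : \sum_(i | P i) g (h i) = \sum_(j in [set h i | i in P]) g j.
  by rewrite big_imset.
rewrite [leRHS](bigID (mem [set h i | i in P])) /=.
have -> : \sum_(j | Q j && (j \in [set h i | i in P])) g j =
          \sum_(j in [set h i | i in P]) g j.
  apply: eq_bigl => j; case: (boolP (j \in _)) => [/imsetP[i Pi ->]|_].
    by rewrite hQ.
  by rewrite andbF.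
by rewrite lerDl; apply: sumr_ge0 => j /andP[/g0].
Qed.

Lemma sum_nat_coprime_block (W X : nat) (f : nat -> R) : (0 < W)%N ->
  \sum_(0 <= n < X * W | coprime n W) f n =
  \sum_(0 <= l < X) \sum_(r < W | coprime r W) f (l * W + r)%N.
Proof.
move=> W0; elim: X => [|X IH]; first by rewrite mul0n !big_geq.
rewrite (@big_cat_nat _ _ _ (X * W)) //=; last by rewrite mulSn leq_addl.
rewrite IH big_nat_recr //=; congr (_ + _).
rewrite -{1}[(X * W)%N]add0n big_addn mulSn addnK big_mkord.
apply: eq_big => r; first by rewrite coprime_sym [RHS]coprime_sym /coprime addnC gcdnMDl.
by rewrite addnC.
Qed.

Lemma card_coprime (W : nat) : #|[pred r : 'I_W | coprime r W]| = totient W.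
Proof.
rewrite totient_count_coprime big_mkord -sum1_card big_mkcond /=.
by apply: eq_bigr => r _; rewrite inE coprime_sym; case: coprime.
Qed.

(** The integers are cut into blocks of length W, each with phi(W) admissible residues. In block l
    >= 1 every n is at least lW, which bounds the block by phi(W)/W times the term l of the full
    sum. *)
Lemma sum_coprime_inv_E_le (W : nat) : (0 < W)%N ->
  exists2 C : R, 0 <= C & forall (X j : nat) (u : R),
    \sum_(1 <= n < X.+1 | coprime n W) n%:R^-1 * E j (u - lg n) <=
    (totient W)%:R / W%:R * (E j.+1 u + C * E j u).
Proof.
move=> W0.
have W0R : 0 < W%:R :> R by rewrite ltr0n.
have phi0 : 0 < (totient W)%:R :> R by rewrite ltr0n totient_gt0.
pose c : R := (totient W)%:R / W%:R.
have c0 : 0 < c by rewrite divr_gt0.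
(* The 1 pays for the boundary term of [sum_inv_E_le], and W/c for the block l = 0, which is bounded
   trivially by W E_j(u). *)
exists (1 + W%:R / c); first by rewrite addr_ge0 // divr_ge0 // ltW.
move=> X j u; rewrite -/c.
pose f n : R := n%:R^-1 * E j (u - lg n).
have f0 n : 0 <= f n by rewrite mulr_ge0 ?invr_ge0 ?E_ge0.
have fle n m : (0 < m)%N -> (m <= n)%N -> f n <= m%:R^-1 * E j (u - lg m).
  move=> m0 mn; have n0 := leq_trans m0 mn.
  rewrite ler_pM ?invr_ge0 ?E_ge0 ?ler0n //.
    by rewrite lef_pV2 ?posrE ?ltr0n // ler_nat.
  by apply: E_le; rewrite lerD2l lerN2 ler_lg.
apply: (@le_trans _ _ (\sum_(0 <= n < X.+1 * W | coprime n W) f n)).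
  rewrite big_mkcond [leRHS]big_mkcond /= [leRHS](@big_cat_nat _ _ _ 1) //=; last first.
    by rewrite muln_gt0.
  rewrite [X in _ <= _ + X](@big_cat_nat _ _ _ X.+1) //=; last first.
    by rewrite leq_pmulr.
  have g0 n : 0 <= (if coprime n W then f n else 0) by case: ifP.
  rewrite [X in _ <= _ + X]addrC addrA lerDr addr_ge0 //; exact: sumr_ge0.
rewrite sum_nat_coprime_block // big_nat_recl // mulrDr [c * _ + _]addrC.
rewrite mulrDl mul1r mulrDr -addrA addrCA.
apply: lerD.
  rewrite (_ : c * _ = W%:R * E j u); last by field; rewrite gt_eqF.
  apply: (@le_trans _ _ (\sum_(r < W) E j u)); last first.
    by rewrite sumr_const card_ord mulr_natl.
  rewrite big_mkcond /=; apply: ler_sum => r _; case: ifP => _; last exact: E_ge0.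
  (* The block l = 0 contains the index n = 0, whose term is 0 because the inverse of 0 is 0. *)
  rewrite mul0n add0n /f; case: (posnP r) => [->|r0].
    by rewrite invr0 mul0r E_ge0.
  apply: le_trans (fle _ _ _ r0) _ => //.
  by rewrite lg1 subr0 invr1 mul1r.
apply: (@le_trans _ _ (\sum_(0 <= l < X) c * (l.+1%:R^-1 * E j (u - lg l.+1)))).
  apply: ler_sum => l _.
  apply: (@le_trans _ _ (\sum_(r < W | coprime r W)
    (W%:R^-1 * (l.+1%:R^-1 * E j (u - lg l.+1))))).
    apply: ler_sum => r _.
    apply: le_trans (fle _ (l.+1 * W)%N _ _) _; rewrite ?muln_gt0 ?leq_addr //.
    rewrite natrM invfM mulrA (mulrC _^-1) -!mulrA ler_wpM2l ?invr_ge0 //.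
    rewrite ler_wpM2l ?invr_ge0 //; apply: E_le.
    by rewrite lerD2l lerN2 ler_lg // leq_pmulr.
  rewrite (sumr_const [pred r : 'I_W | coprime r W]) -[leRHS]mulrA [leRHS](_ : _ =
    (totient W)%:R * (W%:R^-1 * (l.+1%:R^-1 * E j (u - lg l.+1)))) //.
  by rewrite mulr_natl card_coprime.
rewrite -mulr_sumr -mulrDr ler_pM2l //.
by have := sum_inv_E_le X j u; rewrite big_add1.
Qed.

Lemma geometric_le (x : R) (K : nat) : 0 <= x -> x < 1 ->
  \sum_(i < K) x ^+ i <= (1 - x)^-1.
Proof.
move=> x0 x1; rewrite -[leRHS]mul1r ler_pdivlMr ?subr_gt0 // mulrC.
have -> : (1 - x) * \sum_(i < K) x ^+ i = 1 - x ^+ K.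
  by rewrite -[RHS]opprB -[1 - x]opprB mulNr -subrX1.
by rewrite lerBlDr lerDl exprn_ge0.
Qed.

Definition smooth (ps : seq nat) (n : nat) : bool := all (mem ps) (primes n).

(** Upper half of the Euler product. Splitting off the exact power of the head prime embeds the
    smooth integers up to X into pairs of an exponent and a cofactor smooth over the tail; the
    exponents contribute a geometric series. *)
Lemma smooth_sum_le (ps : seq nat) (X : nat) : all prime ps ->
  \sum_(n < X.+1 | (0 < n)%N && smooth ps n) (n%:R : R)^-1 <=
  \prod_(p <- ps) (1 - p%:R^-1)^-1.
Proof.
elim: ps => [_|p ps IH /= /andP[pp pps]].
  rewrite big_nil.
  apply: (@le_trans _ _ (\sum_(n < 1) 1)); last by rewrite big_ord1.
  apply: (@ler_sum_inj _ _ _ _ _ _ (fun=> ord0)) => //=.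
    move=> n m; rewrite /smooth => /andP[n0 sn] /andP[m0 sm] _.
    have E1 (k : nat) : (0 < k)%N -> all (mem [::]) (primes k) -> k = 1%N.
      move=> k0; case: (ltngtP k 1) => //; first by case: k k0.
      move=> k1 /allP /(_ (pdiv k)); rewrite mem_primes pdiv_prime // k0 pdiv_dvd.
      by move=> /(_ isT).
    apply: val_inj; exact: etrans (E1 n n0 sn) (esym (E1 m m0 sm)).
  move=> n /andP[n0 _]; rewrite invf_le1 ?ltr0n // ler1n //.
rewrite big_cons.
have p1 := prime_gt1 pp.
have pinv0 : 0 <= (p%:R : R)^-1 by rewrite invr_ge0.
have pinv1 : (p%:R : R)^-1 < 1 by rewrite invf_lt1 ?ltr0n ?ltr1n // ltnW.
apply: (@le_trans _ _ (\sum_(i < X.+1) p%:R^-1 ^+ i *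
   \sum_(n < X.+1 | (0 < n)%N && smooth ps n) (n%:R : R)^-1)); last first.
  rewrite -mulr_suml ler_pM ?IH //.
  - by apply: sumr_ge0 => i _; rewrite exprn_ge0.
  - by apply: sumr_ge0 => i _; rewrite invr_ge0.
  - exact: geometric_le.
under [leRHS]eq_bigr => i _ do rewrite mulr_sumr.
rewrite pair_big /=.
have lX (n : nat) (m : 'I_X.+1) : (n <= m)%N -> (n < X.+1)%N.
  by move=> nm; apply: leq_ltn_trans nm (ltn_ord m).
apply: (@ler_sum_inj _ _ _ _ _ _ (fun n : 'I_X.+1 =>
   (inord (logn p n), inord (n %/ p ^ logn p n)) : 'I_X.+1 * 'I_X.+1)) => /=.
- move=> n m /andP[n0 sn] /andP[m0 sm] [].
  move=> /(congr1 (@nat_of_ord _)) e1 /(congr1 (@nat_of_ord _)) e2.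
  have ln (k : 'I_X.+1) : (0 < k)%N -> (logn p k < X.+1)%N.
    by move=> k0; apply: (lX _ k); apply: ltnW; apply: ltn_logl.
  have ld (k : 'I_X.+1) : (k %/ p ^ logn p k < X.+1)%N by apply: (lX _ k); exact: leq_div.
  move: e1 e2; rewrite !inordK ?ln ?ld // => e1 e2.
  apply: val_inj => /=.
  rewrite -(divnK (pfactor_dvdnn p n)) -[RHS](divnK (pfactor_dvdnn p m)).
  by rewrite e2 e1.
- move=> n /andP[n0 sn]; rewrite inordK ?(lX _ n) ?leq_div //.
  rewrite divn_gt0 ?expn_gt0 ?(ltnW p1) // dvdn_leq ?pfactor_dvdnn //=.
  apply/allP => q; rewrite mem_primes => /and3P[pq q0 qn].
  have := allP sn q; rewrite mem_primes pq n0 (dvdn_trans qn) ?dvdn_div ?pfactor_dvdnn //=.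
  move=> /(_ isT); rewrite inE => /orP[/eqP qp|//]; exfalso.
  have := pfactor_coprime pp n0 => -[m cm e].
  move: qn; rewrite {1}e mulnK ?expn_gt0 ?(ltnW p1) // qp => pm.
  by move: cm; rewrite prime_coprime // pm.
- move=> n /andP[n0 sn].
  have ln : (logn p n < X.+1)%N by apply: (lX _ n); apply: ltnW; apply: ltn_logl.
  have ld : (n %/ p ^ logn p n < X.+1)%N by apply: (lX _ n); exact: leq_div.
  rewrite (inordK ln) (inordK ld) exprVn -invfM -natrX -natrM mulnC.
  by rewrite divnK ?pfactor_dvdnn.
- by move=> j _; rewrite mulr_ge0 ?exprn_ge0 ?invr_ge0.
Qed.

Lemma totient_ratio (n : nat) : (0 < n)%N ->
  (totient n)%:R / n%:R = \prod_(p <- primes n) (1 - (p%:R : R)^-1).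
Proof.
move=> n0; rewrite totientE // [X in _ / X%:R]prod_prime_decomp // prime_decompE big_map /=.
rewrite !natr_prod -prodf_div big_seq [RHS]big_seq; apply: eq_bigr => p pn.
have pp : prime p by move: pn; rewrite mem_primes => /and3P[].
have l0 : (0 < logn p n)%N by rewrite logn_gt0.
rewrite -(prednK l0) /= expnS !natrM.
rewrite -subn1 natrB ?prime_gt0 //.
have p0 : (p%:R : R) != 0 by rewrite pnatr_eq0 -lt0n prime_gt0.
have e0 : ((p ^ (logn p n).-1)%N%:R : R) != 0 by rewrite natrX expf_neq0.
by field; rewrite p0 e0.
Qed.

(** * Sums over sets of primes *)

Lemma prod_add_subsets (I : finType) (V : {set I}) (x z : I -> R) :
  \prod_(p in V) (x p + z p) =
  \sum_(U : {set I} | U \subset V) (\prod_(p in V :\: U) x p) * (\prod_(p in U) z p).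
Proof.
rewrite big_mkcond /=.
rewrite (eq_bigr (fun p => (if p \in V then z p else 0) +
    (if p \in V then x p else 1))); last first.
  by move=> p _; case: ifP; rewrite ?add0r // addrC.
rewrite bigA_distr (bigID (fun U : {set I} => U \subset V)) /= [X in _ + X]big1 ?addr0.
  apply: eq_bigr => U UV.
  rewrite (big_mkcond (mem (V :\: U))) (big_mkcond (mem U)) /= -big_split /=.
  apply: eq_bigr => p _; rewrite !inE.
  case: (boolP (p \in U)) => pU /=; first by rewrite (subsetP UV) // mul1r.
  by case: ifP; rewrite mulr1.
move=> U /subsetPn[p pU pV]; rewrite (bigD1 p) //= pU (negbTE pV) mul0r //.
Qed.

(** Expanding the product assigns every prime to one of the two summands, so the sum runs over
    disjoint pairs. This is Dirichlet convolution on squarefree integers: raising the sieve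
    dimension by one means splitting off one factor. *)
Lemma sum_setU_split (I : finType) (P : {set I}) (x z : I -> R) (F : {set I} -> R) :
  \sum_(V : {set I} | V \subset P) (\prod_(p in V) (x p + z p)) * F V =
  \sum_(V : {set I} | V \subset P) \sum_(U : {set I} | U \subset P :\: V)
    (\prod_(p in V) x p) * (\prod_(p in U) z p) * F (V :|: U).
Proof.
under eq_bigr => V _ do rewrite prod_add_subsets mulr_suml.
rewrite pair_big_dep /= [RHS]pair_big_dep /=.
rewrite (reindex_onto (fun q : {set I} * {set I} => (q.1 :|: q.2, q.2))
   (fun q => (q.1 :\: q.2, q.2))) /=; last first.
  move=> [V U] /= /andP[VP UV]; congr (_, _).
  by rewrite setUC -{1}(setIidPr UV) setID.
apply: eq_big => [[V U]|[V U]] /=.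
  rewrite subUset subsetUr andbT xpair_eqE eqxx andbT subsetD.
  rewrite setDUl setDv setU0 -andbA; congr (_ && (_ && _)).
  by rewrite disjoint_sym; apply/eqP/setDidPl.
by rewrite setDUl setDv setU0 => /andP[_ /eqP[-> ]].
Qed.

Lemma prime_dvd_fact p w : prime p -> (p %| w`!)%N = (p <= w)%N.
Proof.
move=> pp; apply/idP/idP => [|pw]; last by rewrite dvdn_fact // prime_gt0.
elim: w => [|w IH]; first by rewrite fact0 dvdn1 => /eqP p1; rewrite p1 in pp.
rewrite factS Euclid_dvdM // => /orP[/dvdn_leq->//|/IH/leq_trans->//].
Qed.

Definition sieving_primes (w N : nat) : {set 'I_N.+1} :=
  [set p : 'I_N.+1 | prime p && (w < p)%N].

Definition dprod (N : nat) (S : {set 'I_N.+1}) : nat := (\prod_(p in S) p)%N.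

Lemma sieving_primesP w N (S : {set 'I_N.+1}) (p : 'I_N.+1) :
  S \subset sieving_primes w N -> p \in S -> prime p /\ (w < p)%N.
Proof. by move=> /subsetP SP /SP; rewrite inE => /andP. Qed.

Lemma dprod_gt0 w N (S : {set 'I_N.+1}) : S \subset sieving_primes w N -> (0 < dprod S)%N.
Proof.
move=> SP; rewrite prodn_cond_gt0 // => p pS.
by have [/prime_gt0] := sieving_primesP SP pS.
Qed.

Lemma dprodU N (S T : {set 'I_N.+1}) : [disjoint S & T] ->
  dprod (S :|: T) = (dprod S * dprod T)%N.
Proof. by move=> dST; rewrite /dprod (eq_bigl [predU S & T]) ?bigU // => p; rewrite !inE. Qed.

Lemma prime_dvd_dprod w N (S : {set 'I_N.+1}) (p : 'I_N.+1) :
  S \subset sieving_primes w N -> prime p -> (p %| dprod S)%N = (p \in S).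
Proof.
move=> SP pp; apply/idP/idP => [|pS]; last by rewrite /dprod (bigD1 p) //= dvdn_mulr.
rewrite /dprod; elim/big_rec: _ => [|q n qS IH]; first by rewrite dvdn1 => /eqP p1; rewrite p1
  in pp.
rewrite Euclid_dvdM // => /orP[|//]; have [pq _] := sieving_primesP SP qS.
by rewrite dvdn_prime2 // => /eqP/val_inj->.
Qed.

Lemma dprod_inj w N (S T : {set 'I_N.+1}) :
  S \subset sieving_primes w N -> T \subset sieving_primes w N ->
  dprod S = dprod T -> S = T.
Proof.
move=> SP TP e; apply/setP => p; case: (boolP (prime p)) => pp.
  by rewrite -(prime_dvd_dprod SP pp) -(prime_dvd_dprod TP pp) e.
apply/idP/idP => [pS|pT].
  by have [pp'] := sieving_primesP SP pS; rewrite pp' in pp.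
by have [pp'] := sieving_primesP TP pT; rewrite pp' in pp.
Qed.

Lemma coprime_prod (I : Type) (r : seq I) (P : pred I) (F : I -> nat) (n : nat) :
  (forall i, P i -> coprime (F i) n) -> coprime (\prod_(i <- r | P i) F i) n.
Proof.
move=> h; elim/big_rec: _ => [|i m Pi IH]; first exact: coprime1n.
by rewrite coprimeMl h.
Qed.

Lemma dprod_coprime w N (S : {set 'I_N.+1}) : S \subset sieving_primes w N ->
  coprime (dprod S) w`!.
Proof.
move=> SP; apply: coprime_prod => p pS; have [pp wp] := sieving_primesP SP pS.
by rewrite prime_coprime // prime_dvd_fact // -ltnNge.
Qed.

Lemma dprod_dvd w N (S : {set 'I_N.+1}) (n : nat) : S \subset sieving_primes w N ->
  (forall p, p \in S -> (p %| n)%N) -> (dprod S %| n)%N.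
Proof.
have [m] := ubnP #|S|; elim: m S => // m IH S; rewrite ltnS => Sm SP h.
have [->|[p pS]] := set_0Vmem S; first by rewrite /dprod big_set0 dvd1n.
have SpP : S :\ p \subset sieving_primes w N by apply: subset_trans (subsetDl _ _) SP.
have [pp _] := sieving_primesP SP pS.
rewrite /dprod (big_setD1 p) //= Gauss_dvd ?h //=.
  apply: IH => //; first by move: Sm; rewrite (cardsD1 p S) pS.
  by move=> q; rewrite !inE => /andP[_ /h].
by rewrite prime_coprime // (prime_dvd_dprod SpP) // !inE eqxx.
Qed.

Lemma natr_dprod N (S : {set 'I_N.+1}) : (dprod S)%:R = \prod_(p in S) (p : nat)%:R :> R.
Proof. by rewrite /dprod natr_prod. Qed.

(* By [totient_ratio] this is the product of 1 - 1/p over the primes p <= w. *)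
Definition cW (w : nat) : R := (totient w`!)%:R / (w`!)%:R.

Lemma cW_gt0 w : 0 < cW w.
Proof. by rewrite /cW; apply: divr_gt0; rewrite ltr0n ?totient_gt0 fact_gt0. Qed.

(* Sort the n <= e^u by the set U of their prime factors > w outside V.  What remains of n
   is smooth over V, U and the primes <= w, so its reciprocals sum to an Euler product. *)
Lemma sum_subset_E_ge w N j (V : {set 'I_N.+1}) (u : R) : u < lg N.+1 ->
  V \subset sieving_primes w N ->
  cW w * (\prod_(p in V) (1 - (p : nat)%:R^-1)) * E j.+1 u <=
  \sum_(U : {set 'I_N.+1} | U \subset sieving_primes w N :\: V)
    (\prod_(p in U) ((p : nat)%:R - 1)^-1) * E j (u - lg (dprod U)).
Proof.
move=> uN VP; set P := sieving_primes w N.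
pose Un (n : 'I_N.+1) : {set 'I_N.+1} := [set p in P :\: V | (p %| n)%N].
have Pp (p : 'I_N.+1) : p \in P -> prime p /\ (w < p)%N by rewrite inE => /andP.
have inv1 (p : nat) : prime p -> 0 < 1 - (p%:R : R)^-1.
  move=> pp; rewrite subr_gt0 invf_lt1 ?ltr0n ?ltr1n ?prime_gt0 ?prime_gt1 //.
have K0 : 0 < cW w * (\prod_(p in V) (1 - (p : nat)%:R^-1)).
  rewrite mulr_gt0 ?cW_gt0 //; apply: prodr_gt0 => p pV; apply: inv1.
  by have [] := sieving_primesP VP pV.
set K := cW w * _ in K0 *.
apply: le_trans (ler_wpM2l (ltW K0) (sum_inv_E_ge j uN)) _.
rewrite big_add1 /=.
rewrite (_ : \sum_(0 <= n < N) _ = \sum_(n < N.+1 | (0 < n)%N) n%:R^-1 * E j (u - lg n)); last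
  first.
  by rewrite [RHS]big_mkcond big_ord_recl /= add0r big_mkord.
rewrite (partition_big Un (fun U => U \subset P :\: V)) /=; last first.
  by move=> n _; apply/subsetP => p; rewrite inE => /andP[].
rewrite mulr_sumr; apply: ler_sum => U UPV.
have UP : U \subset P by apply: subset_trans UPV (subsetDl _ _).
pose ps := primes w`! ++ [seq val p | p <- enum V] ++ [seq val p | p <- enum U].
have dU0 := dprod_gt0 UP.
apply: (@le_trans _ _ (K *
   \sum_(m < N.+1 | (0 < m)%N && smooth ps m)
     m%:R^-1 * ((dprod U)%:R^-1 * E j (u - lg (dprod U))))).
  rewrite ler_wpM2l ?(ltW K0) //.
  have dvdU (n : 'I_N.+1) : Un n == U -> (dprod U %| n)%N.
    move=> /eqP <-; rewrite /dprod.
    apply: (@dprod_dvd w); first by apply/subsetP => p; rewrite !inE => /andP[/andP[_ ->]].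
    by move=> p; rewrite inE => /andP[].
  apply: (@ler_sum_inj _ _ _ _ _ _ (fun n : 'I_N.+1 => inord (n %/ dprod U))) => /=.
  - move=> n m /andP[n0 /dvdU dn] /andP[m0 /dvdU dm] /(congr1 (@nat_of_ord _)).
    rewrite !inordK ?(leq_ltn_trans (leq_div _ _)) // => e; apply: val_inj => /=.
    by rewrite -(divnK dn) e divnK.
  - move=> n /andP[n0 nU]; have dn := dvdU _ nU.
    rewrite inordK ?(leq_ltn_trans (leq_div _ _)) // divn_gt0 // dvdn_leq //=.
    apply/allP => q; rewrite mem_primes => /and3P[pq q0 qn].
    have qn' : (q %| n)%N by rewrite (dvdn_trans qn) // dvdn_div.
    have qN : (q < N.+1)%N by apply: leq_ltn_trans (dvdn_leq _ qn') (ltn_ord n).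
    rewrite inE !mem_cat mem_primes pq fact_gt0 prime_dvd_fact //=.
    case: (leqP q w) => //= wq.
    case: (boolP (Ordinal qN \in V)) => qV.
      by apply/orP; left; apply/mapP; exists (Ordinal qN); rewrite ?mem_enum.
    apply/orP; right; apply/mapP; exists (Ordinal qN); rewrite ?mem_enum //.
    by rewrite -(eqP nU) !inE qV pq wq.
  - move=> n /andP[n0 nU]; have dn := dvdU _ nU.
    rewrite inordK ?(leq_ltn_trans (leq_div _ _)) // mulrA -invfM -natrM divnK //.
    rewrite ler_wpM2l ?invr_ge0 //; apply: E_le.
    by rewrite lerD2l lerN2 ler_lg // dvdn_leq.
  - by move=> m _; rewrite !mulr_ge0 ?invr_ge0 ?E_ge0.
rewrite -mulr_suml.
have aps : all prime ps.
  rewrite !all_cat; apply/and3P; split; first by apply/allP => q; rewrite mem_primes => /and3P[].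
    by apply/allP => _ /mapP[p + ->]; rewrite mem_enum => /(sieving_primesP VP)[].
  by apply/allP => _ /mapP[p + ->]; rewrite mem_enum => /(sieving_primesP UP)[].
apply: le_trans (ler_wpM2l (ltW K0) (ler_wpM2r _ (smooth_sum_le N aps))) _.
  by rewrite mulr_ge0 ?invr_ge0 ?E_ge0.
(* The Euler factors over the primes up to w and over V cancel K, and those over U combine with
   1/[dprod U] into the product of 1/(p-1). *)
suff e : K * (\prod_(p <- ps) (1 - p%:R^-1)^-1 * (dprod U)%:R^-1) =
    \prod_(p in U) ((p : nat)%:R - 1)^-1 by rewrite -e !mulrA.
have h1 : \prod_(p <- primes w`!) (1 - (p%:R : R)^-1) != 0.
  rewrite gt_eqF //; rewrite big_seq; apply: prodr_gt0 => p.
  by rewrite mem_primes => /and3P[/inv1].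
rewrite /K /ps /cW totient_ratio ?fact_gt0 //.
move: (primes _) h1 => pw h1.
rewrite !big_cat !big_map /= !big_enum /= natr_dprod !prodfV.
have h2 : \prod_(p in V) (1 - ((p : nat)%:R : R)^-1) != 0.
  rewrite gt_eqF //; apply: prodr_gt0 => p pV; apply: inv1.
  by have [] := sieving_primesP VP pV.
rewrite [RHS](_ : _ = ((\prod_(p in U) (1 - ((p : nat)%:R : R)^-1)) * (\prod_(p in U) (p :
  nat)%:R))^-1); last first.
  rewrite -big_split /=; congr (_^-1); apply: eq_bigr => p pU.
  have [pp _] := sieving_primesP UP pU.
  by rewrite mulrBl mul1r mulVf // pnatr_eq0 -lt0n prime_gt0.
have cancel2 (a b c d : R) : a != 0 -> b != 0 -> a * b * (a^-1 * (b^-1 * c) * d) = c * d.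
  by move=> a0 b0; field; rewrite a0 b0.
by rewrite invfM; exact: cancel2.
Qed.

Lemma cW_ge0 w : 0 <= cW w.
Proof. exact: ltW (cW_gt0 w). Qed.

Lemma dprod0 N : dprod (set0 : {set 'I_N.+1}) = 1%N.
Proof. by rewrite /dprod big_set0. Qed.

Lemma lg_dprodU w N (V U : {set 'I_N.+1}) :
  V \subset sieving_primes w N -> U \subset sieving_primes w N :\: V ->
  lg (dprod (V :|: U)) = lg (dprod V) + lg (dprod U).
Proof.
move=> VP; rewrite subsetD => /andP[UP dUV].
by rewrite dprodU 1?disjoint_sym // lgM ?(dprod_gt0 VP) ?(dprod_gt0 UP).
Qed.

(* Writing (m+1)/(p-1-(m+1)) = x + 1/(p-1), the sum over the second summand is bounded by
   [sum_subset_E_ge], which costs a factor 1 - 1/p for each p in V. *)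
Lemma lower_weight_step (p m : R) : 0 <= m -> 0 < p - 2 - m ->
  m / (p - 1 - m) <= ((m + 1) / (p - 1 - (m + 1)) - (p - 1)^-1) * (1 - p^-1).
Proof.
move=> m0 t0.
have p0 : 0 < p by lra.
have -> : ((m + 1) / (p - 1 - (m + 1)) - (p - 1)^-1) * (1 - p^-1) =
    (m * p + 1) / (p * (p - 2 - m)).
  by field; rewrite !gt_eqF //; lra.
rewrite ler_pdivlMr ?mulr_gt0 // mulrAC ler_pdivrMr; last by lra.
nra.
Qed.

(** Induction on m, one dimension at a time: each step gains a factor [cW w] and raises the kernel
    by one. The weights m/(p-1-m), rather than m/p, are exactly those left by the diagonalised prime
    sum. *)
Lemma sieve_sum_lower w N m j (u : R) : (m < w)%N -> u < lg N.+1 ->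
  cW w ^+ m * E (j + m) u <=
  \sum_(V : {set 'I_N.+1} | V \subset sieving_primes w N)
    (\prod_(p in V) (m%:R / ((p : nat)%:R - 1 - m%:R))) * E j (u - lg (dprod V)).
Proof.
elim: m j => [|m IH] j mw uN.
  rewrite expr0 mul1r addn0 (bigD1 set0) ?sub0set //= big_set0 mul1r dprod0 lg1 subr0.
  rewrite lerDl; apply: sumr_ge0 => V /andP[_ V0]; rewrite mulr_ge0 ?E_ge0 //.
  by apply: prodr_ge0 => p _; rewrite mul0r.
have pbound (V : {set 'I_N.+1}) p : V \subset sieving_primes w N -> p \in V ->
    0 < (p : nat)%:R - 2 - m%:R :> R.
  move=> VP pV; have [_ wp] := sieving_primesP VP pV.
  have : (m.+3 <= p)%N by apply: leq_trans wp.
  by rewrite -(ler_nat R) -!natr1 => h; lra.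
have m0 : 0 <= m%:R :> R by [].
pose x (p : 'I_N.+1) : R := (m%:R + 1) / ((p : nat)%:R - 1 - (m%:R + 1)) - ((p : nat)%:R - 1)^-1.
rewrite [leRHS](_ : _ = \sum_(V : {set 'I_N.+1} | V \subset sieving_primes w N)
    (\prod_(p in V) (x p + ((p : nat)%:R - 1)^-1)) * E j (u - lg (dprod V))); last first.
  by apply: eq_bigr => V _; congr (_ * _); apply: eq_bigr => p _; rewrite /x subrK -natr1.
rewrite (sum_setU_split (sieving_primes w N) x (fun p => ((p : nat)%:R - 1)^-1)
   (fun V => E j (u - lg (dprod V)))).
rewrite exprS -mulrA addnS -addSn.
apply: le_trans (ler_wpM2l (ltW (cW_gt0 w)) (IH j.+1 (ltnW mw) uN)) _.
rewrite mulr_sumr; apply: ler_sum => V VP.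
have x0 p : p \in V -> 0 <= x p.
  move=> /(pbound _ _ VP) h; rewrite /x subr_ge0.
  apply: (@le_trans _ _ ((p : nat)%:R - 1 - (m%:R + 1))^-1).
    by rewrite lef_pV2 ?posrE; lra.
  by rewrite ler_peMl ?invr_ge0; lra.
have uV : u - lg (dprod V) < lg N.+1 by have := lg_ge0 (dprod V); lra.
rewrite [leRHS](_ : _ = (\prod_(p in V) x p) *
  \sum_(U : {set 'I_N.+1} | U \subset sieving_primes w N :\: V)
   (\prod_(p in U) ((p : nat)%:R - 1)^-1) * E j (u - lg (dprod V) - lg (dprod U))); last first.
  rewrite mulr_sumr; apply: eq_bigr => U UP.
  by rewrite (lg_dprodU VP UP) opprD addrA !mulrA.
have px0 : 0 <= \prod_(p in V) x p by apply: prodr_ge0.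
apply: le_trans (ler_wpM2l px0 (sum_subset_E_ge j uV VP)).
rewrite [leRHS](_ : _ = cW w * ((\prod_(p in V) x p * \prod_(p in V) (1 - (p : nat)%:R^-1))
  * E j.+1 (u - lg (dprod V)))); last by ring.
rewrite ler_wpM2l ?cW_ge0 // ler_wpM2r ?E_ge0 // -big_split /=; apply: ler_prod => p pV.
have h := pbound _ _ VP pV.
by rewrite lower_weight_step // divr_ge0 //; lra.
Qed.

Lemma sum_nat1_ord (X : nat) (P : pred nat) (f : nat -> R) :
  \sum_(1 <= n < X.+1 | P n) f n = \sum_(n < X.+1 | (0 < n)%N && P n) f n.
Proof.
rewrite big_add1 /= big_mkord [RHS]big_mkcond big_ord_recl /= add0r.
by rewrite [LHS]big_mkcond.
Qed.

(** The [dprod U] are distinct integers coprime to w!, so the left-hand side is a part of the sum in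
    [sum_coprime_inv_E_le]. The constant depends on w only. *)
Lemma sum_subset_inv_E_le w : exists2 C : R, 0 <= C & forall (N j : nat) (v : R),
  \sum_(U : {set 'I_N.+1} | U \subset sieving_primes w N)
    (\prod_(p in U) (p : nat)%:R^-1) * E j (v - lg (dprod U)) <=
  cW w * (E j.+1 v + C * E j v).
Proof.
have [C C0 hC] := sum_coprime_inv_E_le (fact_gt0 w).
exists C => // N j v; set P := sieving_primes w N.
pose X := \max_(U : {set 'I_N.+1}) dprod U.
have dX (U : {set 'I_N.+1}) : (dprod U < X.+1)%N by rewrite ltnS /X; exact: leq_bigmax.
apply: le_trans (hC X j v); rewrite sum_nat1_ord.
apply: (@ler_sum_inj _ _ _ _ _ _ (fun U : {set 'I_N.+1} => inord (dprod U) : 'I_X.+1)).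
- move=> U V UP VP /(congr1 (@nat_of_ord _)).
  by rewrite (inordK (dX U)) (inordK (dX V)); apply: (dprod_inj UP VP).
- by move=> U UP; rewrite (inordK (dX U)) (dprod_gt0 UP) (dprod_coprime UP).
- by move=> U UP; rewrite (inordK (dX U)) prodfV natr_dprod.
- by move=> n _; rewrite mulr_ge0 ?invr_ge0 ?E_ge0.
Qed.

(** After [sum_setU_split], letting U run over all sets instead of those disjoint from V only adds
    nonnegative terms. The inner sum then no longer depends on V except through the argument of the
    kernel. *)
Lemma sum_setU_le w N (x z : 'I_N.+1 -> R) j (u : R) :
  (forall p, p \in sieving_primes w N -> 0 <= x p) ->
  (forall p, p \in sieving_primes w N -> 0 <= z p) ->
  \sum_(V : {set 'I_N.+1} | V \subset sieving_primes w N)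
    (\prod_(p in V) (x p + z p)) * E j (u - lg (dprod V)) <=
  \sum_(V : {set 'I_N.+1} | V \subset sieving_primes w N) (\prod_(p in V) x p) *
   \sum_(U : {set 'I_N.+1} | U \subset sieving_primes w N)
      (\prod_(p in U) z p) * E j (u - lg (dprod V) - lg (dprod U)).
Proof.
move=> x0 z0.
rewrite (sum_setU_split (sieving_primes w N) x z (fun V => E j (u - lg (dprod V)))).
apply: ler_sum => V VP; rewrite mulr_sumr.
have px0 : 0 <= \prod_(p in V) x p.
  by apply: prodr_ge0 => p pV; apply: x0; apply: (subsetP VP).
have pz0 (U : {set 'I_N.+1}) : U \subset sieving_primes w N -> 0 <= \prod_(p in U) z p.
  by move=> UP; apply: prodr_ge0 => p pV; apply: z0; apply: (subsetP UP).
apply: (@ler_sum_inj _ _ _ _ _ _ id) => // U.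
- by rewrite subsetD => /andP[].
- by move=> UP; rewrite (lg_dprodU VP UP) opprD addrA !mulrA.
- by move=> UP; rewrite !mulr_ge0 ?E_ge0 ?pz0.
Qed.

(** Induction on m through (m+1)/p = m/p + 1/p. The error is written u^(j+m)/u, one power below the
    main term, which makes sense for j + m = 0 too. *)
Lemma sieve_sum_upper w m : exists2 C : R, 0 <= C & forall (N j : nat) (u : R), 1 <= u ->
  \sum_(V : {set 'I_N.+1} | V \subset sieving_primes w N)
    (\prod_(p in V) (m%:R / (p : nat)%:R)) * E j (u - lg (dprod V)) <=
  cW w ^+ m * (E (j + m) u + C * (u ^+ (j + m) / u)).
Proof.
have [C1 C10 hC1] := sum_subset_inv_E_le w.
elim: m => [|m [Cm Cm0 IH]].
  exists 0 => // N j u u1.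
  rewrite (bigD1 set0) ?sub0set //= big_set0 mul1r dprod0 lg1 subr0 addn0.
  rewrite big1 => [|V /andP[_ /set0Pn[p pV]]]; first by rewrite expr0 mul1r mul0r.
  by rewrite (bigD1 p) //= !mul0r.
(* [Cm] is the error of the sum with kernel j+1; C1 multiplies the whole bound for kernel j, main
   term and error together. *)
exists (Cm + C1 * (1 + Cm)); first by rewrite addr_ge0 ?mulr_ge0 // addr_ge0.
move=> N j u u1.
have u0 : 0 < u by lra.
apply: le_trans (_ : _ <= cW w * (\sum_(V : {set 'I_N.+1} | V \subset sieving_primes w N)
    (\prod_(p in V) (m%:R / (p : nat)%:R)) * E j.+1 (u - lg (dprod V)) +
   C1 * \sum_(V : {set 'I_N.+1} | V \subset sieving_primes w N)
    (\prod_(p in V) (m%:R / (p : nat)%:R)) * E j (u - lg (dprod V)))) _.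
  rewrite (_ : \sum_(V : {set 'I_N.+1} | _) _ = \sum_(V : {set 'I_N.+1} | V \subset
    sieving_primes w N)
    (\prod_(p in V) (m%:R / (p : nat)%:R + (p : nat)%:R^-1)) * E j (u - lg (dprod V))); last first.
    apply: eq_bigr => V _; congr (_ * _); apply: eq_bigr => p _.
    by rewrite -natr1 mulrDl mul1r.
  apply: le_trans (sum_setU_le _ _ _ _) _.
  - by move=> p _; rewrite divr_ge0.
  - by move=> p _; rewrite invr_ge0.
  rewrite mulrDr !mulr_sumr -big_split /=; apply: ler_sum => V VP.
  have p0 : 0 <= \prod_(p in V) (m%:R / ((p : nat)%:R : R)).
    by apply: prodr_ge0 => p _; rewrite divr_ge0.
  apply: le_trans (ler_wpM2l p0 (hC1 N j _)) _.
  by rewrite le_eqVlt; apply/orP; left; apply/eqP; ring.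
rewrite exprS -mulrA ler_wpM2l ?cW_ge0 //.
apply: le_trans (lerD (IH N j.+1 u u1) (ler_wpM2l C10 (IH N j u u1))) _.
rewrite [C1 * (_ * _)]mulrCA -mulrDr ler_wpM2l ?exprn_ge0 ?cW_ge0 //.
rewrite addSn -addnS -addrA mulrDl lerD2l lerD2l -mulrA ler_wpM2l //.
rewrite mulrDl mul1r addnS exprS [u * _]mulrC mulfK ?gt_eqF //.
apply: lerD; first by rewrite E_le_exp // ltW.
by rewrite ler_wpM2l // ler_pdivrMr // ler_peMr // exprn_ge0 // ltW.
Qed.

(** Weierstrass product inequality. It bounds a product of 1 + x by the inverse of 1 minus the sum
    of the x, so that convergence of an Euler product is reduced to a sum. *)
Lemma prod1D_mul_le1 (I : Type) (r : seq I) (P : pred I) (x : I -> R) :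
  (forall i, P i -> 0 <= x i) ->
  (\prod_(i <- r | P i) (1 + x i)) * (1 - \sum_(i <- r | P i) x i) <= 1.
Proof.
move=> x0; elim: r => [|i r IH]; first by rewrite !big_nil subr0 mul1r.
rewrite !big_cons; case: ifP => // Pi.
set A := \prod_(_ <- _ | _) _ in IH *; set B := \sum_(_ <- _ | _) _ in IH *.
have A0 : 0 <= A by apply: prodr_ge0 => k /x0 h; lra.
have B0 : 0 <= B by apply: sumr_ge0.
apply: le_trans IH; rewrite -mulrA mulrCA ler_wpM2l //.
have := x0 _ Pi; set y := x i => y0; nra.
Qed.

Lemma sum_inv_sq_le (w N : nat) : (0 < w)%N ->
  \sum_(p in sieving_primes w N) ((p : nat)%:R ^+ 2 : R)^-1 <= (w%:R)^-1.
Proof.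
move=> w0.
apply: (@le_trans _ _ (\sum_(n < N.+1 | (w < n)%N) (n%:R ^+ 2 : R)^-1)).
  apply: (@ler_sum_inj _ _ _ _ _ _ id) => //= p.
    by rewrite inE => /andP[].
  by move=> _; rewrite invr_ge0 exprn_ge0.
(* The strengthened bound telescopes through 1/(N+1)^2 <= 1/N - 1/(N+1); [maxn] makes it 0 as long
   as N <= w, where the sum is empty. *)
suff H : \sum_(n < N.+1 | (w < n)%N) (n%:R ^+ 2 : R)^-1 <= (w%:R)^-1 - (maxn w N)%:R^-1.
  by apply: le_trans H _; rewrite gerBl invr_ge0.
elim: N => [|N IH]; first by rewrite big_mkcond big_ord1 /= maxn0 subrr.
rewrite big_mkcond big_ord_recr /= -big_mkcond /=; case: ltnP => [wN|Nw]; last first.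
  by rewrite addr0; move: IH; rewrite (maxn_idPl (ltnW Nw)).
apply: le_trans (lerD IH (lexx _)) _; rewrite (maxn_idPr (_ : w <= N)%N) //.
rewrite -addrA lerD2l.
have N0 : 0 < N%:R :> R by rewrite ltr0n (leq_trans w0).
rewrite addrC lerBlDr.
have -> : - N.+1%:R^-1 + N%:R^-1 = (N%:R * N.+1%:R)^-1 :> R.
  by rewrite -natr1; field; rewrite !gt_eqF // addr_gt0.
rewrite lef_pV2 ?posrE ?mulr_gt0 ?exprn_gt0 ?ltr0n ?(leq_trans w0) ?(ltnW wN) //.
by rewrite expr2 ler_wpM2r // ler_nat.
Qed.

(** For p > w >= 2k one has p <= 2(p-k), hence k^2/(p(p-k)) <= 2k^2/p^2, and the sum of 1/p^2 over p
    > w is at most 1/w. *)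
Lemma prod1D_kappa_le k w N : (2 * k <= w)%N -> (2 * k ^ 2 < w)%N ->
  \prod_(p in sieving_primes w N) (1 + k%:R ^+ 2 / ((p : nat)%:R * ((p : nat)%:R - k%:R)) : R)
  <= (1 - (2 * k ^ 2)%N%:R / w%:R)^-1.
Proof.
move=> kw k2w.
have w0 : (0 < w)%N by apply: leq_ltn_trans k2w.
have w0R : 0 < w%:R :> R by rewrite ltr0n.
have pk (p : 'I_N.+1) : p \in sieving_primes w N -> (p : nat)%:R <= 2 * ((p : nat)%:R - k%:R) :> R
   /\ 0 < (p : nat)%:R :> R.
  rewrite inE => /andP[_ wp]; split; last by rewrite ltr0n (leq_ltn_trans _ wp).
  have : (2 * k <= p)%N by apply: leq_trans kw (ltnW wp).
  by rewrite -(ler_nat R) natrM => h; lra.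
have k0 : 0 <= k%:R ^+ 2 :> R by rewrite exprn_ge0.
have x0 (p : 'I_N.+1) : p \in sieving_primes w N ->
    0 <= k%:R ^+ 2 / ((p : nat)%:R * ((p : nat)%:R - k%:R)) :> R.
  by move=> /pk[h1 h2]; rewrite divr_ge0 // mulr_ge0; lra.
have := prod1D_mul_le1 (index_enum _) x0.
set A := \prod_(_ in _) _; set B := \sum_(_ <- _ | _) _ => AB.
have A0 : 0 <= A by apply: prodr_ge0 => p /x0 h; lra.
have Bw : B <= (2 * k ^ 2)%N%:R / w%:R.
  apply: le_trans (ler_wpM2l _ (sum_inv_sq_le N w0)); last by [].
  rewrite mulr_sumr; apply: ler_sum => p /pk[h1 h2].
  rewrite [leRHS](_ : _ = k%:R ^+ 2 * (2 / (p : nat)%:R ^+ 2)); last first.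
    by rewrite natrM natrX; ring.
  apply: ler_wpM2l => //.
  rewrite ler_pdivlMr ?exprn_gt0 // mulrC ler_pdivrMr ?mulr_gt0 //; last by lra.
  nra.
have q1 : (2 * k ^ 2)%N%:R / w%:R < 1 :> R by rewrite ltr_pdivrMr // mul1r ltr_nat.
rewrite -[leRHS]mul1r ler_pdivlMr ?subr_gt0 //.
apply: le_trans AB; rewrite ler_wpM2l //; lra.
Qed.

(** The weight k/(p-k) equals k/p + k^2/(p(p-k)). The second summands form a convergent Euler
    product, and the shift of the kernel that they cause is dropped by monotonicity. *)
Lemma sieve_sum_upper_kappa k w N j (u : R) : (2 * k <= w)%N -> (2 * k ^ 2 < w)%N ->
  \sum_(V : {set 'I_N.+1} | V \subset sieving_primes w N)
    (\prod_(p in V) (k%:R / ((p : nat)%:R - k%:R))) * E j (u - lg (dprod V)) <=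
  (1 - (2 * k ^ 2)%N%:R / w%:R)^-1 *
  \sum_(V : {set 'I_N.+1} | V \subset sieving_primes w N)
    (\prod_(p in V) (k%:R / (p : nat)%:R)) * E j (u - lg (dprod V)).
Proof.
move=> kw k2w; set P := sieving_primes w N.
pose z (p : 'I_N.+1) : R := k%:R ^+ 2 / ((p : nat)%:R * ((p : nat)%:R - k%:R)).
have pk (p : 'I_N.+1) : p \in P -> 0 < (p : nat)%:R :> R /\ 0 < (p : nat)%:R - k%:R :> R.
  rewrite inE => /andP[/prime_gt0 p0 wp]; split; first by rewrite ltr0n.
  by rewrite subr_gt0 ltr_nat (leq_ltn_trans _ wp) // (leq_trans _ kw) // leq_pmull.
have z0 p : p \in P -> 0 <= z p.
  by move=> /pk[h1 h2]; apply: divr_ge0; rewrite ?exprn_ge0 // ltW // mulr_gt0.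
rewrite (_ : \sum_(V : {set 'I_N.+1} | _) _ = \sum_(V : {set 'I_N.+1} | V \subset P)
    (\prod_(p in V) (k%:R / (p : nat)%:R + z p)) * E j (u - lg (dprod V))); last first.
  apply: eq_bigr => V VP; congr (_ * _); apply: eq_bigr => p /(subsetP VP)/pk[h1 h2].
  by rewrite /z; field; rewrite !gt_eqF.
apply: le_trans (sum_setU_le _ _ _ _) _ => //.
  by move=> p _; rewrite divr_ge0.
rewrite mulr_sumr; apply: ler_sum => V VP.
rewrite mulrCA ler_wpM2l //; first by apply: prodr_ge0 => p _; rewrite divr_ge0.
apply: (@le_trans _ _ ((\sum_(U : {set 'I_N.+1} | U \subset P) \prod_(p in U) z p)
   * E j (u - lg (dprod V)))).
  rewrite mulr_suml; apply: ler_sum => U UP; rewrite ler_wpM2l //.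
    by apply: prodr_ge0 => p /(subsetP UP); exact: z0.
  by apply: E_le; rewrite gerBl lg_ge0.
rewrite ler_wpM2r ?E_ge0 //; apply: le_trans (prod1D_kappa_le N kw k2w).
rewrite prod_add_subsets le_eqVlt; apply/orP; left; apply/eqP.
by apply: eq_bigr => U _; rewrite big1_eq mul1r.
Qed.

(** * Selberg's diagonalisation *)

Lemma prod_setU_disjoint (I : finType) (A B : {set I}) (f : I -> R) : [disjoint A & B] ->
  \prod_(p in A :|: B) f p = (\prod_(p in A) f p) * \prod_(p in B) f p.
Proof.
by move=> dAB; rewrite (eq_bigl [predU A & B]) ?bigU // => p; rewrite !inE.
Qed.

Lemma prod_setU_inv (I : finType) (A B : {set I}) (f : I -> R) :
  (forall p, p \in A :&: B -> f p != 0) ->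
  \prod_(p in A :|: B) f p =
  (\prod_(p in A) f p) * (\prod_(p in B) f p) * \prod_(p in A :&: B) (f p)^-1.
Proof.
move=> f0; rewrite big_mkcond [X in _ = X * _ * _]big_mkcond.
rewrite [X in _ = _ * X * _]big_mkcond [X in _ = _ * X]big_mkcond -!big_split /=.
apply: eq_bigr => p _; move: (f0 p); rewrite !inE.
by case: (p \in A); case: (p \in B) => /= h; rewrite ?mulr1 ?mul1r // mulfK ?h.
Qed.

Lemma sum_superset (I : finType) (P V : {set I}) (F : {set I} -> R) : V \subset P ->
  \sum_(S : {set I} | (V \subset S) && (S \subset P)) F S =
  \sum_(U : {set I} | U \subset P :\: V) F (V :|: U).
Proof.
move=> VP.
rewrite (reindex_onto (fun U : {set I} => V :|: U) (fun S => S :\: V)) /=; last first.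
  by move=> S /andP[VS _]; rewrite -{1}(setIidPr VS) setID.
apply: eq_bigl => U; rewrite subsetUl subUset VP /= subsetD; congr (_ && _).
rewrite setDUl setDv set0U; by apply/eqP/setDidPl.
Qed.

(** The rule f([d,e]) = f(d) f(e) / f((d,e)), with 1/f((d,e)) expanded over the common subsets V of
    S and T as a sum of products of 1/b - 1. Summing over V last separates S from T and leaves a
    square. *)
Lemma quadratic_form_diag (I : finType) (P : {set I}) (b : I -> R) (l : {set I} -> R) :
  (forall p, p \in P -> b p != 0) ->
  \sum_(S : {set I} | S \subset P) \sum_(T : {set I} | T \subset P)
    l S * l T * \prod_(p in S :|: T) b p =
  \sum_(V : {set I} | V \subset P) (\prod_(p in V) ((b p)^-1 - 1)) *
    (\sum_(U : {set I} | U \subset P :\: V) l (V :|: U) * \prod_(p in V :|: U) b p) ^+ 2.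
Proof.
move=> b0.
pose a S := l S * \prod_(p in S) b p.
transitivity (\sum_(S : {set I} | S \subset P) \sum_(T : {set I} | T \subset P)
   \sum_(V : {set I} | V \subset P) (\prod_(p in V) ((b p)^-1 - 1)) *
     ((V \subset S)%:R * a S) * ((V \subset T)%:R * a T)).
  apply: eq_bigr => S SP; apply: eq_bigr => T TP.
  rewrite prod_setU_inv; last by move=> p; rewrite inE => /andP[/(subsetP SP)/b0].
  rewrite [X in _ * (_ * X)](eq_bigr (fun p => 1 + ((b p)^-1 - 1))); last by move=> p _; rewrite
    addrC subrK.
  rewrite prod_add_subsets !mulr_sumr.
  rewrite [RHS](bigID (fun V : {set I} => V \subset S :&: T)) /= [X in _ + X]big1 ?addr0; last
    first.
    move=> V /andP[_]; rewrite subsetI negb_and => /orP[]/negbTE->; by rewrite !(mul0r,mulr0).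
  apply: eq_big => V.
    rewrite andb_idl // subsetI => /andP[VS _]; exact: subset_trans VS SP.
  rewrite subsetI => /andP[-> ->]; rewrite big1_eq !mul1r /a; ring.
transitivity (\sum_(V : {set I} | V \subset P) \sum_(S : {set I} | S \subset P)
   \sum_(T : {set I} | T \subset P) (\prod_(p in V) ((b p)^-1 - 1)) *
     ((V \subset S)%:R * a S) * ((V \subset T)%:R * a T)).
  rewrite [RHS]exchange_big /=; apply: eq_bigr => S _; by rewrite exchange_big.
apply: eq_bigr => V VP.
have e : \sum_(S : {set I} | S \subset P) (V \subset S)%:R * a S =
   \sum_(U : {set I} | U \subset P :\: V) l (V :|: U) * \prod_(p in V :|: U) b p.
  rewrite -(sum_superset a VP) big_mkcond [RHS]big_mkcond; apply: eq_bigr => S _.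
  by case: (S \subset P); case: (V \subset S); rewrite /= ?mul1r ?mul0r.
rewrite -e expr2 big_distrlr /= mulr_sumr; apply: eq_bigr => S _.
by rewrite mulr_sumr; apply: eq_bigr => T _; ring.
Qed.

(* The sieve coefficients with diagonal variables [Y], where [a p] is the density of the
   residues removed at p; the usual y_r is Y_r * prod (1/a - 1). *)
Definition selberg (I : finType) (P : {set I}) (a : I -> R) (Y : {set I} -> R)
    (S : {set I}) : R :=
  (\prod_(p in S) - (a p)^-1) * \sum_(U : {set I} | U \subset P :\: S) Y (S :|: U).

(** Grouping by the union of the two sets involved, each prime outside V receives -b/a or 1, hence 1
    - b/a in total. For b = a only the empty U survives, which is Selberg's inversion; other b give
    the diagonal variables of a second form with the same coefficients. *)
Lemma selberg_transform (I : finType) (P V : {set I}) (a b : I -> R) (Y : {set I} -> R) :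
  V \subset P ->
  \sum_(U : {set I} | U \subset P :\: V)
     selberg P a Y (V :|: U) * \prod_(p in V :|: U) b p =
  (\prod_(p in V) - (b p / a p)) *
  \sum_(U : {set I} | U \subset P :\: V) (\prod_(p in U) (1 - b p / a p)) * Y (V :|: U).
Proof.
move=> VP.
rewrite [in RHS](eq_bigr (fun U : {set I} => (\prod_(p in U) (- (b p / a p) + 1)) * Y (V :|: U)));
  last by move=> U _; congr (_ * _); apply: eq_bigr => p _; rewrite addrC.
rewrite (sum_setU_split _ (fun p => - (b p / a p)) (fun=> 1) (fun T => Y (V :|: T))).
rewrite mulr_sumr; apply: eq_bigr => U; rewrite subsetD => /andP[UP dUV].
have dVU : [disjoint V & U] by rewrite disjoint_sym.
rewrite /selberg !mulr_sumr mulr_suml setDDl; apply: eq_bigr => T _.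
rewrite big1_eq mulr1 mulrAC -big_split /= mulrA -setUA; congr (_ * _).
by rewrite -prod_setU_disjoint //; apply: eq_bigr => p _; rewrite mulrC mulrN.
Qed.

Definition ycoef (c L : R) (N : nat) (V : {set 'I_N.+1}) : R :=
  L * E 0 (L - lg (dprod V)) + c * E 1 (L - lg (dprod V)).

(** The factor k/(p-k) is the inverse of 1/a - 1 for a = k/p, so [ycoef] is the usual diagonal
    variable. *)
Definition lam (w N k : nat) (c L : R) : {set 'I_N.+1} -> R :=
  selberg (sieving_primes w N) (fun p => k%:R / (p : nat)%:R)
    (fun V => ycoef c L V * \prod_(p in V) (k%:R / ((p : nat)%:R - k%:R))).

(* The quadratic form sum_(d, e) l_d l_e F([d, e]). *)
Definition quad (w N : nat) (l : {set 'I_N.+1} -> R) (F : {set 'I_N.+1} -> R) : R :=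
  \sum_(S : {set 'I_N.+1} | S \subset sieving_primes w N)
  \sum_(T : {set 'I_N.+1} | T \subset sieving_primes w N) l S * l T * F (S :|: T).

Lemma sieving_prime_gt w N k (p : 'I_N.+1) : (2 * k <= w)%N -> p \in sieving_primes w N ->
  0 < (p : nat)%:R :> R /\ (p : nat)%:R / 2 < (p : nat)%:R - k%:R :> R.
Proof.
move=> kw; rewrite inE => /andP[/prime_gt0 p0 wp]; split; first by rewrite ltr0n.
have : (2 * k < p)%N by apply: leq_ltn_trans kw wp.
by rewrite -(ltr_nat R) natrM => h; lra.
Qed.

(** The case b = a of [selberg_transform]; the local factor is (1/a - 1)(k/(p-k))^2 = k/(p-k). *)
Lemma quad_main1 w N k (c L : R) : (0 < k)%N -> (2 * k <= w)%N ->
  quad w (lam w k c L) (fun Q : {set 'I_N.+1} => \prod_(p in Q) (k%:R / (p : nat)%:R)) =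
  \sum_(V : {set 'I_N.+1} | V \subset sieving_primes w N)
    (\prod_(p in V) (k%:R / ((p : nat)%:R - k%:R))) * ycoef c L V ^+ 2.
Proof.
move=> k0 kw; have k0R : 0 < k%:R :> R by rewrite ltr0n.
have pk (p : 'I_N.+1) : p \in sieving_primes w N ->
    [/\ (p : nat)%:R != 0 :> R, (p : nat)%:R - k%:R != 0 :> R & k%:R / (p : nat)%:R != 0 :> R].
  move=> /(sieving_prime_gt kw) [h1 h2]; split; rewrite ?gt_eqF ?divr_gt0 //; lra.
rewrite /quad quadratic_form_diag; last by move=> p /pk[].
apply: eq_bigr => V VP; rewrite selberg_transform // (bigD1 set0) ?sub0set //=.
rewrite [X in _ + X]big1 ?addr0; last first.
  move=> U /andP[UP /set0Pn[p pU]]; rewrite (bigD1 p) //= mulfV ?subrr ?mul0r //.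
  by have := subsetP UP _ pU; rewrite inE => /andP[_ /pk[]].
rewrite big_set0 mul1r setU0 exprMn.
have -> : (\prod_(p in V) - (k%:R / (p : nat)%:R / (k%:R / (p : nat)%:R))) ^+ 2 = 1 :> R.
  rewrite -prodrXl big1 // => p /(subsetP VP)/pk[_ _ h].
  by rewrite mulfV // sqrrN expr1n.
rewrite mul1r exprMn [_ ^+ 2 * _]mulrC mulrA; congr (_ * _).
rewrite -prodrXl -big_split /=; apply: eq_bigr => p /(subsetP VP)/pk[h1 h2 _].
by field; rewrite h1 h2 gt_eqF.
Qed.

(** Here a = (m+1)/p and b = m/(p-1), and 1 - b/a times the factor (m+1)/(p-m-1) of [lam] is
    1/(p-1). The inner sums are thus those of [sum_subset_E_ge], which raises the kernels 0 and 1 of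
    [ycoef] to 1 and 2; they are nonnegative, so their lower bounds may be squared.
    [sieve_sum_lower] then evaluates the outer sum. *)
Lemma quad_main2_ge w N m (c L : R) : (0 < m)%N -> (2 * m.+1 <= w)%N -> 0 <= c -> 0 <= L ->
  L < lg N.+1 ->
  cW w ^+ m.+2 * (2 * L ^+ 2 * E m.+2 L + 6 * c * L * E m.+3 L + 6 * c ^+ 2 * E m.+4 L) <=
  quad w (lam w m.+1 c L) (fun Q : {set 'I_N.+1} => \prod_(p in Q) (m%:R / ((p : nat)%:R - 1))).
Proof.
move=> m0 mw c0 L0 LN; have m0R : 0 < m%:R :> R by rewrite ltr0n.
set P := sieving_primes w N.
have pk (p : 'I_N.+1) : p \in P -> 1 < (p : nat)%:R :> R /\ 0 < (p : nat)%:R - 1 - m%:R :> R.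
  rewrite inE => /andP[/prime_gt1 p1 wp]; split; first by rewrite ltr1n.
  have : (m.+1 < p)%N by apply: leq_ltn_trans wp; apply: leq_trans mw; rewrite leq_pmull.
  by rewrite -(ltr_nat R) -natr1 => h; lra.
rewrite /quad quadratic_form_diag; last first.
  by move=> p /pk[h1 h2]; rewrite mulf_neq0 ?invr_eq0 ?gt_eqF // subr_gt0.
pose G (u : R) : R := L * E 1 u + c * E 2 u.
have G0 u : 0 <= G u by rewrite addr_ge0 ?mulr_ge0 ?E_ge0.
apply: (@le_trans _ _ (\sum_(V : {set 'I_N.+1} | V \subset P)
   (\prod_(p in V) (m%:R / ((p : nat)%:R - 1 - m%:R))) *
   (cW w * G (L - lg (dprod V))) ^+ 2)).
  have mw' : (m < w)%N by apply: leq_trans mw; rewrite leq_pmull.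
  (* The coefficients come from E_1^2 = 2 E_2, E_1 E_2 = 3 E_3 and E_2^2 = 6 E_4. *)
  have G2 u : (cW w * G u) ^+ 2 = cW w ^+ 2 * (2 * L ^+ 2 * E 2 u + 6 * c * L * E 3 u + 6 * c ^+
    2 * E 4 u).
    have e11 := EM 1 1 u; have e12 := EM 1 2 u; have e22 := EM 2 2 u.
    move: e11 e12 e22; rewrite /= (_ : 'C(1 + 1, 1) = 2)%N // (_ : 'C(1 + 2, 1) = 3)%N //.
    rewrite (_ : 'C(2 + 2, 2) = 6)%N // !addSn !add0n => e11 e12 e22.
    have -> : (cW w * G u) ^+ 2 = cW w ^+ 2 * (L ^+ 2 * (E 1 u * E 1 u) + 2 * c * L * (E 1 u * E
      2 u)
       + c ^+ 2 * (E 2 u * E 2 u)) by rewrite /G; ring.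
    by rewrite e11 e12 e22; ring.
  under eq_bigr => V _ do rewrite G2.
  rewrite (_ : \sum_(V : {set 'I_N.+1} | _) _ =
    cW w ^+ 2 * (2 * L ^+ 2 * (\sum_(V : {set 'I_N.+1} | V \subset P) (\prod_(p in V) (m%:R /
      ((p : nat)%:R - 1 - m%:R))) * E 2 (L - lg (dprod V))) +
     6 * c * L * (\sum_(V : {set 'I_N.+1} | V \subset P) (\prod_(p in V) (m%:R / ((p : nat)%:R -
       1 - m%:R))) * E 3 (L - lg (dprod V))) +
     6 * c ^+ 2 * (\sum_(V : {set 'I_N.+1} | V \subset P) (\prod_(p in V) (m%:R / ((p : nat)%:R
       - 1 - m%:R))) * E 4 (L - lg (dprod V))))); last first.
    rewrite !mulr_sumr -!big_split /= mulr_sumr; apply: eq_bigr => V _; ring.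
  have H j := @sieve_sum_lower w N m j L mw' LN.
  rewrite [leLHS](_ : _ = cW w ^+ 2 * (2 * L ^+ 2 * (cW w ^+ m * E (2 + m) L) +
     6 * c * L * (cW w ^+ m * E (3 + m) L) + 6 * c ^+ 2 * (cW w ^+ m * E (4 + m) L))); last first.
    by rewrite !exprS !addSn add0n; ring.
  apply: ler_wpM2l; first by rewrite exprn_ge0 ?cW_ge0.
  apply: lerD; [apply: lerD|]; apply: ler_wpM2l (H _).
  - by rewrite mulr_ge0 ?exprn_ge0.
  - by rewrite !mulr_ge0.
  - by rewrite mulr_ge0 ?exprn_ge0.
apply: ler_sum => V VP; rewrite selberg_transform //.
rewrite [X in _ <= _ * (_ * X) ^+ 2](_ : _ = (\prod_(p in V) (m.+1%:R / ((p : nat)%:R - m.+1%:R))) *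
   (\sum_(U : {set 'I_N.+1} | U \subset P :\: V)
     (\prod_(p in U) ((p : nat)%:R - 1)^-1) * ycoef c L (V :|: U))); last first.
  rewrite mulr_sumr; apply: eq_bigr => U; rewrite subsetD => /andP[UP dUV].
  rewrite prod_setU_disjoint; last by rewrite disjoint_sym.
  have -> : \prod_(p in U) ((p : nat)%:R - 1)^-1 = \prod_(p in U) (1 - m%:R / ((p : nat)%:R - 1)
    / (m.+1%:R / (p : nat)%:R)) *
     \prod_(p in U) (m.+1%:R / ((p : nat)%:R - m.+1%:R)) :> R.
    rewrite -big_split /=; apply: eq_bigr => p /(subsetP UP)/pk[h1 h2].
    by rewrite -natr1; field; rewrite !gt_eqF; lra.
  ring.
set S := \sum_(U : {set 'I_N.+1} | _) _.
rewrite [leRHS](_ : _ = (\prod_(p in V) (m%:R / ((p : nat)%:R - 1 - m%:R))) *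
   ((\prod_(p in V) (1 - (p : nat)%:R^-1)^-1) * S) ^+ 2); last first.
  (* The factors 1/(1 - 1/p) that appear here compensate exactly for the factors 1 - 1/p lost in
     [sum_subset_E_ge]. *)
  have key : \prod_(p in V) ((m%:R / ((p : nat)%:R - 1))^-1 - 1) *
      (\prod_(p in V) - (m%:R / ((p : nat)%:R - 1) / (m.+1%:R / (p : nat)%:R))) ^+ 2 *
      (\prod_(p in V) (m.+1%:R / ((p : nat)%:R - m.+1%:R))) ^+ 2 =
      \prod_(p in V) (m%:R / ((p : nat)%:R - 1 - m%:R)) *
      (\prod_(p in V) (1 - (p : nat)%:R^-1)^-1) ^+ 2 :> R.
    rewrite -!prodrXl -!big_split /=; apply: eq_bigr => p /(subsetP VP)/pk[h1 h2].
    by rewrite -natr1; field; rewrite !gt_eqF; lra.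
  transitivity (\prod_(p in V) (m%:R / ((p : nat)%:R - 1 - m%:R)) *
      (\prod_(p in V) (1 - (p : nat)%:R^-1)^-1) ^+ 2 * S ^+ 2); last by ring.
  by rewrite -key; ring.
rewrite ler_wpM2l //.
  by apply: prodr_ge0 => p /(subsetP VP)/pk[h1 h2]; rewrite divr_ge0 //; lra.
have q0 : 0 < \prod_(p in V) (1 - ((p : nat)%:R : R)^-1).
  apply: prodr_gt0 => p /(subsetP VP)/pk[h1 h2]; rewrite subr_gt0 invf_lt1; lra.
rewrite lerXn2r ?nnegrE //; first by rewrite mulr_ge0 ?cW_ge0.
  rewrite mulr_ge0 ?prodfV ?invr_ge0 ?(ltW q0) //; apply: sumr_ge0 => U UP.
  rewrite mulr_ge0 ?addr_ge0 ?mulr_ge0 ?E_ge0 //; apply: prodr_ge0 => p.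
  by move=> /(subsetP UP); rewrite inE => /andP[_ /pk[h1 h2]]; rewrite invr_ge0; lra.
rewrite prodfV ler_pdivlMl // /S /ycoef.
have LV : L - lg (dprod V) < lg N.+1 by have := lg_ge0 (dprod V); lra.
rewrite [leRHS](_ : _ =
   L * (\sum_(U : {set 'I_N.+1} | U \subset P :\: V)
       (\prod_(p in U) ((p : nat)%:R - 1)^-1) * E 0 (L - lg (dprod V) - lg (dprod U))) +
   c * (\sum_(U : {set 'I_N.+1} | U \subset P :\: V)
       (\prod_(p in U) ((p : nat)%:R - 1)^-1) * E 1 (L - lg (dprod V) - lg (dprod U)))); last first.
  rewrite !mulr_sumr -big_split /=; apply: eq_bigr => U UP.
  by rewrite (lg_dprodU VP UP) opprD addrA; ring.
apply: le_trans (lerD (ler_wpM2l L0 (sum_subset_E_ge 0 LV VP)) (ler_wpM2l c0 (sum_subset_E_ge 1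
  LV VP))).
rewrite /G le_eqVlt; apply/orP; left; apply/eqP; ring.
Qed.

(** The bound of [prod1D_kappa_le] for the local factors beyond w; it tends to 1 as w grows. *)
Definition Kw (k w : nat) : R := (1 - (2 * k ^ 2)%N%:R / w%:R)^-1.

Lemma Kw_gt0 k w : (2 * k ^ 2 < w)%N -> 0 < Kw k w.
Proof.
move=> h; have w0 : 0 < w%:R :> R by rewrite ltr0n (leq_ltn_trans _ h).
by rewrite invr_gt0 subr_gt0 ltr_pdivrMr // mul1r ltr_nat.
Qed.

Lemma sieve_sum_upper_main k w : (2 * k <= w)%N -> (2 * k ^ 2 < w)%N ->
  exists2 C : R, 0 <= C & forall (N j : nat) (u : R), 1 <= u ->
  \sum_(V : {set 'I_N.+1} | V \subset sieving_primes w N)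
    (\prod_(p in V) (k%:R / ((p : nat)%:R - k%:R))) * E j (u - lg (dprod V)) <=
  Kw k w * cW w ^+ k * (E (j + k) u + C * (u ^+ (j + k) / u)).
Proof.
move=> h1 h2; have [C C0 hC] := sieve_sum_upper w k; exists C => // N j u u1.
apply: le_trans (sieve_sum_upper_kappa _ _ _ h1 h2) _; rewrite -/(Kw k w) -mulrA.
by apply: ler_wpM2l; [exact: ltW (Kw_gt0 h2) | exact: hC].
Qed.

(** Squaring [ycoef] with E_0^2 = E_0, E_0 E_1 = E_1 and E_1^2 = 2 E_2 leaves three instances of
    [sieve_sum_upper_main], each with an error of order L^(k+1). *)
Lemma quad_main1_le w k (c : R) : (0 < k)%N -> (2 * k <= w)%N -> (2 * k ^ 2 < w)%N -> 0 <= c ->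
  exists2 C : R, 0 <= C & forall (N : nat) (L : R), 1 <= L ->
  quad w (lam w k c L) (fun Q : {set 'I_N.+1} => \prod_(p in Q) (k%:R / (p : nat)%:R)) <=
  Kw k w * cW w ^+ k * (L ^+ 2 * E k L + 2 * c * L * E k.+1 L + 2 * c ^+ 2 * E k.+2 L
     + C * L ^+ k.+1).
Proof.
move=> k0 h1 h2 c0; have [C C0 hC] := sieve_sum_upper_main h1 h2.
exists (C * (1 + 2 * c + 2 * c ^+ 2)).
  by rewrite mulr_ge0 // !addr_ge0 ?mulr_ge0 ?exprn_ge0.
move=> N L L1; have L0 : 0 < L by lra.
rewrite quad_main1 //.
have y2 (V : {set 'I_N.+1}) : ycoef c L V ^+ 2 =
    L ^+ 2 * E 0 (L - lg (dprod V)) + 2 * c * L * E 1 (L - lg (dprod V)) + 2 * c ^+ 2 * E 2 (L -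
      lg (dprod V)).
  rewrite /ycoef; set u := L - _.
  have e00 := EM 0 0 u; have e01 := EM 0 1 u; have e11 := EM 1 1 u.
  move: e00 e01 e11; rewrite !addSn !add0n => e00 e01 e11.
  have -> : (L * E 0 u + c * E 1 u) ^+ 2 = L ^+ 2 * (E 0 u * E 0 u) + 2 * c * L * (E 0 u * E 1 u)
       + c ^+ 2 * (E 1 u * E 1 u) by ring.
  by rewrite e00 e01 e11 (_ : 'C(0, 0) = 1)%N // (_ : 'C(1, 0) = 1)%N // (_ : 'C(2, 1) = 2)%N
    //; ring.
under eq_bigr => V _ do rewrite y2.
rewrite (_ : \sum_(V : {set 'I_N.+1} | _) _ =
   L ^+ 2 * (\sum_(V : {set 'I_N.+1} | V \subset sieving_primes w N) (\prod_(p in V) (k%:R / ((p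
     : nat)%:R - k%:R))) * E 0 (L - lg (dprod V))) +
   2 * c * L * (\sum_(V : {set 'I_N.+1} | V \subset sieving_primes w N) (\prod_(p in V) (k%:R /
     ((p : nat)%:R - k%:R))) * E 1 (L - lg (dprod V))) +
   2 * c ^+ 2 * (\sum_(V : {set 'I_N.+1} | V \subset sieving_primes w N) (\prod_(p in V) (k%:R /
     ((p : nat)%:R - k%:R))) * E 2 (L - lg (dprod V)))); last first.
  by rewrite !mulr_sumr -!big_split /=; apply: eq_bigr => V _; ring.
have H j := hC N j L L1.
have a1 : 0 <= L ^+ 2 by rewrite exprn_ge0 // ltW.
have a2 : 0 <= 2 * c * L by rewrite !mulr_ge0 // ltW.
have a3 : 0 <= 2 * c ^+ 2 by rewrite mulr_ge0 ?exprn_ge0.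
apply: le_trans (lerD (lerD (ler_wpM2l a1 (H 0%N)) (ler_wpM2l a2 (H 1%N))) (ler_wpM2l a3 (H
  2%N))) _.
rewrite le_eqVlt; apply/orP; left; apply/eqP; rewrite !addSn !add0n !exprS.
by field; rewrite gt_eqF.
Qed.

(** * The error term *)

Lemma dprod_setU_le w N (S T : {set 'I_N.+1}) :
  S \subset sieving_primes w N -> T \subset sieving_primes w N ->
  lg (dprod (S :|: T)) <= lg (dprod S) + lg (dprod T).
Proof.
move=> SP TP; have TSP : T :\: S \subset sieving_primes w N.
  by apply: subset_trans TP; apply: subsetDl.
have TSPS : T :\: S \subset sieving_primes w N :\: S by apply: setSD.
have -> : S :|: T = S :|: (T :\: S) by rewrite setDE setUIr setUCr setIT.
rewrite (lg_dprodU SP TSPS) lerD2l ler_lg ?(dprod_gt0 TSP) //.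
apply: dvdn_leq; first exact: (dprod_gt0 TP).
apply: (dprod_dvd TSP) => p; rewrite inE => /andP[_ pT].
by rewrite (prime_dvd_dprod TP) //; case: (sieving_primesP TP pT).
Qed.

Lemma ycoef_ge0 (c L : R) N (V : {set 'I_N.+1}) : 0 <= c -> 0 <= L -> 0 <= ycoef c L V.
Proof. by move=> c0 L0; rewrite addr_ge0 ?mulr_ge0 ?E_ge0. Qed.

Lemma ycoef_le (c L : R) N (V : {set 'I_N.+1}) : 0 <= c -> 0 <= L ->
  ycoef c L V <= (1 + c) * L * E 0 (L - lg (dprod V)).
Proof.
move=> c0 L0; rewrite /ycoef -mulrA mulrDl mul1r lerD2l ler_wpM2l //.
rewrite /E; case: ifP => u0; last by rewrite mulr0.
by rewrite expr1 expr0 !divr1 mulr1 gerBl lg_ge0.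
Qed.

(** The coefficient at S is built from [ycoef] at sets containing S, whose logarithms all exceed L,
    so both kernels vanish. *)
Lemma lam_supp w N k (c L : R) (S : {set 'I_N.+1}) :
  S \subset sieving_primes w N -> L < lg (dprod S) -> lam w k c L S = 0.
Proof.
move=> SP LS; rewrite /lam /selberg [X in _ * X]big1 ?mulr0 // => U UP.
have h : L - lg (dprod (S :|: U)) < 0.
  by rewrite (lg_dprodU SP UP); have := lg_ge0 (dprod U); lra.
by rewrite /ycoef !E_neg // !mulr0 addr0 mul0r.
Qed.

(** The factor 2 per prime is p/(p-k) <= 2. Powers of L are given away freely: the conditions save
    any power of log N. *)
Lemma lam_bound w k (c : R) : (0 < k)%N -> (2 * k <= w)%N -> (2 * k ^ 2 < w)%N -> 0 <= c ->
  exists2 C : R, 0 <= C & forall (N : nat) (L : R) (S : {set 'I_N.+1}), 1 <= L ->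
  S \subset sieving_primes w N -> `|lam w k c L S| <= C * 2 ^+ #|S| * L ^+ k.+1.
Proof.
move=> k0 h1 h2 c0; have [C C0 hC] := sieve_sum_upper_main h1 h2.
have K0 := ltW (Kw_gt0 h2).
have KW0 : 0 <= Kw k w * cW w ^+ k by rewrite mulr_ge0 ?exprn_ge0 ?cW_ge0.
exists ((1 + c) * (Kw k w * cW w ^+ k * (1 + C))).
  by rewrite !mulr_ge0 ?addr_ge0 ?exprn_ge0 ?cW_ge0.
move=> N L S L1 SP; have L0 : 0 < L by lra.
set P := sieving_primes w N in SP *.
have pk (p : 'I_N.+1) : p \in P -> 0 < (p : nat)%:R :> R /\ (p : nat)%:R / 2 < (p : nat)%:R -
  k%:R :> R.
  exact: sieving_prime_gt.
have kpos (V : {set 'I_N.+1}) : V \subset P -> 0 <= \prod_(p in V) (k%:R / ((p : nat)%:R -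
  k%:R)) :> R.
  move=> VP; apply: prodr_ge0 => p /(subsetP VP)/pk[h3 h4]; rewrite divr_ge0 //; lra.
rewrite /lam /selberg normrM normr_prod.
rewrite [X in _ * X]ger0_norm; last first.
  apply: sumr_ge0 => U; rewrite subsetD => /andP[UP _].
  by rewrite mulr_ge0 ?ycoef_ge0 ?(ltW L0) // kpos // subUset SP.
apply: (@le_trans _ _ ((\prod_(p in S) `|- (k%:R / ((p : nat)%:R : R))^-1|) *
   ((\prod_(p in S) (k%:R / ((p : nat)%:R - k%:R))) * ((1 + c) * L *
   \sum_(U : {set 'I_N.+1} | U \subset P) (\prod_(p in U) (k%:R / ((p : nat)%:R - k%:R))) * E 0
     (L - lg (dprod U)))))).
  rewrite ler_wpM2l //; first by apply: prodr_ge0.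
  rewrite !mulr_sumr.
  apply: (@ler_sum_inj _ _ _ _ _ _ id) => // U.
  - by rewrite subsetD => /andP[].
  - move=> UP; have := UP; rewrite subsetD => /andP[UP' dUS].
    rewrite prod_setU_disjoint; last by rewrite disjoint_sym.
    rewrite mulrCA ler_wpM2l ?kpos // mulrC [leRHS]mulrCA ler_wpM2l ?kpos //.
    apply: le_trans (ycoef_le _ c0 (ltW L0)) _.
    rewrite ler_wpM2l ?mulr_ge0 ?addr_ge0 ?(ltW L0) //; apply: E_le.
    by rewrite (lg_dprodU SP UP); have := lg_ge0 (dprod S); lra.
  - by move=> UP; rewrite !mulr_ge0 ?kpos ?addr_ge0 ?E_ge0 ?(ltW L0).
have s0 : 0 <= (1 + c) * L by rewrite mulr_ge0 ?addr_ge0 ?(ltW L0).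
have E0L : E (0 + k) L + C * (L ^+ (0 + k) / L) <= (1 + C) * L ^+ k.
  rewrite add0n mulrDl mul1r lerD ?E_le_exp ?(ltW L0) // ler_wpM2l // ler_pdivrMr //.
  by rewrite ler_peMr // exprn_ge0 // ltW.
have h3 := le_trans (hC N 0%N L L1) (ler_wpM2l KW0 E0L).
rewrite [leLHS]mulrA -big_split /=.
rewrite [leRHS](_ : _ = 2 ^+ #|S| * ((1 + c) * L * (Kw k w * cW w ^+ k * ((1 + C) * L ^+ k))));
  last first.
  by rewrite exprS; ring.
apply: ler_pM.
- by apply: prodr_ge0 => p pS; rewrite mulr_ge0 //; have := kpos [set p]; rewrite sub1set
  big_set1; apply; apply: (subsetP SP).
- rewrite mulr_ge0 //; apply: sumr_ge0 => U UP; rewrite mulr_ge0 ?E_ge0 ?kpos //.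
- rewrite -[leRHS]prodr_const; apply: ler_prod => p /(subsetP SP)/pk[h4 h5].
  have kR : 0 < k%:R :> R by rewrite ltr0n.
  rewrite normrN ger0_norm; last by rewrite invr_ge0 divr_ge0 ?ltW.
  have -> : (k%:R / (p : nat)%:R)^-1 * (k%:R / ((p : nat)%:R - k%:R)) = (p : nat)%:R / ((p :
    nat)%:R - k%:R) :> R.
    by field; rewrite !gt_eqF //; lra.
  apply/andP; split; first by rewrite divr_ge0; lra.
  by rewrite ler_pdivrMr; lra.
- by rewrite ler_wpM2l.
Qed.

(** If S and T have union Q, both are subsets of Q, which leaves at most 4^|Q| pairs. *)
Lemma sum_pairs_setU_le (I : finType) (P : {set I}) (g : {set I} -> R) :
  (forall Q : {set I}, Q \subset P -> 0 <= g Q) ->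
  \sum_(S : {set I} | S \subset P) \sum_(T : {set I} | T \subset P) g (S :|: T) <=
  \sum_(Q : {set I} | Q \subset P) 4 ^+ #|Q| * g Q.
Proof.
move=> g0; rewrite pair_big /=.
rewrite (partition_big (fun q : {set I} * {set I} => q.1 :|: q.2) (fun Q : {set I} => Q \subset
  P)) /=; last first.
  by move=> [S T] /=; rewrite subUset.
apply: ler_sum => Q QP.
apply: (@le_trans _ _ (\sum_(q in setX (powerset Q) (powerset Q)) g Q)); last first.
  by rewrite sumr_const cardsX card_powerset -expnMn -[leLHS]mulr_natl -natrX.
apply: (@ler_sum_inj _ _ _ _ _ _ id) => //= [[S T]|[S T]|[S T] _] /=.
- by move=> /andP[_ /eqP <-]; rewrite !inE /= subsetUl subsetUr.
- by move=> /andP[_ /eqP ->].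
- exact: g0.
Qed.

(* The multiplicities D^|Q| are removed by D^|Q| <= Z + D^(2|Q|) / Z with Z a power of ell:
   the first part is controlled by the level of distribution, the second by the trivial
   bound for [err]. *)
Lemma error_sum_le w k (c : R) : (0 < k)%N -> (2 * k <= w)%N -> (2 * k ^ 2 < w)%N -> 0 <= c ->
  exists A : nat, forall C1 C2 : R, 0 <= C1 -> 0 <= C2 -> exists2 C3 : R, 0 <= C3 &
  forall (N : nat) (L ell X : R) (err : {set 'I_N.+1} -> R), 1 <= L -> L <= ell -> 0 <= X ->
  (forall Q : {set 'I_N.+1}, Q \subset sieving_primes w N -> lg (dprod Q) <= 2 * L ->
     0 <= err Q <= C1 * X * ell * 2 ^+ #|Q| / (dprod Q)%:R) ->
  \sum_(Q : {set 'I_N.+1} | (Q \subset sieving_primes w N) && (lg (dprod Q) <= 2 * L)) err Q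
     <= C2 * X / ell ^+ A ->
  \sum_(S : {set 'I_N.+1} | S \subset sieving_primes w N)
  \sum_(T : {set 'I_N.+1} | T \subset sieving_primes w N)
    `|lam w k c L S * lam w k c L T| * (k%:R ^+ #|S :|: T| * err (S :|: T)) <= C3 * X.
Proof.
move=> k0 h1 h2 c0; have [CL CL0 hL] := lam_bound k0 h1 h2 c0.
(* D collects 4 from the pairs with a given union, 4 from the two factors 2^|S| 2^|T|, and k from
   the residue classes. M has D^2 from the quadratic term and 2 from the bound on [err]. The
   exponent r comes from L^(k+1) taken twice, and z is chosen so that 1/Z absorbs ell^r, ell^M and
   one more ell. *)
pose D := (16 * k)%N; pose M := (2 * D ^ 2)%N.
have [CM CM0 hM] := sieve_sum_upper w M.
pose r := (2 * k.+1)%N; pose z := (r + M.+1)%N.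
exists (r + z)%N => C1 C2 C10 C20.
pose CMM : R := cW w ^+ M * (1 + CM) * 2 ^+ M.
have CMM0 : 0 <= CMM by rewrite !mulr_ge0 ?exprn_ge0 ?cW_ge0 ?addr_ge0.
exists (CL ^+ 2 * (C2 + C1 * CMM)); first by apply: mulr_ge0; rewrite ?exprn_ge0 // addr_ge0 //
  mulr_ge0.
move=> N L ell X err L1 Lell X0 herr hsum.
set P := sieving_primes w N in herr hsum *.
have L0 : 0 < L by lra.
have ell1 : 1 <= ell by lra.
have ell0 : 0 < ell by lra.
pose F (Q : {set 'I_N.+1}) : R := if lg (dprod Q) <= 2 * L then err Q else 0.
have F0 (Q : {set 'I_N.+1}) : Q \subset P -> 0 <= F Q.
  by move=> QP; rewrite /F; case: ifP => // /(herr _ QP)/andP[].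
pose D0 : R := (4 * k)%N%:R.
apply: (@le_trans _ _ (\sum_(S : {set 'I_N.+1} | S \subset P) \sum_(T : {set 'I_N.+1} | T \subset P)
   CL ^+ 2 * ell ^+ r * (D0 ^+ #|S :|: T| * F (S :|: T)))).
  apply: ler_sum => S SP; apply: ler_sum => T TP.
  have STP : S :|: T \subset P by rewrite subUset SP.
  have rhs0 : 0 <= CL ^+ 2 * ell ^+ r * (D0 ^+ #|S :|: T| * F (S :|: T)).
    by rewrite !mulr_ge0 ?exprn_ge0 ?F0 // ltW.
  have [LS|LS] := ltP L (lg (dprod S)).
    by rewrite (lam_supp _ _ SP LS) mul0r normr0 mul0r.
  have [LT|LT] := ltP L (lg (dprod T)).
    by rewrite (lam_supp _ _ TP LT) mulr0 normr0 mul0r.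
  have l2 : lg (dprod (S :|: T)) <= 2 * L by have := dprod_setU_le SP TP; lra.
  rewrite /F l2; have /andP[e0 _] := herr _ STP l2.
  rewrite [leLHS]mulrA [leRHS]mulrA; apply: ler_wpM2r => //.
  rewrite /D0 natrM exprMn [leRHS]mulrA; apply: ler_wpM2r; first by rewrite exprn_ge0.
  rewrite normrM.
  apply: le_trans (ler_pM _ _ (hL _ _ _ L1 SP) (hL _ _ _ L1 TP)) _ => //.
  rewrite [leLHS](_ : _ = CL ^+ 2 * (2 ^+ #|S| * 2 ^+ #|T|) * L ^+ r); last first.
    by rewrite /r mul2n -addnn exprD; ring.
  rewrite mulrAC ler_pM ?mulr_ge0 ?exprn_ge0 //; try lra.
    by rewrite ler_wpM2l ?exprn_ge0 // lerXn2r ?nnegrE //; lra.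
  rewrite (_ : 4 = 2 * 2 :> R); last by ring.
  rewrite exprMn ler_pM ?exprn_ge0 // ler_weXn2l ?ler1n // subset_leq_card //.
    exact: subsetUl.
  exact: subsetUr.
under eq_bigr => S _ do rewrite -mulr_sumr.
rewrite -mulr_sumr.
have c1 : 0 <= CL ^+ 2 * ell ^+ r by rewrite mulr_ge0 ?exprn_ge0 // ltW.
have D00 : 0 <= D0 by [].
apply: le_trans (ler_wpM2l c1 (@sum_pairs_setU_le _ P (fun Q => D0 ^+ #|Q| * F Q) _)) _.
  by move=> Q QP; rewrite mulr_ge0 ?exprn_ge0 ?F0.
pose Z := ell ^+ z.
have Z0 : 0 < Z by rewrite exprn_gt0.
apply: (@le_trans _ _ (CL ^+ 2 * ell ^+ r * (\sum_(Q : {set 'I_N.+1} | Q \subset P)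
    (Z * F Q + Z^-1 * (C1 * X * ell) * ((\prod_(p in Q) (M%:R / (p : nat)%:R)) * E 0 (2 * L - lg
      (dprod Q))))))).
  rewrite ler_wpM2l //; apply: ler_sum => Q QP.
  rewrite mulrA -exprMn (_ : 4 * D0 = D%:R); last by rewrite /D0 /D -natrM mulnA.
  rewrite /F /E subr_ge0; case: ifP => l2; last by rewrite !mulr0 addr0.
  have /andP[e0 e1] := herr _ QP l2.
  rewrite expr0 fact0 divr1 mulr1.
  apply: (@le_trans _ _ (Z * err Q + Z^-1 * (D%:R ^+ 2) ^+ #|Q| * err Q)).
    rewrite -mulrDl ler_wpM2r //; set x : R := D%:R ^+ #|Q|.
    have -> : (D%:R ^+ 2) ^+ #|Q| = x ^+ 2 :> R by rewrite /x -!exprM mulnC.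
    have x0 : 0 <= x by rewrite exprn_ge0.
    rewrite -subr_ge0 -(pmulr_rge0 _ Z0).
    rewrite (_ : Z * _ = (Z - x / 2) ^+ 2 + 3 / 4 * x ^+ 2); last by field; rewrite gt_eqF.
    by apply: addr_ge0; [exact: sqr_ge0 | apply: mulr_ge0; [rewrite divr_ge0 | exact: sqr_ge0]].
  have -> : \prod_(p in Q) (M%:R / (p : nat)%:R) = (D%:R ^+ 2) ^+ #|Q| * (2 ^+ #|Q| / (dprod
    Q)%:R) :> R.
    rewrite big_split /= prodr_const prodfV -natr_dprod /M natrM natrX exprMn.
    by rewrite mulrA; congr (_ / _); rewrite mulrC.
  rewrite lerD2l; set y : R := (D%:R ^+ 2) ^+ #|Q|.
  have y0 : 0 <= Z^-1 * y by rewrite mulr_ge0 ?invr_ge0 ?(ltW Z0) // exprn_ge0 // exprn_ge0.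
  apply: le_trans (ler_wpM2l y0 e1) _.
  by rewrite le_eqVlt; apply/orP; left; apply/eqP; ring.
rewrite big_split /= -!mulr_sumr.
rewrite (_ : \sum_(Q : {set 'I_N.+1} | Q \subset P) F Q =
   \sum_(Q : {set 'I_N.+1} | (Q \subset P) && (lg (dprod Q) <= 2 * L)) err Q); last first.
  by rewrite [RHS]big_mkcondr.
have L21 : 1 <= 2 * L by lra.
have hM' : \sum_(Q : {set 'I_N.+1} | Q \subset P) (\prod_(p in Q) (M%:R / (p : nat)%:R)) * E 0
  (2 * L - lg (dprod Q))
   <= CMM * ell ^+ M.
  apply: le_trans (hM N 0%N _ L21) _; rewrite /CMM -!mulrA ler_wpM2l ?exprn_ge0 ?cW_ge0 // add0n.
  apply: (@le_trans _ _ ((1 + CM) * (2 * L) ^+ M)).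
    rewrite [leRHS]mulrDl [X in _ <= X + _]mul1r; apply: lerD; first by apply: E_le_exp; lra.
    rewrite ler_wpM2l // ler_pdivrMr; last by lra.
    by rewrite ler_peMr // exprn_ge0 //; lra.
  rewrite ler_wpM2l ?addr_ge0 // exprMn ler_wpM2l ?exprn_ge0 //.
  by rewrite lerXn2r ?nnegrE //; lra.
have c2 : 0 <= Z^-1 * (C1 * X * ell) by rewrite !mulr_ge0 ?invr_ge0 // ltW.
apply: le_trans (ler_wpM2l c1 (lerD (ler_wpM2l (ltW Z0) hsum) (ler_wpM2l c2 hM'))) _.
rewrite le_eqVlt; apply/orP; left; apply/eqP.
have er0 : ell ^+ r != 0 by rewrite expf_neq0 // gt_eqF.
have eM0 : ell ^+ M != 0 by rewrite expf_neq0 // gt_eqF.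
rewrite /Z exprD /z exprD (exprS ell M).
move: (ell ^+ r) (ell ^+ M) er0 eM0 => er eM er0 eM0.
by field; rewrite er0 eM0 gt_eqF.
Qed.

(** * Residue classes *)

Lemma card_chinese (m n : nat) (a b : pred nat) : (0 < m)%N -> (0 < n)%N -> coprime m n ->
  #|[set x : 'I_(m * n) | a (x %% m)%N && b (x %% n)%N]| =
  (#|[set x : 'I_m | a x]| * #|[set x : 'I_n | b x]|)%N.
Proof.
move=> m0 n0 cmn.
pose f (x : 'I_(m * n)) := (Ordinal (ltn_pmod x m0), Ordinal (ltn_pmod x n0)).
have fi : injective f.
  move=> x y [e1 e2]; apply: val_inj => /=.
  rewrite -(modn_small (ltn_ord x)) -(modn_small (ltn_ord y)).
  by rewrite (chinese_mod cmn x) (chinese_mod cmn y) e1 e2.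
have fb : bijective f by apply: inj_card_bij => //; rewrite card_prod !card_ord.
rewrite -cardsX -(on_card_preimset (f := f)); last exact: onW_bij.
by apply: eq_card => x; rewrite !inE.
Qed.

Definition hit (gs : seq nat) (p n : nat) : bool := has (fun g => p %| n + g)%N gs.

Lemma hit_mod gs p q n : (p %| q)%N -> hit gs p (n %% q)%N = hit gs p n.
Proof.
move=> pq; apply: eq_has => g.
by rewrite /dvdn -modnDml modn_dvdm // modnDml.
Qed.

(** The classes hit are those of -g, which are distinct because the g are distinct and below p. *)
Lemma card_hit p gs : prime p -> uniq gs -> all (fun g => g < p)%N gs ->
  #|[set a : 'I_p | hit gs p a]| = size gs.
Proof.
move=> pp ugs gsp; have p0 := prime_gt0 pp.
pose f g := Ordinal (ltn_pmod (p - g) p0).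
have fe g (a : 'I_p) : (g < p)%N -> (p %| a + g)%N = (a == f g).
  move=> gp; have ap := ltn_ord a; apply/idP/eqP => [|->] /=.
    move=> d; apply: val_inj => /=; rewrite -(modn_small ap); apply/eqP.
    by rewrite -(eqn_modDr g) subnK ?(ltnW gp) // modnn; apply/eqP; apply/eqP: d.
  by rewrite /dvdn modnDml subnK ?(ltnW gp) // modnn.
rewrite -(size_map f) (_ : #|_| = #|map f gs|); last first.
  apply: eq_card => a; rewrite !inE /hit; apply/hasP/mapP => -[g gs_g].
    by rewrite fe ?(allP gsp) // => /eqP ->; exists g.
  by move=> e; exists g => //; rewrite fe ?(allP gsp) // e.
apply/card_uniqP; rewrite map_inj_in_uniq // => g h gs_g gs_h e.
have gp := allP gsp _ gs_g; have hp := allP gsp _ gs_h.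
have : (p %| f g + g)%N by rewrite fe ?eqxx.
rewrite /dvdn => /eqP e1; have : (p %| f g + h)%N by rewrite fe // e.
rewrite /dvdn => /eqP e2; apply/eqP.
rewrite -(modn_small gp) -(modn_small hp) -(eqn_modDl (f g)) e1 e2 //.
Qed.

(** Chinese remainder theorem, one prime of Q at a time; the single class modulo w! is the base
    case. *)
Lemma card_residues w N b gs (Q : {set 'I_N.+1}) q : uniq gs -> all (fun g => g <= w)%N gs ->
  Q \subset sieving_primes w N -> q = (w`! * dprod Q)%N ->
  #|[set a : 'I_q | (a == b %[mod w`!]) && [forall p in Q, hit gs p a]]| = (size gs ^ #|Q|)%N.
Proof.
move=> ugs gsw; have [m] := ubnP #|Q|; elim: m Q q => // m IH Q q.
rewrite ltnS => Qm QP ->; have W0 := fact_gt0 w.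
have [Q0|[p pQ]] := set_0Vmem Q.
  rewrite Q0 dprod0 muln1 cards0 expn0; apply/eqP/cards1P.
  exists (Ordinal (ltn_pmod b W0)); apply/setP => a; rewrite !inE.
  have -> : [forall p in (set0 : {set 'I_N.+1}), hit gs p a] by apply/forall_inP => p; rewrite inE.
  rewrite andbT -val_eqE /= (modn_small (ltn_ord a)) //.
have QpP : Q :\ p \subset sieving_primes w N by apply: subset_trans (subsetDl _ _) QP.
have [pp wp] := sieving_primesP QP pQ.
set q' := (w`! * dprod (Q :\ p))%N.
have q'0 : (0 < q')%N by rewrite muln_gt0 W0 (dprod_gt0 QpP).
have e : (w`! * dprod Q = q' * p)%N by rewrite /dprod (big_setD1 p) //= mulnCA mulnC.
have cq : coprime q' p.
  rewrite coprime_sym prime_coprime // Euclid_dvdM // prime_dvd_fact // leqNgt wp /=.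
  by rewrite (prime_dvd_dprod QpP) // !inE eqxx.
rewrite e (cardsD1 p Q) pQ expnD [RHS]mulnC expn1 -(IH (Q :\ p) q') //; last first.
  by move: Qm; rewrite (cardsD1 p Q) pQ.
rewrite -(card_hit pp ugs); last by apply: sub_all gsw => g /leq_ltn_trans; apply.
rewrite -(@card_chinese q' p (fun a => (a == b %[mod w`!]) && [forall r in Q :\ p, hit gs r a])
  (hit gs p) q'0 (prime_gt0 pp) cq).
apply: eq_card => a; rewrite !inE modn_dvdm ?dvdn_mulr // -andbA; congr (_ && _).
rewrite hit_mod //; apply/forall_inP/andP => [H|[/forall_inP H1 H2] r rQ].
  split; last exact: H; apply/forall_inP => r rQp; have := rQp; rewrite !inE => /andP[_ rQ].
  rewrite hit_mod ?H // dvdn_mull // (prime_dvd_dprod QpP) //.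
  by have [] := sieving_primesP QP rQ.
have [->//|rp] := eqVneq r p.
have rQp : r \in Q :\ p by rewrite !inE rp.
rewrite -(@hit_mod gs r q') ?H1 // dvdn_mull // (prime_dvd_dprod QpP) //.
by have [] := sieving_primesP QP rQ.
Qed.

Lemma sum_residue_classes (q m M : nat) (Pr : pred nat) (x : nat -> R) : (0 < q)%N ->
  (forall n, Pr (n %% q)%N = Pr n) ->
  \sum_(m <= n < M | Pr n) x n =
  \sum_(a < q | Pr a) \sum_(m <= n < M | (n %% q == a)%N) x n.
Proof.
move=> q0 Prm.
rewrite (exchange_big_dep Pr) /=; last first.
  by move=> a n Pa /eqP e; rewrite -Prm e.
apply: eq_bigr => n Pn.
rewrite (big_pred1 (Ordinal (ltn_pmod n q0))) // => a /=.
rewrite -val_eqE /= [RHS]eq_sym; have [<-|_] := eqVneq (n %% q)%N (a : nat); last by rewrite andbF.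
by rewrite Prm Pn.
Qed.

(** A squarefree d divides the product of the n + g exactly when each of its primes hits n. The
    shifts are a parameter, since one of them is removed when n + h is prime. *)
Definition sieve_weight (w N : nat) (l : {set 'I_N.+1} -> R) (gs : seq nat) (n : nat) : R :=
  (\sum_(S : {set 'I_N.+1} | (S \subset sieving_primes w N) && [forall p in S, hit gs p n]) l S)
    ^+ 2.

Lemma weighted_sum_quad w N (l : {set 'I_N.+1} -> R) gs (rng : seq nat) (Pr : pred nat) (x : nat
  -> R) :
  \sum_(n <- rng | Pr n) sieve_weight w l gs n * x n =
  quad w l (fun Q => \sum_(n <- rng | Pr n && [forall p in Q, hit gs p n]) x n).
Proof.
rewrite /quad.
transitivity (\sum_(n <- rng | Pr n) \sum_(S : {set 'I_N.+1} | S \subset sieving_primes w N)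
  \sum_(T : {set 'I_N.+1} | T \subset sieving_primes w N)
    l S * l T * (if [forall p in S :|: T, hit gs p n] then x n else 0)).
  apply: eq_bigr => n _; rewrite /sieve_weight expr2 big_distrlr mulr_suml /=.
  rewrite big_mkcondr /=; apply: eq_bigr => S SP.
  have eST (T : {set 'I_N.+1}) : [forall p in S :|: T, hit gs p n] =
      [forall p in S, hit gs p n] && [forall p in T, hit gs p n].
    apply/forall_inP/andP => [H|[/forall_inP H1 /forall_inP H2] p].
      by split; apply/forall_inP => p pS; apply: H; rewrite inE pS ?orbT.
    by rewrite inE => /orP[/H1|/H2].
  case: ifP => hS; last by rewrite big1 // => T _; rewrite eST hS mulr0.
  rewrite mulr_suml big_mkcondr /=; apply: eq_bigr => T TP.
  by rewrite eST hS /=; case: ifP; rewrite ?mulr0.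
rewrite exchange_big /=; apply: eq_bigr => S SP.
rewrite exchange_big /=; apply: eq_bigr => T TP.
by rewrite -mulr_sumr big_mkcondr.
Qed.

(** Expanding the square, a pair S, T requires all primes of the union Q to hit n. Such n fill (size
    gs)^|Q| classes modulo w! [dprod Q], and each class is replaced by its expected value [mu Q]. *)
Lemma weighted_sum_approx w N (l : {set 'I_N.+1} -> R) gs b m M (x : nat -> R)
    (mu err : {set 'I_N.+1} -> R) : uniq gs -> all (fun g => g <= w)%N gs ->
  (forall (Q : {set 'I_N.+1}) (a : nat), Q \subset sieving_primes w N ->
     a == b %[mod w`!] -> [forall p in Q, hit gs p a] ->
     `|\sum_(m <= n < M | n == a %[mod w`! * dprod Q]) x n - mu Q| <= err Q) ->
  `|\sum_(m <= n < M | n == b %[mod w`!]) sieve_weight w l gs n * x n -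
    quad w l (fun Q => (size gs)%:R ^+ #|Q| * mu Q)| <=
  \sum_(S : {set 'I_N.+1} | S \subset sieving_primes w N)
  \sum_(T : {set 'I_N.+1} | T \subset sieving_primes w N)
    `|l S * l T| * ((size gs)%:R ^+ #|S :|: T| * err (S :|: T)).
Proof.
move=> ugs gsw H; rewrite weighted_sum_quad /quad -sumrB.
apply: le_trans (ler_norm_sum _ _ _) _; apply: ler_sum => S SP.
rewrite -sumrB; apply: le_trans (ler_norm_sum _ _ _) _; apply: ler_sum => T TP.
rewrite -mulrBr normrM ler_wpM2l //.
have QP : S :|: T \subset sieving_primes w N by rewrite subUset SP.
move: (S :|: T) QP => Q QP.
set q := (w`! * dprod Q)%N.
have q0 : (0 < q)%N by rewrite muln_gt0 fact_gt0 (dprod_gt0 QP).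
pose Pr n := (n == b %[mod w`!]) && [forall p in Q, hit gs p n].
have Prm n : Pr (n %% q)%N = Pr n.
  rewrite /Pr modn_dvdm ?dvdn_mulr //; congr (_ && _).
  apply: eq_forallb => p; case: (boolP (p \in Q)) => //= pQ.
  by rewrite hit_mod // dvdn_mull // (prime_dvd_dprod QP) //; case: (sieving_primesP QP pQ).
rewrite (sum_residue_classes _ _ _ q0 Prm).
have cnt : (\sum_(a < q | Pr a) 1 = (size gs ^ #|Q|)%N%:R :> R).
  by rewrite sumr_const -(card_residues b ugs gsw QP (erefl q)) cardsE.
rewrite natrX in cnt; rewrite -cnt !mulr_suml -sumrB.
apply: le_trans (ler_norm_sum _ _ _) _; apply: ler_sum => a /andP[ab aQ].
rewrite !mul1r (eq_bigl (fun n => n == a %[mod q])); first exact: H.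
by move=> n; rewrite (modn_small (ltn_ord a)).
Qed.

(** * The error functions of conditions (A) and (B) *)

Lemma bigRmax_ge (I : eqType) (r : seq I) (P : pred I) (F : I -> R) i :
  i \in r -> P i -> F i <= \big[Rmax/R0]_(j <- r | P j) F j.
Proof.
move=> + Pi; elim: r => // j r IH; rewrite inE big_cons => /orP[/eqP <-|/IH h].
  by rewrite Pi RmaxE le_max lexx.
by case: ifP => // _; rewrite RmaxE le_max h orbT.
Qed.

Lemma bigRmax_ge0 (I : Type) (r : seq I) (P : pred I) (F : I -> R) :
  0 <= \big[Rmax/R0]_(j <- r | P j) F j.
Proof.
elim: r => [|j r IH]; first by rewrite big_nil.
by rewrite big_cons; case: ifP => // _; rewrite RmaxE le_max IH orbT.
Qed.

Lemma bigRmax_le (I : Type) (r : seq I) (P : pred I) (F : I -> R) (B : R) :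
  0 <= B -> (forall i, P i -> F i <= B) -> \big[Rmax/R0]_(j <- r | P j) F j <= B.
Proof.
move=> B0 FB; elim: r => [|j r IH]; first by rewrite big_nil.
by rewrite big_cons; case: ifP => // Pj; rewrite RmaxE ge_max FB.
Qed.

Lemma sum1_residue (q a M : nat) : (a < q)%N ->
  (\sum_(0 <= n < M | n %% q == a) 1 = M %/ q + (a < M %% q))%N.
Proof.
move=> aq; have q0 : (0 < q)%N by apply: leq_ltn_trans aq.
elim: M => [|M IH]; first by rewrite big_geq // div0n mod0n.
rewrite big_mkcond big_nat_recr //= -big_mkcond /= IH divnS // modnS.
case: (boolP (q %| M.+1)%N) => [d|nd] /=.
  have e : (M %% q).+1 = q.
    have := d; rewrite -addn1 /dvdn -modnDml addn1 => /eqP e.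
    have := ltn_pmod M q0; rewrite leq_eqVlt => /orP[/eqP //|lt].
    by move: e; rewrite modn_small.
  rewrite addn0; have [->|ne] := eqVneq (M %% q)%N a; first by rewrite ltnn; lia.
  have -> : (a < M %% q)%N; last by lia.
  by move: aq; rewrite -{1}e ltnS leq_eqVlt eq_sym (negbTE ne).
by rewrite ltnS; case: (ltngtP (M %% q)%N a) => _ /=; lia.
Qed.

Lemma sum1_residue_approx (q a M : nat) : (a < q)%N ->
  `|\sum_(0 <= n < M | (n %% q == a)%N) 1 - M%:R / q%:R| <= 1 :> R.
Proof.
move=> aq; have q0 : (0 < q)%N by apply: leq_ltn_trans aq.
have -> : \sum_(0 <= n < M | (n %% q == a)%N) 1 = (M %/ q + (a < M %% q))%N%:R :> R.
  by rewrite -sum1_residue // natr_sum.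
have qR : 0 < q%:R :> R by rewrite ltr0n.
have -> : M%:R / q%:R = (M %/ q)%N%:R + (M %% q)%N%:R / q%:R :> R.
  by rewrite {1}(divn_eq M q) natrD natrM mulrDl mulfK // gt_eqF.
have f0 : 0 <= (M %% q)%N%:R / q%:R :> R by rewrite divr_ge0.
have f1 : (M %% q)%N%:R / q%:R < 1 :> R by rewrite ltr_pdivrMr // mul1r ltr_nat ltn_pmod.
rewrite natrD opprD addrACA subrr add0r ler_norml.
by case: (_ < _)%N => /=; apply/andP; split; lra.
Qed.

Definition theta_class (M q a : nat) : R :=
  \sum_(0 <= p < M.+1 | prime p && (p %% q == a)%N) lg p.

Lemma errA_ge M q a : (a < q)%N -> coprime a q ->
  `|theta_class M q a - M%:R / (totient q)%:R| <= errA M q.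
Proof.
move=> aq caq.
have := @bigRmax_ge _ (index_enum 'I_q) (fun a => coprime a q)
  (fun a : 'I_q => Rabs (Rminus (\big[Rplus/R0]_(p < M.+1 | prime p && (p %% q == a)%N) ln (INR p))
                 (Rdiv (INR M) (INR (totient q))))) (Ordinal aq) (mem_index_enum _) caq.
rewrite -/(errA M q); apply: le_trans.
rewrite RabsE RminusE RdivE !INRE /theta_class big_mkord le_eqVlt; apply/orP; left.
apply/eqP; congr (`|_ - _|); apply: eq_bigr => p _; by rewrite INRE.
Qed.

Lemma theta_class_le M q a : (a < q)%N ->
  0 <= theta_class M q a <= (M.+1%:R / q%:R + 1) * lg M.
Proof.
move=> aq; apply/andP; split; first by apply: sumr_ge0 => p _; apply: lg_ge0.
apply: (@le_trans _ _ (\sum_(0 <= n < M.+1 | (n %% q == a)%N) 1 * lg M)).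
  rewrite /theta_class big_mkcond [leRHS]big_mkcond big_nat_cond [leRHS]big_nat_cond.
  apply: ler_sum => p /andP[/andP[_ pM] _]; rewrite mul1r.
  case: (boolP (prime p)) => pp /=; case: ifP => // _; last exact: lg_ge0.
  by rewrite ler_lg // prime_gt0.
rewrite -mulr_suml ler_wpM2r ?lg_ge0 //.
by have := sum1_residue_approx M.+1 aq; rewrite ler_norml => /andP[_]; lra.
Qed.

Lemma errA_triv M q : (0 < q)%N ->
  errA M q <= (M.+1%:R / q%:R + 1) * lg M + M%:R / (totient q)%:R.
Proof.
move=> q0.
have b0 : 0 <= (M.+1%:R / q%:R + 1) * lg M :> R.
  by rewrite mulr_ge0 ?lg_ge0 // addr_ge0 // divr_ge0.
have b1 : 0 <= M%:R / (totient q)%:R :> R by rewrite divr_ge0.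
apply: bigRmax_le => [|a _]; first exact: addr_ge0.
rewrite RabsE RminusE RdivE !INRE.
have /andP[t0 t1] := theta_class_le M (ltn_ord a).
have -> : \big[Rplus/R0]_(p < M.+1 | prime p && (p %% q == a)%N) ln (INR p) = theta_class M q a.
  by rewrite /theta_class big_mkord; apply: eq_bigr => p _; rewrite INRE.
rewrite ler_norml; apply/andP; split; lra.
Qed.

Lemma errA_ge0 M q : 0 <= errA M q.
Proof. exact: bigRmax_ge0. Qed.

Lemma errB_ge0 M q : 0 <= errB M q.
Proof. exact: bigRmax_ge0. Qed.

Definition lambda_class (y q a : nat) : R :=
  \sum_(1 <= n < y.+1 | (n %% q == a)%N) liouville n.

Lemma liouville_norm n : `|liouville n| = 1.
Proof. by rewrite /liouville RpowE normrX (_ : IZR (-1) = -1) // normrN1 expr1n. Qed.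

Lemma errB_ge M q y a : (y <= M)%N -> (a < q)%N -> `|lambda_class y q a| <= errB M q.
Proof.
move=> yM aq; have yM' : (y < M.+1)%N by [].
pose G (y : 'I_M.+1) : R := \big[Rmax/R0]_(a < q)
      Rabs (\big[Rplus/R0]_(1 <= n < y.+1 | (n %% q == a)%N) liouville n).
have h1 : G (Ordinal yM') <= errB M q.
  exact: (@bigRmax_ge _ (index_enum 'I_M.+1) xpredT G (Ordinal yM') (mem_index_enum _)).
apply: le_trans h1; rewrite -RabsE.
exact: (@bigRmax_ge _ (index_enum 'I_q) xpredT (fun a : 'I_q =>
  Rabs (\big[Rplus/R0]_(1 <= n < y.+1 | (n %% q == a)%N) liouville n)) (Ordinal aq)
    (mem_index_enum _)).
Qed.

Lemma errB_triv M q : (0 < q)%N -> errB M q <= M.+1%:R / q%:R + 1.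
Proof.
move=> q0.
have b0 : 0 <= M.+1%:R / q%:R + 1 :> R by rewrite addr_ge0 // divr_ge0.
apply: bigRmax_le => // y _; apply: bigRmax_le => // a _; rewrite RabsE.
apply: le_trans (ler_norm_sum _ _ _) _.
apply: (@le_trans _ _ (\sum_(0 <= n < M.+1 | (n %% q == a)%N) 1)).
  under eq_bigr => n _ do rewrite liouville_norm.
  rewrite sum_nat1_ord big_mkord.
  have yM (n : 'I_y.+1) : (n < M.+1)%N by apply: leq_trans (ltn_ord n) _.
  apply: (@ler_sum_inj _ _ _ _ _ _ (fun n : 'I_y.+1 => Ordinal (yM n))) => //=.
    by move=> i j _ _ [] e; apply: val_inj.
  by move=> i /andP[].
by have := sum1_residue_approx M.+1 (ltn_ord a); rewrite ler_norml => /andP[_]; lra.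
Qed.

(** The dyadic window, shifted by h, becomes a difference of two initial segments, the form in which
    conditions (A) and (B) are stated. *)
Lemma sum_shift_class (N h q a : nat) (f : nat -> R) (P : pred nat) : (0 < q)%N ->
  \sum_(N.+1 <= n < (2 * N).+1 | (n == a %[mod q])) (if P (n + h)%N then f (n + h)%N else 0) =
  \sum_(0 <= p < (2 * N + h).+1 | P p && (p %% q == (a + h) %% q)%N) f p -
  \sum_(0 <= p < (N + h).+1 | P p && (p %% q == (a + h) %% q)%N) f p.
Proof.
move=> q0.
have l1 : ((N + h).+1 <= (2 * N + h).+1)%N by rewrite ltnS leq_add2r leq_pmull.
rewrite big_mkcond [X in X - _]big_mkcond [X in _ - X]big_mkcond /=.
rewrite [X in X - _](@big_cat_nat _ _ _ (N + h).+1) //= [X in X - _]addrC addrK.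
rewrite (_ : (2 * N + h).+1 = ((2 * N).+1 + h)%N) // (_ : (N + h).+1 = (N.+1 + h)%N) //.
rewrite big_addn addnK; apply: eq_bigr => i _; rewrite eqn_modDr andbC.
by case: (_ == _ %[mod q]).
Qed.

Lemma lg_unbounded (B : R) : exists N0 : nat, forall N : nat, (N0 <= N)%N -> B <= lg N.
Proof.
have [n hn] : exists n : nat, exp B < n%:R.
  exists (Num.bound (exp B)); apply: archi_boundP; apply/RleP/Rlt_le; exact: exp_pos.
have n0 : (0 < n)%N.
  by rewrite -(ltr_nat R); apply: lt_trans hn; apply/RltP; exact: exp_pos.
exists n => N nN; apply: le_trans (ler_lg n0 nN); rewrite /lg -[leLHS]ln_exp.
apply/RleP/Rlt_le/ln_increasing; [exact: exp_pos | by apply/RltP].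
Qed.

Lemma lg_le_exp (n : nat) (x : R) : (0 < n)%N -> lg n <= x -> n%:R <= exp x.
Proof.
move=> n0 h; rewrite -[n%:R]exp_ln; last exact: natr_gt0R.
rewrite -/(lg n); move: h; rewrite le_eqVlt => /orP[/eqP<-//|/RltP h].
by apply/RleP/Rlt_le/exp_increasing.
Qed.

Lemma exp_lg (n : nat) : (0 < n)%N -> exp (lg n) = n%:R.
Proof. by move=> n0; rewrite exp_ln //; exact: natr_gt0R. Qed.

(** The n-th power of y <= exp y at y = dx/n. With x = log N it compares a power of log N with
    N^d. *)
Lemma pow_le_exp (x d : R) (n : nat) : 0 <= x -> 0 < d ->
  x ^+ n <= (n%:R / d) ^+ n * exp (d * x).
Proof.
move=> x0 d0; case: n => [|n].
  rewrite !expr0 mul1r; have /RleP := exp_ineq1_le (d * x); rewrite RplusE => h.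
  by apply: le_trans h; rewrite lerDl mulr_ge0 // ltW.
have n0 : 0 < n.+1%:R :> R by rewrite ltr0n.
pose y := d * x / n.+1%:R.
have y0 : 0 <= y by rewrite divr_ge0 ?mulr_ge0 // ltW.
have -> : exp (d * x) = exp y ^+ n.+1.
  by rewrite expRX -mulr_natr /y divfK // gt_eqF.
have xy (t : R) : 0 < t -> x = t / d * (d * x / t).
  by move=> t0; field; rewrite !gt_eqF.
rewrite [x in leLHS](xy _ n0) -/y.
have nd0 : 0 <= n.+1%:R / d by rewrite divr_ge0 // ltW.
rewrite exprMn ler_wpM2l ?exprn_ge0 // lerXn2r ?nnegrE //.
  by apply/RleP/Rlt_le/exp_pos.
by have /RleP := exp_ineq1_le y; rewrite RplusE => h; apply: le_trans h; rewrite lerDr.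
Qed.

(** Distinct Q give distinct moduli w! [dprod Q], so the left-hand side is a part of the sum over
    all q up to X in the conditions. *)
Lemma sum_moduli_le w N (L X : R) (err : nat -> R) : (forall q, 0 <= err q) ->
  (forall Q : {set 'I_N.+1}, Q \subset sieving_primes w N -> lg (dprod Q) <= 2 * L ->
     (w`! * dprod Q)%N%:R <= X) ->
  \sum_(Q : {set 'I_N.+1} | (Q \subset sieving_primes w N) && (lg (dprod Q) <= 2 * L))
     err (w`! * dprod Q)%N <=
  \big[Rplus/R0]_(q < Z.to_nat (up X) | (0 < q)%N && le_real q X) err q.
Proof.
move=> err0 hX.
set n := Z.to_nat (up X).
have lt_n q : q%:R <= X -> (q < n)%N.
  move=> /RleP qX; have [h _] := archimed X.
  have : Rlt (IZR (Z.of_nat q)) (IZR (up X)).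
    by rewrite -INR_IZR_INZ; apply: Rle_lt_trans h; rewrite INRE.
  move=> /lt_IZR h2; rewrite /n; lia.
case: (posnP n) => [n0|npos].
  rewrite big1 ?big_ord_0 //; first by apply: sumr_ge0.
  by move=> Q /andP[QP LQ]; have := lt_n _ (hX _ QP LQ); rewrite n0.
apply: (@ler_sum_inj _ _ _ _ _ (fun q : 'I_n => err q)
   (fun Q : {set 'I_N.+1} => insubd (Ordinal npos) (w`! * dprod Q)%N)).
- move=> Q Q' /andP[QP LQ] /andP[QP' LQ'] /(congr1 (@nat_of_ord _)).
  rewrite !val_insubd !lt_n ?hX // => /eqP; rewrite eqn_pmul2l ?fact_gt0 // => /eqP.
  exact: (dprod_inj QP QP').
- move=> Q /andP[QP LQ]; rewrite val_insubd lt_n ?hX // muln_gt0 fact_gt0 (dprod_gt0 QP) /=.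
  rewrite /le_real; case: Rle_dec => //= h; exfalso; apply: h.
  by rewrite INRE; apply/RleP; exact: hX.
- by move=> Q /andP[QP LQ]; rewrite val_insubd lt_n ?hX.
- by [].
Qed.

Lemma natr_le_Rpower (n M : nat) (t : R) : (0 < n)%N -> lg n <= t * lg M ->
  n%:R <= Rpower (INR M) t.
Proof. by move=> n0 h; rewrite /Rpower INRE; apply: lg_le_exp. Qed.

Lemma totient_dprod w N (Q : {set 'I_N.+1}) : Q \subset sieving_primes w N ->
  (totient (w`! * dprod Q))%:R = (totient w`!)%:R * \prod_(p in Q) ((p : nat)%:R - 1) :> R.
Proof.
move=> QP; rewrite totient_coprime; last by rewrite coprime_sym (dprod_coprime QP).
rewrite natrM; congr (_ * _).
have [m] := ubnP #|Q|; elim: m Q QP => // m IH Q QP; rewrite ltnS => Qm.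
have [->|[p pQ]] := set_0Vmem Q; first by rewrite dprod0 big_set0.
have QpP : Q :\ p \subset sieving_primes w N by apply: subset_trans (subsetDl _ _) QP.
have [pp _] := sieving_primesP QP pQ.
rewrite {1}/dprod (big_setD1 p) //= -/(dprod (Q :\ p)) [RHS](big_setD1 p) //=.
rewrite totient_coprime; last first.
  by rewrite prime_coprime // (prime_dvd_dprod QpP) // !inE eqxx.
rewrite natrM totient_prime // IH //; last by move: Qm; rewrite (cardsD1 p Q) pQ.
by rewrite -subn1 natrB ?prime_gt0.
Qed.

Lemma prod_pred_ge w N (Q : {set 'I_N.+1}) : Q \subset sieving_primes w N ->
  (dprod Q)%:R / 2 ^+ #|Q| <= \prod_(p in Q) ((p : nat)%:R - 1) :> R.
Proof.
move=> QP; rewrite natr_dprod -(prodr_const (mem Q) (2 : R)) -prodf_div; apply: ler_prod => p pQ.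
have [/prime_gt1 pp _] := sieving_primesP QP pQ.
have : 2 <= (p : nat)%:R :> R by rewrite ler_nat.
by move=> h; apply/andP; split; lra.
Qed.

Lemma class_count_approx (N q a : nat) : (0 < q)%N ->
  `|\sum_(N.+1 <= n < (2 * N).+1 | n == a %[mod q]) 1 - N%:R / q%:R| <= 2 :> R.
Proof.
move=> q0; have aq : (a %% q < q)%N by rewrite ltn_pmod.
have e : \sum_(N.+1 <= n < (2 * N).+1 | n == a %[mod q]) 1 =
   \sum_(0 <= n < (2 * N).+1 | (n %% q == a %% q)%N) 1 - \sum_(0 <= n < N.+1 | (n %% q == a %%
     q)%N) 1 :> R.
  rewrite [X in _ = X - _]big_mkcond [X in _ = X - _](@big_cat_nat _ _ _ N.+1) //=; last by lia.
  by rewrite -!big_mkcond /= [X in _ = X - _]addrC addrK.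
have h1 := sum1_residue_approx (2 * N).+1 aq; have h2 := sum1_residue_approx N.+1 aq.
rewrite e (_ : N%:R / q%:R = (2 * N).+1%:R / q%:R - N.+1%:R / q%:R :> R); last first.
  by rewrite -mulrBl -natrB; [congr (_%:R / _); lia | lia].
move: h1 h2; rewrite !ler_norml => /andP[a1 a2] /andP[a3 a4]; apply/andP; split; lra.
Qed.

Lemma prime_class_approx (N h q a : nat) : (0 < q)%N -> coprime (a + h) q ->
  `|\sum_(N.+1 <= n < (2 * N).+1 | n == a %[mod q]) (if prime (n + h) then lg (n + h) else 0)
    - N%:R / (totient q)%:R| <= errA (2 * N + h) q + errA (N + h) q.
Proof.
move=> q0 cop; have aq : ((a + h) %% q < q)%N by rewrite ltn_pmod.
rewrite (@sum_shift_class N h q a lg prime q0).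
have cop' : coprime ((a + h) %% q) q by rewrite coprime_modl.
have h1 := @errA_ge (2 * N + h) q _ aq cop'; have h2 := @errA_ge (N + h) q _ aq cop'.
rewrite (_ : N%:R / (totient q)%:R = (2 * N + h)%N%:R / (totient q)%:R - (N + h)%N%:R / (totient
  q)%:R :> R); last first.
  by rewrite -mulrBl -natrB; [congr (_%:R / _); lia | lia].
move: h1 h2; rewrite /theta_class !ler_norml => /andP[a1 a2] /andP[a3 a4]; apply/andP; split; lra.
Qed.

Lemma lambda_class_approx (N q a : nat) : (0 < q)%N ->
  `|\sum_(N.+1 <= n < (2 * N).+1 | n == a %[mod q]) liouville n.+1| <= 2 * errB (2 * N).+1 q.
Proof.
move=> q0; have aq : ((a + 1) %% q < q)%N by rewrite ltn_pmod.
have := @sum_shift_class N 1 q a liouville (fun p => (0 < p)%N) q0.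
rewrite (eq_bigr (fun n => liouville n.+1)); last by move=> n _; rewrite addn1.
have e M : \sum_(0 <= p < M.+1 | (0 < p)%N && (p == a + 1 %[mod q])) liouville p =
    lambda_class M q ((a + 1) %% q).
  by rewrite big_mkord -(sum_nat1_ord M (fun p => p == a + 1 %[mod q]) liouville).
rewrite !e => ->; rewrite !addn1 in aq *.
have h1 := @errB_ge (2 * N).+1 q (2 * N).+1 _ (leqnn _) aq.
have NN : (N.+1 <= (2 * N).+1)%N by lia.
have h2 := @errB_ge (2 * N).+1 q N.+1 _ NN aq.
move: h1 h2; rewrite !ler_norml => /andP[a1 a2] /andP[a3 a4]; apply/andP; split; lra.
Qed.

Lemma E0_pos (u : R) : 0 <= u -> E 0 u = 1.
Proof. by move=> u0; rewrite E_pos // expr0 fact0 divr1. Qed.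

Lemma E1_pos (u : R) : 0 <= u -> E 1 u = u.
Proof. by move=> u0; rewrite E_pos // expr1 divr1. Qed.

Lemma class_size_le (w d N M : nat) : (0 < d)%N -> (d <= N)%N -> (M.+1 <= 16 * N)%N ->
  M.+1%:R / (w`! * d)%N%:R + 1 <= 17 * N%:R / d%:R :> R.
Proof.
move=> d0 dN MN.
have dR : 0 < d%:R :> R by rewrite ltr0n.
have WR : 1 <= (w`!)%:R :> R by rewrite ler1n fact_gt0.
have MR : M.+1%:R <= 16 * N%:R :> R by rewrite -natrM ler_nat.
have dNR : d%:R <= N%:R :> R by rewrite ler_nat.
rewrite natrM ler_pdivlMr // mulrDl mul1r.
have -> : M.+1%:R / ((w`!)%:R * d%:R) * d%:R = M.+1%:R / (w`!)%:R :> R.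
  by field; rewrite !gt_eqF //; lra.
have : M.+1%:R / (w`!)%:R <= M.+1%:R :> R by rewrite ler_pdivrMr ?ler_peMr //; lra.
lra.
Qed.

(** * Evaluation of the weighted sums *)

Lemma quad_scale w N (l : {set 'I_N.+1} -> R) (F G : {set 'I_N.+1} -> R) (a : R) :
  (forall Q : {set 'I_N.+1}, Q \subset sieving_primes w N -> F Q = a * G Q) ->
  quad w l F = a * quad w l G.
Proof.
move=> h; rewrite /quad mulr_sumr; apply: eq_bigr => S SP; rewrite mulr_sumr.
by apply: eq_bigr => T TP; rewrite h ?subUset ?SP //; ring.
Qed.

(** Transfers the bound at M to a scale N common to all shifts; the factor 15 leaves room for M = 2N
    + h with h <= 12. *)
Lemma cond_bound (S : nat -> R) (A : nat) (C : R) (N0 : nat) :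
  (forall M : nat, (N0 <= M)%N -> Rle (S M) (Rdiv (Rmult C (INR M)) (Rpower (ln (INR M)) (INR
    A)))) ->
  forall N M : nat, (N0 <= N)%N -> 1 <= lg N -> (N <= M <= 15 * N)%N ->
  S M <= 15 * `|C| * N%:R / lg N ^+ A.
Proof.
move=> H N M N0N l1 /andP[NM MN].
have N0' : (0 < N)%N by case: N l1 {NM MN N0N} => //; rewrite lg0 ler10.
have lNM := ler_lg N0' NM.
have lM0 : 0 < lg M by lra.
have /RleP := H M (leq_trans N0N NM).
rewrite INRE -/(lg M) INRE (_ : Rpower (lg M) A%:R = lg M ^+ A); last first.
  by rewrite -INRE Rpower_pow ?RpowE //; apply/RltP.
rewrite RdivE RmultE => h; apply: le_trans h _.
have lA : lg N ^+ A <= lg M ^+ A by rewrite lerXn2r ?nnegrE ?lg_ge0.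
have lA0 : 0 < lg N ^+ A by rewrite exprn_gt0 //; lra.
have MR : M%:R <= 15 * N%:R :> R by rewrite -natrM ler_nat.
apply: (@le_trans _ _ (`|C| * M%:R / lg M ^+ A)).
  by rewrite ler_wpM2r ?invr_ge0 ?exprn_ge0 ?lg_ge0 // ler_wpM2r // ler_norm.
rewrite ler_pM ?mulr_ge0 ?invr_ge0 ?exprn_ge0 ?lg_ge0 //.
  by rewrite [15 * _]mulrC -mulrA ler_wpM2l.
by rewrite lef_pV2 // posrE // exprn_gt0.
Qed.

Lemma dprod_le_N w N (Q : {set 'I_N.+1}) (t : R) : (0 < N)%N -> t <= 1 ->
  Q \subset sieving_primes w N -> lg (dprod Q) <= 2 * (t / 2 * lg N) -> (dprod Q <= N)%N.
Proof.
move=> N0 t1 QP h; rewrite leqNgt; apply/negP => lt.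
have := ltr_lg N0 lt; have : t * lg N <= 1 * lg N by rewrite ler_wpM2r ?lg_ge0.
lra.
Qed.

Definition lamN (w k : nat) (c tau : R) (N : nat) : {set 'I_N.+1} -> R :=
  lam w k c (tau / 2 * lg N).

Lemma eventually_large (tau B : R) : 0 < tau -> tau < 1 ->
  exists N0 : nat, forall N : nat, (N0 <= N)%N ->
  [/\ (0 < N)%N, 1 <= lg N, 1 <= tau / 2 * lg N, tau / 2 * lg N <= lg N & B <= lg N].
Proof.
move=> tau0 tau1; have [N0 h] := lg_unbounded (Num.max B (1 + 2 / tau)).
have t2 : 0 < 2 / tau by rewrite divr_gt0.
exists (maxn N0 1) => N; rewrite geq_max => /andP[/h + N1].
rewrite ge_max => /andP[hB ht]; split=> //; first by lra.
- have : tau / 2 * (2 / tau) <= tau / 2 * lg N by rewrite ler_wpM2l; lra.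
  by have -> : tau / 2 * (2 / tau) = 1 by field; rewrite gt_eqF.
- by rewrite ler_piMl ?lg_ge0 //; lra.
Qed.

(** Every class count is off by at most 2, and the moduli d go up to N^tau only, so the total error
    is a power of N below N as tau < 1. *)
Lemma approx_one (w k : nat) (c tau : R) (hs : seq nat) (b : nat) :
  (0 < k)%N -> (2 * k <= w)%N -> (2 * k ^ 2 < w)%N -> 0 <= c -> 0 < tau -> tau < 1 ->
  uniq hs -> size hs = k -> all (fun h => h <= w)%N hs ->
  exists2 C : R, 0 <= C & exists N0 : nat, forall N : nat, (N0 <= N)%N ->
  `|\sum_(N.+1 <= n < (2 * N).+1 | n == b %[mod w`!]) sieve_weight w (@lamN w k c tau N) hs n * 1 -
    N%:R / (w`!)%:R * quad w (@lamN w k c tau N) (fun Q => \prod_(p in Q) (k%:R / (p :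
      nat)%:R))| <= C * N%:R.
Proof.
move=> k0 kw k2w c0 tau0 tau1 uhs szhs hsw.
have [A hA] := error_sum_le k0 kw k2w c0.
have [CT CT0 hT] := sum_subset_inv_E_le w.
pose K : R := (A.+1%:R / (1 - tau)) ^+ A.+1.
have dt : 0 < 1 - tau by lra.
have K0 : 0 <= K by rewrite exprn_ge0 // divr_ge0 // ltW.
pose C2 := 2 * (cW w * (1 + CT)) * K.
have CTW0 : 0 <= cW w * (1 + CT) by apply: mulr_ge0; [exact: cW_ge0 | exact: addr_ge0].
have C20 : 0 <= C2 by apply: mulr_ge0 => //; apply: mulr_ge0.
have [C3 C30 h3] := hA 2 C2 (ler0n _ 2) C20.
exists C3 => //; have [N0 hN0] := eventually_large 0 tau0 tau1.
exists N0 => N /hN0[N1 l1 L1 Ll _].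
pose err (Q : {set 'I_N.+1}) : R := 2.
pose mu (Q : {set 'I_N.+1}) : R := N%:R / (w`! * dprod Q)%N%:R.
have := @weighted_sum_approx w N (@lamN w k c tau N) hs b N.+1 (2 * N).+1 (fun=> 1) mu err uhs hsw.
have e : quad w (@lamN w k c tau N) (fun Q => (size hs)%:R ^+ #|Q| * mu Q) =
    N%:R / (w`!)%:R * quad w (@lamN w k c tau N) (fun Q => \prod_(p in Q) (k%:R / (p : nat)%:R)).
  apply: quad_scale => Q QP; rewrite szhs big_split /= prodr_const prodfV -natr_dprod /mu natrM
    invfM.
  ring.
rewrite e => H; apply: le_trans (H _) _.
  move=> Q a QP _ _; apply: class_count_approx.
  by rewrite muln_gt0 fact_gt0 (dprod_gt0 QP).
rewrite szhs; apply: (h3 N _ (lg N) N%:R err) => //.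
- move=> Q QP LQ; rewrite ler0n /=.
  have dN := dprod_le_N N1 (ltW tau1) QP LQ.
  have dR : 0 < (dprod Q)%:R :> R by rewrite ltr0n (dprod_gt0 QP).
  rewrite /err ler_pdivlMr // -!mulrA ler_wpM2l // (le_trans (_ : _ <= N%:R)) ?ler_nat //.
  rewrite ler_peMr // -[leLHS]mulr1 ler_pM // exprn_ege1 // ler1n //.
- set ell := lg N; have ell0 : 0 < ell by rewrite /ell; lra.
  have ee : 2 * (tau / 2 * ell) = tau * ell by field.
  rewrite ee.
  have := hT N 0%N (tau * ell).
  have te0 : 0 <= tau * ell by rewrite mulr_ge0 ?ltW.
  rewrite (E1_pos te0) (E0_pos te0) mulr1 => hT'.
  (* Rankin's trick: each counted Q satisfies 1 <= N^tau / [dprod Q]. *)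
  apply: (@le_trans _ _ (2 * exp (tau * ell) * (cW w * (tau * ell + CT)))).
    apply: le_trans (ler_wpM2l _ hT'); last by rewrite mulr_ge0 //; apply/RleP/Rlt_le/exp_pos.
    rewrite mulr_sumr big_mkcondr /=; apply: ler_sum => Q QP.
    have pr0 : 0 <= \prod_(p in Q) ((p : nat)%:R : R)^-1 by apply: prodr_ge0 => p _; rewrite
      invr_ge0.
    case: ifP => LQ; last first.
      rewrite mulr_ge0 ?mulr_ge0 ?E_ge0 //; apply/RleP/Rlt_le/exp_pos.
    rewrite E0_pos ?subr_ge0 // mulr1 prodfV -natr_dprod /err.
    rewrite -mulrA ler_peMr // ler_pdivlMr ?ltr0n ?(dprod_gt0 QP) // mul1r.
    by apply: lg_le_exp; rewrite ?(dprod_gt0 QP).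
  have hp := @pow_le_exp ell (1 - tau) A.+1 (ltW ell0) dt.
  rewrite -/K in hp.
  have eN : exp (tau * ell) * exp ((1 - tau) * ell) = N%:R.
    by rewrite expRD -(exp_lg N1) -/ell; congr (exp _); rewrite RplusE; ring.
  rewrite ler_pdivlMr ?exprn_gt0 // /C2 -eN.
  have ex0 : 0 < exp (tau * ell) by apply/RltP/exp_pos.
  have ew0 : 0 <= 2 * exp (tau * ell) * cW w.
    by apply: mulr_ge0; [apply: mulr_ge0 => //; exact: ltW | exact: cW_ge0].
  rewrite [leRHS](_ : _ = 2 * exp (tau * ell) * cW w * (1 + CT) * (K * exp ((1 - tau) * ell)));
    last by ring.
  apply: le_trans (ler_wpM2l _ hp); last first.
    by apply: mulr_ge0 => //; exact: addr_ge0.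
  rewrite [leRHS](_ : _ = 2 * exp (tau * ell) * cW w * ((1 + CT) * ell) * ell ^+ A); last by
    rewrite exprS; ring.
  apply: ler_wpM2r; first by rewrite exprn_ge0 // ltW.
  rewrite [leLHS]mulrA; apply: ler_wpM2l => //.
  rewrite mulrDl mul1r lerD //; first by rewrite ler_piMl ?(ltW ell0) // ltW.
  by rewrite ler_peMr.
Qed.

(** With eps = (theta - tau)/2 the admissible level is N^(tau + eps); the part N^eps absorbs the
    fixed factor w!. *)
Lemma moduli_bound w N M (tau theta : R) (Q : {set 'I_N.+1}) : 0 < tau -> tau < theta -> (0 <
  N)%N -> (N <= M)%N ->
  lg w`! <= (theta - tau) / 2 * lg N ->
  Q \subset sieving_primes w N -> lg (dprod Q) <= 2 * (tau / 2 * lg N) ->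
  (w`! * dprod Q)%N%:R <= Rpower (INR M) (theta - (theta - tau) / 2).
Proof.
move=> tau0 tt N0 NM lW QP LQ; apply: natr_le_Rpower.
  by rewrite muln_gt0 fact_gt0 (dprod_gt0 QP).
rewrite lgM ?fact_gt0 ?(dprod_gt0 QP) //.
have := ler_lg N0 NM => h.
have e : (theta - (theta - tau) / 2) * lg N <= (theta - (theta - tau) / 2) * lg M.
  by rewrite ler_wpM2l //; lra.
apply: le_trans e; lra.
Qed.

Lemma approx_liouville (theta : R) (w k : nat) (c tau : R) (hs : seq nat) (b : nat) :
  (0 < k)%N -> (2 * k <= w)%N -> (2 * k ^ 2 < w)%N -> 0 <= c -> 0 < tau -> tau < 1 ->
  uniq hs -> size hs = k -> all (fun h => h <= w)%N hs ->
  tau < theta -> condB theta ->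
  exists2 C : R, 0 <= C & exists N0 : nat, forall N : nat, (N0 <= N)%N ->
  `|\sum_(N.+1 <= n < (2 * N).+1 | n == b %[mod w`!])
     sieve_weight w (@lamN w k c tau N) hs n * liouville n.+1| <= C * N%:R.
Proof.
move=> k0 kw k2w c0 tau0 tau1 uhs szhs hsw tt HB.
have [A hA] := error_sum_le k0 kw k2w c0.
have eps0 : Rlt 0%R ((theta - tau) / 2) by apply/RltP; rewrite divr_gt0 // subr_gt0.
(* The condition asks for a positive exponent; A+1 is positive for every A, and the extra logarithm
   is dropped at the end. *)
have HB' := HB _ (INR A.+1) eps0 _.
have [CB [NB hB]] := HB' (lt_0_INR _ (Nat.lt_0_succ _)).
pose C2 : R := 2 * (15 * `|CB|).
have C20 : 0 <= C2 by rewrite !mulr_ge0.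
have [C3 C30 h3] := hA 34 C2 (ler0n _ 34) C20.
exists C3 => //; have [N0 hN0] := eventually_large (lg w`! / ((theta - tau) / 2)) tau0 tau1.
exists (maxn N0 NB) => N; rewrite geq_max => /andP[/hN0[N1 l1 L1 Ll lW] NBN].
have lW' : lg w`! <= (theta - tau) / 2 * lg N.
  by rewrite mulrC -ler_pdivrMr //; rewrite divr_gt0 // subr_gt0.
pose err (Q : {set 'I_N.+1}) : R := 2 * errB (2 * N).+1 (w`! * dprod Q).
pose mu (Q : {set 'I_N.+1}) : R := 0.
have := @weighted_sum_approx w N (@lamN w k c tau N) hs b N.+1 (2 * N).+1 (fun n => liouville
  n.+1) mu err uhs hsw.
rewrite (_ : quad w (@lamN w k c tau N) _ = 0); last first.
  by rewrite (@quad_scale _ _ _ _ (fun=> 0) 0) ?mul0r // => Q _; rewrite /mu !mulr0.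
rewrite subr0 => H; apply: le_trans (H _) _.
  move=> Q a QP _ _; rewrite subr0; apply: lambda_class_approx.
  by rewrite muln_gt0 fact_gt0 (dprod_gt0 QP).
have ell0 : 0 < lg N by lra.
rewrite szhs; apply: (h3 N _ (lg N) N%:R err) => //.
- move=> Q QP LQ; rewrite mulr_ge0 ?errB_ge0 //=.
  have dN := dprod_le_N N1 (ltW tau1) QP LQ.
  have d0 := dprod_gt0 QP.
  have dR : 0 < (dprod Q)%:R :> R by rewrite ltr0n.
  have q0 : (0 < w`! * dprod Q)%N by rewrite muln_gt0 fact_gt0.
  have sM : ((2 * N).+2 <= 16 * N)%N by clear -N1; lia.
  apply: le_trans (ler_wpM2l (ler0n _ 2) (errB_triv _ q0)) _.
  apply: le_trans (ler_wpM2l (ler0n _ 2) (class_size_le w d0 dN sM)) _.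
  rewrite [leLHS](_ : _ = 34 * N%:R / (dprod Q)%:R); last by ring.
  apply: ler_wpM2r; first by rewrite invr_ge0 ltW.
  rewrite -mulrA ler_peMr ?mulr_ge0 //.
  by rewrite -[leLHS]mulr1 ler_pM // exprn_ege1 // ler1n.
- rewrite -mulr_sumr.
  have NM : (N <= (2 * N).+1)%N by clear; lia.
  have := @sum_moduli_le w N (tau / 2 * lg N) (Rpower (INR (2 * N).+1) (theta - (theta - tau) / 2))
     (errB (2 * N).+1) (errB_ge0 _) (fun Q => moduli_bound tau0 tt N1 NM lW').
  move=> h; have hB2 := @cond_bound (sumB theta ((theta - tau) / 2)) A.+1 CB NB hB N (2 * N).+1
    NBN l1 _.
  have NM2 : (N <= (2 * N).+1 <= 15 * N)%N by clear -N1; lia.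
  have h4 := le_trans h (hB2 NM2).
  apply: le_trans (ler_wpM2l (ler0n _ 2) h4) _.
  rewrite /C2 -!mulrA !ler_wpM2l // lef_pV2 ?posrE ?exprn_gt0 //.
  by rewrite exprS ler_peMl // exprn_ge0 // ltW.
Qed.


(** The trivial bound: 49 = 17 * 2 + 15, with 17 from [class_size_le], 2 from log M <= 2 log N, and
    15 from M <= 15N in the expected value. The factor 2^|Q| comes from p - 1 >= p/2 in the
    totient. *)
Lemma errA_moduli_le w N M (Q : {set 'I_N.+1}) : Q \subset sieving_primes w N ->
  (0 < N)%N -> (dprod Q <= N)%N -> (N <= M <= 15 * N)%N -> 1 <= lg N -> lg 16 <= lg N ->
  errA M (w`! * dprod Q) <= 49 * N%:R * lg N * 2 ^+ #|Q| / (dprod Q)%:R.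
Proof.
move=> QP N0 dN /andP[NM M15] l1 l16; have MN : (M.+1 <= 16 * N)%N by clear -N0 M15; lia.
 have d0 := dprod_gt0 QP.
have dR : 0 < (dprod Q)%:R :> R by rewrite ltr0n.
have q0 : (0 < w`! * dprod Q)%N by rewrite muln_gt0 fact_gt0.
apply: le_trans (errA_triv M q0) _.
have lM : lg M <= 2 * lg N.
  have M0 : (0 < M)%N by apply: leq_trans NM.
  have := ler_lg M0 (ltnW MN); rewrite lgM //; lra.
have h1 := class_size_le w d0 dN MN.
have p2 : 1 <= 2 ^+ #|Q| :> R by rewrite exprn_ege1 // ler1n.
have NR : 0 <= N%:R :> R by [].
have h2 : M%:R / (totient (w`! * dprod Q))%:R <= 15 * N%:R * 2 ^+ #|Q| / (dprod Q)%:R :> R.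
  have t1 : (dprod Q)%:R / 2 ^+ #|Q| <= (totient (w`! * dprod Q))%:R :> R.
    rewrite (totient_dprod QP); apply: le_trans (prod_pred_ge QP) _.
    rewrite ler_peMl ?ler1n ?totient_gt0 ?fact_gt0 //; apply: prodr_ge0 => p pQ.
    have [/prime_gt1 pp _] := sieving_primesP QP pQ.
    by rewrite subr_ge0 ler1n ltnW.
  have t0 : 0 < (dprod Q)%:R / 2 ^+ #|Q| :> R by rewrite divr_gt0 // exprn_gt0.
  have M15R : M%:R <= 15 * N%:R :> R by rewrite -natrM ler_nat.
  apply: (@le_trans _ _ (15 * N%:R / ((dprod Q)%:R / 2 ^+ #|Q|))).
    apply: ler_pM => //; first by rewrite invr_ge0.
    by rewrite lef_pV2 // posrE //; apply: lt_le_trans t1.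
  by rewrite invf_div mulrA.
apply: le_trans (lerD (ler_pM _ (lg_ge0 M) h1 lM) h2) _.
  by rewrite addr_ge0 // divr_ge0.
rewrite [leRHS](_ : _ = 34 * N%:R * lg N / (dprod Q)%:R * 2 ^+ #|Q| +
   15 * N%:R * 2 ^+ #|Q| / (dprod Q)%:R * lg N); last by ring.
apply: lerD.
  rewrite [leLHS](_ : _ = 34 * N%:R * lg N / (dprod Q)%:R); last by ring.
  apply: ler_peMr => //; apply: divr_ge0; last exact: ltW.
  by rewrite mulr_ge0 ?lg_ge0 // mulr_ge0.
apply: ler_peMr => //; apply: divr_ge0; last exact: ltW.
by rewrite mulr_ge0 ?mulr_ge0 // exprn_ge0.
Qed.

Lemma hit_rem hs h p n : h \in hs -> hit hs p n = (p %| n + h)%N || hit (rem h hs) p n.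
Proof. by move=> hhs; rewrite /hit (perm_has _ (perm_to_rem hhs)). Qed.

(** A prime n + h > N has no divisor among the sieving primes, which are at most N, so the shift h
    never contributes a hit. *)
Lemma sieve_weight_prime w N (l : {set 'I_N.+1} -> R) hs h n : h \in hs -> (N < n)%N ->
  prime (n + h) -> sieve_weight w l hs n = sieve_weight w l (rem h hs) n.
Proof.
move=> hhs Nn pn; rewrite /sieve_weight; congr (_ ^+ 2); apply: eq_bigl => S.
case: (boolP (S \subset _)) => //= SP.
have e p : p \in S -> hit hs p n = hit (rem h hs) p n.
  move=> pS; have [pp _] := sieving_primesP SP pS.
  rewrite (hit_rem _ _ hhs) dvdn_prime2 //; case: eqP => // e; exfalso.
  by have := ltn_ord p; rewrite e ltnS leqNgt (leq_trans Nn) ?leq_addr.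
by apply: eq_forallb => p; case: (boolP (p \in S)) => //= /e ->.
Qed.

(** Modulo w! this is the choice of b. A prime p of Q divides a + g for another shift g; dividing a
    + h too would force g = h modulo p, although both are at most w < p. *)
Lemma coprime_hit_rem w N hs b h (Q : {set 'I_N.+1}) a : uniq hs ->
  all (fun h => h <= w)%N hs -> h \in hs -> coprime (b + h) w`! ->
  Q \subset sieving_primes w N -> a == b %[mod w`!] -> [forall p in Q, hit (rem h hs) p a] ->
  coprime (a + h) (w`! * dprod Q).
Proof.
move=> uhs hsw hhs cbh QP ab /forall_inP aQ; rewrite coprimeMr; apply/andP; split.
  by rewrite -coprime_modl -modnDml (eqP ab) modnDml coprime_modl.
rewrite coprime_sym; apply: coprime_prod => p pQ; have [pp wp] := sieving_primesP QP pQ.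
rewrite prime_coprime //; apply/negP => pah.
have /hasP[g ghs pag] := aQ _ pQ.
have gh : g != h by move: ghs; rewrite mem_rem_uniq // inE => /andP[].
have ghs' : g \in hs by apply: mem_rem ghs.
have gp : (g < p)%N by apply: leq_ltn_trans (allP hsw _ ghs') wp.
have hp : (h < p)%N by apply: leq_ltn_trans (allP hsw _ hhs) wp.
move/negP: gh; apply; rewrite -(modn_small gp) -(modn_small hp) -(eqn_modDl a).
by rewrite (eqP pag) (eqP pah).
Qed.

(** Where n + h is prime the shift h can be removed from the weight. Then k-1 classes per prime
    remain, all coprime to the modulus after adding h, so (A) applies with the density 1/phi. *)
Lemma approx_prime (theta : R) (w k : nat) (c tau : R) (hs : seq nat) (b h : nat) :
  (0 < k)%N -> (2 * k <= w)%N -> (2 * k ^ 2 < w)%N -> 0 <= c -> 0 < tau -> tau < 1 ->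
  uniq hs -> size hs = k -> all (fun h => h <= w)%N hs -> h \in hs -> (h <= 12)%N ->
  coprime (b + h) w`! -> tau < theta -> condA theta ->
  exists2 C : R, 0 <= C & exists N0 : nat, forall N : nat, (N0 <= N)%N ->
  `|\sum_(N.+1 <= n < (2 * N).+1 | n == b %[mod w`!])
     sieve_weight w (@lamN w k c tau N) hs n * (if prime (n + h) then lg (n + h) else 0) -
    N%:R / (totient w`!)%:R *
    quad w (@lamN w k c tau N) (fun Q => \prod_(p in Q) (k.-1%:R / ((p : nat)%:R - 1)))| <= C *
      N%:R.
Proof.
move=> k0 kw k2w c0 tau0 tau1 uhs szhs hsw hhs h12 cbh tt HA.
have [A hA] := error_sum_le k0 kw k2w c0.
have eps0 : Rlt 0%R ((theta - tau) / 2) by apply/RltP; rewrite divr_gt0 // subr_gt0.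
have HA' := HA _ (INR A.+1) eps0 _.
have [CB [NB hB]] := HA' (lt_0_INR _ (Nat.lt_0_succ _)).
pose C2 : R := 2 * (15 * `|CB|).
have C20 : 0 <= C2 by rewrite !mulr_ge0.
(* 98 is twice the 49 of [errA_moduli_le], since the window is a difference of two initial
   segments. *)
have [C3 C30 h3] := hA 98 C2 (ler0n _ 98) C20.
exists C3 => //; have [N0 hN0] := eventually_large (lg w`! / ((theta - tau) / 2)) tau0 tau1.
have [N0' hN0'] := lg_unbounded (lg 16).
exists (maxn (maxn N0 N0') NB) => N; rewrite !geq_max => /andP[/andP[/hN0[N1 l1 L1 Ll lW] /hN0'
  l16] NBN].
have lW' : lg w`! <= (theta - tau) / 2 * lg N.
  by rewrite mulrC -ler_pdivrMr //; rewrite divr_gt0 // subr_gt0.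
pose gs := rem h hs.
have ugs : uniq gs by apply: rem_uniq.
have gsw : all (fun h => h <= w)%N gs by apply/allP => g /mem_rem /(allP hsw).
have szgs : size gs = k.-1 by rewrite size_rem // szhs.
pose x n : R := if prime (n + h) then lg (n + h) else 0.
have -> : \sum_(N.+1 <= n < (2 * N).+1 | n == b %[mod w`!]) sieve_weight w (@lamN w k c tau N)
  hs n * x n =
   \sum_(N.+1 <= n < (2 * N).+1 | n == b %[mod w`!]) sieve_weight w (@lamN w k c tau N) gs n * x n.
  rewrite big_nat_cond [RHS]big_nat_cond; apply: eq_bigr => n /andP[/andP[Nn _] _].
  by rewrite /x; case: ifP => pn; [rewrite (sieve_weight_prime _ _ hhs Nn pn) | rewrite !mulr0].
pose err (Q : {set 'I_N.+1}) : R := errA (2 * N + h) (w`! * dprod Q) + errA (N + h) (w`! * dprod Q).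
pose mu (Q : {set 'I_N.+1}) : R := N%:R / (totient (w`! * dprod Q))%:R.
have := @weighted_sum_approx w N (@lamN w k c tau N) gs b N.+1 (2 * N).+1 x mu err ugs gsw.
have e : quad w (@lamN w k c tau N) (fun Q => (size gs)%:R ^+ #|Q| * mu Q) =
    N%:R / (totient w`!)%:R * quad w (@lamN w k c tau N) (fun Q => \prod_(p in Q) (k.-1%:R / ((p
      : nat)%:R - 1))).
  apply: quad_scale => Q QP; rewrite szgs big_split /= prodr_const prodfV /mu (totient_dprod QP)
    invfM.
  ring.
rewrite e => H; apply: le_trans (H _) _.
  move=> Q a QP ab aQ; apply: prime_class_approx.
    by rewrite muln_gt0 fact_gt0 (dprod_gt0 QP).
  exact: (coprime_hit_rem uhs hsw hhs cbh QP ab aQ).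
have ell0 : 0 < lg N by lra.
have err0 Q : 0 <= err Q by rewrite addr_ge0 ?errA_ge0.
have b5 : (N <= 2 * N + h <= 15 * N)%N by clear -N1 h12; lia.
have b6 : (N <= N + h <= 15 * N)%N by clear -N1 h12; lia.
(* The multiplicities (k-1)^|Q| are raised to k^|Q| to fit [error_sum_le]. *)
apply: (@le_trans _ _ (\sum_(S : {set 'I_N.+1} | S \subset sieving_primes w N)
  \sum_(T : {set 'I_N.+1} | T \subset sieving_primes w N)
    `|lamN w k c tau S * lamN w k c tau T| * (k%:R ^+ #|S :|: T| * err (S :|: T)))).
  apply: ler_sum => S _; apply: ler_sum => T _; apply: ler_wpM2l => //; apply: ler_wpM2r => //.
  by rewrite szgs lerXn2r ?nnegrE // ler_nat leq_pred.
apply: (h3 N _ (lg N) N%:R err) => //.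
- move=> Q QP LQ; rewrite err0 /=.
  have dN := dprod_le_N N1 (ltW tau1) QP LQ.
  apply: le_trans (lerD (errA_moduli_le QP N1 dN b5 l1 l16) (errA_moduli_le QP N1 dN b6 l1 l16)) _.
  by rewrite le_eqVlt; apply/orP; left; apply/eqP; ring.
- rewrite big_split /=.
  have bound M : (N <= M <= 15 * N)%N ->
    \sum_(Q : {set 'I_N.+1} | (Q \subset sieving_primes w N) && (lg (dprod Q) <= 2 * (tau / 2 *
      lg N)))
      errA M (w`! * dprod Q) <= 15 * `|CB| * N%:R / lg N ^+ A.+1.
    move=> NM; have /andP[NM1 _] := NM.
    apply: le_trans (@cond_bound (sumA theta ((theta - tau) / 2)) A.+1 CB NB hB N M NBN l1 NM).
    exact: (@sum_moduli_le w N (tau / 2 * lg N) (Rpower (INR M) (theta - (theta - tau) / 2))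
     (errA M) (errA_ge0 _) (fun Q => moduli_bound tau0 tt N1 NM1 lW')).
  apply: le_trans (lerD (bound _ b5) (bound _ b6)) _.
  rewrite [leLHS](_ : _ = C2 * N%:R / lg N ^+ A.+1); last by rewrite /C2; ring.
  rewrite ler_wpM2l ?mulr_ge0 // lef_pV2 ?posrE ?exprn_gt0 //.
  by rewrite exprS ler_peMl // exprn_ge0 // ltW.
Qed.

(** * The contradiction *)

(* With k = m + 1: the coefficients of L^(k+2) and L^(k+3) in the main terms of the total
   weight and of the prime sum for one shift, from [quad_main1_le] and [quad_main2_ge]. *)
Definition Fcst (m : nat) (c : R) : R :=
  (m.+1)`!%:R^-1 + 2 * c / (m.+2)`!%:R + 2 * c ^+ 2 / (m.+3)`!%:R.

Definition Gcst (m : nat) (c : R) : R :=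
  2 / (m.+2)`!%:R + 6 * c / (m.+3)`!%:R + 6 * c ^+ 2 / (m.+4)`!%:R.

Lemma sum_approx_uniform (hs : seq nat) (X : nat -> nat -> R) :
  (forall h, h \in hs -> exists2 C : R, 0 <= C & exists N0 : nat, forall N : nat,
     (N0 <= N)%N -> `|X h N| <= C * N%:R) ->
  exists2 C : R, 0 <= C & exists N0 : nat, forall N : nat, (N0 <= N)%N ->
     `|\sum_(h <- hs) X h N| <= C * N%:R.
Proof.
elim: hs => [_|h hs IH H].
  by exists 0 => //; exists 0%N => N _; rewrite big_nil normr0 mul0r.
have [C1 C10 [N1 h1]] := H h (mem_head _ _).
have [|C2 C20 [N2 h2]] := IH; first by move=> g gs; apply: H; rewrite inE gs orbT.
exists (C1 + C2); first exact: addr_ge0.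
exists (maxn N1 N2) => N; rewrite geq_max => /andP[/h1 a1 /h2 a2].
by rewrite big_cons mulrDl; apply: le_trans (ler_normD _ _) (lerD a1 a2).
Qed.

Lemma exists_sifting_bound (k : nat) (F G : R) : 0 <= F -> F < G -> exists w : nat,
  [/\ (2 * k <= w)%N, (2 * k ^ 2 < w)%N, (12 <= w)%N & Kw k w * F < G].
Proof.
move=> F0 FG; have G0 : 0 < G by lra.
pose D : R := (2 * k ^ 2)%N%:R.
have D0 : 0 <= D by [].
have q0 : 0 <= D * G / (G - F) by rewrite divr_ge0 ?mulr_ge0 //; lra.
pose n := Num.bound (D * G / (G - F)).
have hn : D * G / (G - F) < n%:R by apply: archi_boundP.
(* With D = 2k^2, the inequality [Kw k w * F < G] is equivalent to w > D G/(G - F); the other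
   summands secure the remaining three conditions. *)
exists (n + 2 * k + (2 * k ^ 2).+1 + 12)%N; split; [lia|lia|lia|].
set w := (_ + 12)%N.
have wn : n%:R <= w%:R :> R by rewrite ler_nat /w; lia.
have w0 : 0 < w%:R :> R by rewrite ltr0n /w; lia.
have h : D * G < (G - F) * w%:R.
  by rewrite [ltRHS]mulrC -ltr_pdivrMr; [apply: lt_le_trans hn wn | lra].
have Dw : D < w%:R by rewrite ltr_nat /w; lia.
have e0 : 0 < 1 - D / w%:R by rewrite subr_gt0 ltr_pdivrMr // mul1r.
rewrite /Kw -/D mulrC ltr_pdivrMr //.
rewrite -(ltr_pM2r w0) -mulrA mulrBl mul1r divfK ?gt_eqF //.
by rewrite mulrBr; move: h; rewrite mulrBl [D * G]mulrC; lra.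
Qed.

(** P stands for L^(k+1), and L/tau + l for half of log(16N). The terms in P L^2 are compared on
    both sides and all others are O(P L), so dividing by P L bounds L. *)
Lemma growth_contradiction (L P tau l C E0 kG KF : R) :
  1 <= L -> 1 <= P -> 0 < tau -> 0 <= l -> 0 <= C -> 0 <= E0 -> 0 <= KF ->
  kG * (P * L ^+ 2) - C <= (L / tau + l) * (KF * (P * L) + E0 * P) ->
  (kG - KF / tau) * L <= C + E0 / tau + l * KF + l * E0.
Proof.
move=> L1 P1 t0 l0 C0 E00 KF0 h.
have L0 : 0 < L by lra.
have P0 : 0 < P by lra.
have Et0 : 0 <= E0 / tau by rewrite divr_ge0 // ltW.
rewrite -(ler_pM2r (mulr_gt0 P0 L0)).
have PL : 1 <= P * L by rewrite -[leLHS]mulr1 ler_pM.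
have h1 : C <= C * (P * L) by rewrite ler_peMr.
have h2 : l * E0 * P <= l * E0 * (P * L).
  by rewrite ler_wpM2l ?mulr_ge0 // ler_peMr // ltW.
rewrite [leLHS](_ : _ = kG * (P * L ^+ 2) - KF / tau * (P * L ^+ 2)); last by ring.
rewrite [leRHS](_ : _ = C * (P * L) + E0 / tau * (P * L) + l * KF * (P * L) + l * E0 * (P * L));
  last by ring.
have e : (L / tau + l) * (KF * (P * L) + E0 * P) =
  KF / tau * (P * L ^+ 2) + E0 / tau * (P * L) + l * KF * (P * L) + l * E0 * P by ring.
by rewrite e in h; lra.
Qed.

Lemma sieve_contradiction (theta tau c : R) (m : nat) (hs : seq nat) :
  (0 < m)%N -> size hs = m.+1 -> uniq hs -> all (fun h => h <= 12)%N hs ->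
  (forall w, exists b, forall h, h \in hs -> coprime (b + h) w`!) ->
  0 <= c -> 0 < tau -> tau < 1 -> tau < theta -> condA theta -> condB theta ->
  Fcst m c < tau * m.+1%:R * Gcst m c ->
  (exists N1 : nat, forall n, (N1 < n)%N ->
     \sum_(h <- hs) (prime (n + h))%:R <= (1 + liouville n.+1) / 2) -> False.
Proof.
move=> m0 szhs uhs hs12 adm c0 tau0 tau1 tt HA HB FG [N1 Hpt].
set k := m.+1 in szhs FG *.
have F0 : 0 <= Fcst m c.
  have inv0 n : 0 <= (n`!%:R)^-1 :> R by rewrite invr_ge0.
  by rewrite !addr_ge0 ?mulr_ge0 ?exprn_ge0.
have [w [kw k2w w12 hw]] := exists_sifting_bound k F0 FG.
have hsw : all (fun h => h <= w)%N hs by apply: sub_all hs12 => h /leq_trans; apply.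
have [b hb] := adm w.
have k0 : (0 < k)%N by [].
have [C1 C10 [Na ha]] := @approx_one w k c tau hs b k0 kw k2w c0 tau0 tau1 uhs szhs hsw.
have [C2 C20 [Nb hb2]] := @approx_liouville theta w k c tau hs b k0 kw k2w c0 tau0 tau1 uhs szhs
  hsw tt HB.
pose xh h n : R := if prime (n + h) then lg (n + h) else 0.
pose wt N n := sieve_weight w (@lamN w k c tau N) hs n.
pose S (N : nat) (x : nat -> R) := \sum_(N.+1 <= n < (2 * N).+1 | n == b %[mod w`!]) wt N n * x n.
pose Q2 N := quad w (@lamN w k c tau N) (fun Q => \prod_(p in Q) (m%:R / ((p : nat)%:R - 1))).
pose Q1 N := quad w (@lamN w k c tau N) (fun Q => \prod_(p in Q) (k%:R / (p : nat)%:R)).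
have [C3 C30 [Nc hc]] : exists2 C : R, 0 <= C & exists N0 : nat, forall N : nat, (N0 <= N)%N ->
     `|\sum_(h <- hs) (S N (xh h) - N%:R / (totient w`!)%:R * Q2 N)| <= C * N%:R.
  apply: (@sum_approx_uniform hs (fun h N => S N (xh h) - N%:R / (totient w`!)%:R * Q2 N)) => h hhs.
  exact: (@approx_prime theta w k c tau hs b h k0 kw k2w c0 tau0 tau1 uhs szhs hsw hhs
    (allP hs12 _ hhs) (hb _ hhs) tt HA).
have [C4 C40 hQ1] := quad_main1_le k0 kw k2w c0.
have cw0 := cW_gt0 w.
have K0 := Kw_gt0 k2w.
have W0 : 0 < (w`!)%:R :> R by exact: factr_gt0.
have phi0 : 0 < (totient w`!)%:R :> R by rewrite ltr0n totient_gt0 fact_gt0.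
pose B : R := cW w ^+ k / (w`!)%:R.
(* B is the common factor of both sides: cW^(k+1)/phi(w!) = cW^k/w!, because [cW w] is
   phi(w!)/w!. *)
have B0 : 0 < B by apply: divr_gt0 => //; rewrite exprn_gt0.
pose KF := B * (Kw k w * Fcst m c).
pose E0 := B * (Kw k w * C4) + (C1 + C2).
pose l := lg 16 / 2.
pose T := C3 + E0 / tau + l * KF + l * E0.
pose al := k%:R * (B * Gcst m c) - KF / tau.
have al0 : 0 < al.
  rewrite /al /KF subr_gt0 ltr_pdivrMr // [ltRHS](_ : _ = B * (tau * k%:R * Gcst m c)); last by
    ring.
  by rewrite ltr_pM2l.
(* This N makes L at least T/al + 1, so that al L exceeds the bound T obtained at the end. *)
have [Nd hd] := eventually_large ((T / al + 1) / (tau / 2)) tau0 tau1.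
have [N [NNa NNb NNc [NNd NN1]]] : exists N, [/\ (Na <= N)%N, (Nb <= N)%N, (Nc <= N)%N & (Nd <=
  N)%N /\ (N1 <= N)%N].
  by exists (Na + Nb + Nc + Nd + N1)%N; clear; split; [| | |split]; lia.
have [Npos l1 L1 Ll lT] := hd _ NNd.
have {}ha := ha _ NNa; have {}hb2 := hb2 _ NNb; have {}hc := hc _ NNc.
pose L := tau / 2 * lg N.
have LT : T / al + 1 <= L by rewrite /L [leRHS]mulrC -ler_pdivrMr // divr_gt0.
have NR : 0 < N%:R :> R by rewrite ltr0n.
have LN : L < lg N.+1 by apply: le_lt_trans Ll (ltr_lg Npos (leqnn _)).
have L0 : 0 < L by rewrite /L; lra.
have up : \sum_(h <- hs) S N (xh h) <= (lg N + lg 16) / 2 * (S N (fun=> 1) + S N (fun n =>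
  liouville n.+1)).
  rewrite /S exchange_big /= -big_split /= mulr_sumr big_nat_cond [leRHS]big_nat_cond.
  apply: ler_sum => n /andP[/andP[Nn n2N] _].
  have wt0 : 0 <= wt N n by rewrite /wt /sieve_weight sqr_ge0.
  rewrite -mulr_sumr -mulrDr mulrCA; apply: ler_wpM2l => //.
  apply: (@le_trans _ _ (\sum_(h <- hs) (lg N + lg 16) * (prime (n + h))%:R)).
    rewrite big_seq [leRHS]big_seq; apply: ler_sum => h hhs; rewrite /xh.
    case: (boolP (prime (n + h))) => pn; last by rewrite mulr0.
    (* n + h <= 2N + 12 <= 16N, which is the origin of log 16. *)
    rewrite mulr1 -lgM //; apply: ler_lg; first exact: prime_gt0.
    have := allP hs12 _ hhs; clear -n2N Npos; lia.
  rewrite -mulr_sumr -mulrA; apply: ler_wpM2l; first by rewrite addr_ge0 ?lg_ge0.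
  by rewrite mulrC; apply: Hpt; apply: leq_ltn_trans NN1 Nn.
have q2 : cW w ^+ k.+1 * (Gcst m c * L ^+ k.+3) <= Q2 N.
  apply: le_trans (@quad_main2_ge w N m c L m0 kw c0 (ltW L0) LN).
  rewrite -/k le_eqVlt; apply/orP; left; apply/eqP; congr (_ * _).
  rewrite !E_pos ?(ltW L0) // /Gcst /k !exprS.
  have f2 : (m.+2)`!%:R != 0 :> R by rewrite gt_eqF ?factr_gt0.
  have f3 : (m.+3)`!%:R != 0 :> R by rewrite gt_eqF ?factr_gt0.
  have f4 : (m.+4)`!%:R != 0 :> R by rewrite gt_eqF ?factr_gt0.
  move: ((m.+2)`!%:R) ((m.+3)`!%:R) ((m.+4)`!%:R) f2 f3 f4 => a2 a3 a4 f2 f3 f4.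
  by field; rewrite f2 f3 f4.
have q1 : Q1 N <= Kw k w * cW w ^+ k * (Fcst m c * L ^+ k.+2 + C4 * L ^+ k.+1).
  apply: le_trans (hQ1 N L L1) _.
  rewrite le_eqVlt; apply/orP; left; apply/eqP; congr (_ * (_ + _)).
  rewrite !E_pos ?(ltW L0) // /Fcst /k !exprS.
  have f2 : (m.+1)`!%:R != 0 :> R by rewrite gt_eqF ?factr_gt0.
  have f3 : (m.+2)`!%:R != 0 :> R by rewrite gt_eqF ?factr_gt0.
  have f4 : (m.+3)`!%:R != 0 :> R by rewrite gt_eqF ?factr_gt0.
  move: ((m.+1)`!%:R) ((m.+2)`!%:R) ((m.+3)`!%:R) f2 f3 f4 => a2 a3 a4 f2 f3 f4.
  by field; rewrite f2 f3 f4.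
have low : N%:R * (k%:R * (B * Gcst m c) * L ^+ k.+3 - C3) <= \sum_(h <- hs) S N (xh h).
  move: hc; rewrite sumrB big_const_seq count_predT szhs iter_addr_0 ler_norml => /andP[hc _].
  have : N%:R * (k%:R * (B * Gcst m c) * L ^+ k.+3) <= (N%:R / (totient w`!)%:R * Q2 N) *+ k.
    rewrite -[leRHS]mulr_natl.
    have -> : N%:R * (k%:R * (B * Gcst m c) * L ^+ k.+3) =
        k%:R * (N%:R / (totient w`!)%:R * (cW w ^+ k.+1 * (Gcst m c * L ^+ k.+3))) :> R.
      rewrite /B [cW w ^+ k.+1]exprS {2}/cW.
      move: (cW w ^+ k) (L ^+ k.+3) => u v.
      by field; rewrite !gt_eqF.
    by apply: ler_wpM2l => //; apply: ler_wpM2l => //; rewrite divr_ge0.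
  by rewrite mulrBr; lra.
have upp : S N (fun=> 1) + S N (fun n => liouville n.+1) <= N%:R * (KF * L ^+ k.+2 + E0 * L ^+
  k.+1).
  have ha' : S N (fun=> 1) - N%:R / (w`!)%:R * Q1 N <= C1 * N%:R := le_trans (ler_norm _) ha.
  have hb' : S N (fun n => liouville n.+1) <= C2 * N%:R := le_trans (ler_norm _) hb2.
  have Lk : 1 <= L ^+ k.+1 by rewrite exprn_ege1.
  have h1 : N%:R / (w`!)%:R * Q1 N <= N%:R * (KF * L ^+ k.+2 + B * (Kw k w * C4) * L ^+ k.+1).
    have -> : N%:R * (KF * L ^+ k.+2 + B * (Kw k w * C4) * L ^+ k.+1) =
       N%:R / (w`!)%:R * (Kw k w * cW w ^+ k * (Fcst m c * L ^+ k.+2 + C4 * L ^+ k.+1)).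
      by rewrite /KF /B; ring.
    by apply: ler_wpM2l => //; rewrite divr_ge0.
  have h2 : (C1 + C2) * N%:R <= N%:R * ((C1 + C2) * L ^+ k.+1).
    by rewrite mulrC ler_wpM2l // ler_peMr // addr_ge0.
  have -> : N%:R * (KF * L ^+ k.+2 + E0 * L ^+ k.+1) =
     N%:R * (KF * L ^+ k.+2 + B * (Kw k w * C4) * L ^+ k.+1) + N%:R * ((C1 + C2) * L ^+ k.+1).
    by rewrite /E0; ring.
  rewrite mulrDl in h2.
  move: (S N (fun=> 1)) (S N (fun n => liouville n.+1)) (N%:R / (w`!)%:R * Q1 N) (C1 * N%:R)
    (C2 * N%:R) ha' hb' h1 h2 => s1 s2 q c1 c2 ha' hb' h1 h2; lra.
have l0 : 0 <= lg N + lg 16 by rewrite addr_ge0 ?lg_ge0.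
have KF0 : 0 <= KF by apply: mulr_ge0; [exact: ltW | apply: mulr_ge0 => //; exact: ltW].
have E00 : 0 <= E0.
  by apply: addr_ge0; [apply: mulr_ge0; [exact: ltW|apply: mulr_ge0 => //; exact: ltW]|exact:
    addr_ge0].
have fin := @growth_contradiction L (L ^+ k.+1) tau l C3 E0 (k%:R * (B * Gcst m c)) KF L1.
have {}fin : al * L <= T.
  apply: fin => //; first by rewrite exprn_ege1.
    by rewrite /l divr_ge0 ?lg_ge0.
  have Ltau : L / tau + l = (lg N + lg 16) / 2 by rewrite /L /l; field; rewrite gt_eqF.
  rewrite Ltau -(ler_pM2l NR).
  have e3 : L ^+ k.+3 = L ^+ k.+1 * L ^+ 2 by rewrite -exprD addn2.
  have e2 : L ^+ k.+2 = L ^+ k.+1 * L by rewrite [LHS]exprS mulrC.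
  rewrite -e3 -e2; apply: le_trans low _; apply: le_trans up _.
  rewrite [leRHS]mulrCA; apply: ler_wpM2l => //.
  by rewrite divr_ge0.
have : al * (T / al + 1) <= T by apply: le_trans fin; rewrite ler_pM2l.
rewrite mulrDr mulr1 mulrCA mulfV ?gt_eqF // mulr1; lra.
Qed.

(* Each initial segment is an admissible tuple of minimal diameter; 1 is left out, so that
   lambda(n+1) can serve as the common test value. *)
Definition quintuple : seq nat := [:: 0; 2; 6; 8; 12]%N.

(** For p > 12 only five classes are hit; for the five smaller primes a free class is given
    explicitly. *)
Lemma quintuple_avoid p : prime p -> exists r, ~~ hit quintuple p r.
Proof.
move=> pp; have [p13|p13] := ltnP 12 p.
  have := card_hit pp (isT : uniq quintuple).
  have gp : all (fun g => g < p)%N quintuple.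
    by apply/allP => g; rewrite !inE => /or4P[/eqP->|/eqP->|/eqP->|/orP[]/eqP->]; lia.
  move=> /(_ gp) card5.
  have : [set a : 'I_p | hit quintuple p a] != setT.
    apply/eqP => e; move: card5; rewrite e cardsT card_ord /= => e5; lia.
  by rewrite eqEsubset subsetT /= => /subsetPn[a _]; rewrite inE => ha; exists a.
have : p \in [seq q <- iota 0 13 | prime q] by rewrite mem_filter pp mem_iota.
rewrite (_ : [seq q <- _ | _] = [:: 2; 3; 5; 7; 11]%N) // !inE.
move=> /or4P[/eqP->|/eqP->|/eqP->|/orP[]/eqP->].
- by exists 1%N.
- by exists 2%N.
- by exists 1%N.
- by exists 3%N.
- by exists 1%N.
Qed.

(** The free classes modulo the primes up to w are glued by the Chinese remainder theorem, by
    induction on w. *)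
Lemma quintuple_admissible w : exists b, forall h, h \in quintuple -> coprime (b + h) w`!.
Proof.
suff [b hb] : exists b, forall p, prime p -> (p <= w)%N -> ~~ hit quintuple p b.
  exists b => h hq; apply/negPn/negP => nc.
  have g1 : (1 < gcdn (b + h) w`!)%N by rewrite ltn_neqAle eq_sym nc gcdn_gt0 fact_gt0 orbT.
  have pp := pdiv_prime g1; have := pdiv_dvd (gcdn (b + h) w`!).
  rewrite dvdn_gcd prime_dvd_fact // => /andP[ph pw].
  by have /hasPn/(_ _ hq) := hb _ pp pw; rewrite ph.
elim: w => [|w [b IH]].
  by exists 0%N => p pp; rewrite leqn0 => /eqP p0; rewrite p0 in pp.
case: (boolP (prime w.+1)) => pw; last first.
  exists b => p pp; rewrite leq_eqVlt => /orP[/eqP e|]; last exact: IH.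
  by rewrite e in pp; rewrite pp in pw.
have [r hr] := quintuple_avoid pw.
have cop : coprime w`! w.+1 by rewrite coprime_sym prime_coprime // prime_dvd_fact // ltnn.
exists (chinese w`! w.+1 b r) => p pp; rewrite leq_eqVlt => /orP[/eqP ->|].
  by rewrite -(@hit_mod _ _ w.+1) // chinese_modr // hit_mod.
move=> pw'; rewrite -(@hit_mod _ _ w`!) ?prime_dvd_fact // chinese_modl //.
by rewrite hit_mod ?prime_dvd_fact // IH.
Qed.

(** * The Liouville function near primes and the pointwise inequality *)

Lemma liouville_prime p : prime p -> liouville p = -1.
Proof.
move=> pp; rewrite /liouville /bigOmega primes_prime // big_seq1 logn_prime // eqxx.
by rewrite RpowE expr1.
Qed.

Lemma liouville_pm n : liouville n = 1 \/ liouville n = -1.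
Proof.
rewrite /liouville RpowE (_ : IZR (-1) = -1) //; elim: (bigOmega n) => [|m IH]; first by left.
by rewrite exprS; case: IH => ->; [right; rewrite mulr1 | left; rewrite mulrNN mulr1].
Qed.

Lemma uniform_bound (n : nat) (Q : nat -> nat -> Prop) :
  (forall i, (i < n)%N -> exists M : nat, forall p, (M < p)%N -> Q i p) ->
  exists M : nat, forall i p, (i < n)%N -> (M < p)%N -> Q i p.
Proof.
elim: n => [_|n IH H]; first by exists 0%N.
have [M1 h1] := IH (fun i hi => H i (ltnW hi)).
have [M2 h2] := H n (ltnSn n).
exists (maxn M1 M2) => i p; rewrite ltnS leq_eqVlt gtn_max => /orP[/eqP->|lt] /andP[a1 a2].
  exact: h2.
exact: h1.
Qed.

(** The negation of the conclusion of the theorem, kept as a name for the proof by contradiction. *)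
Definition no_minus (D : nat) : Prop := ~ exists d : Z, (0 < Z.abs d <= Z.of_nat D)%Z /\
    forall M : nat, exists p : nat,
      (M < p)%N /\ prime p /\ (0 < Z.of_nat p + d)%Z /\
      liouville (Z.to_nat (Z.of_nat p + d)) = Ropp 1%R.

(** Each of the finitely many shifts has its own bound beyond which no prime gives -1, and their
    maximum serves all. A shift d is encoded by i = d + D, which stays in [nat]. *)
Lemma no_minus_shift D : no_minus D -> exists M0 : nat, forall p q : nat, (M0 < p)%N ->
  prime p -> p != q -> (p <= q + D)%N -> (q <= p + D)%N -> (0 < q)%N -> liouville q = 1.
Proof.
move=> H.
pose Q (i p : nat) := forall q : nat, prime p -> p != q -> (0 < q)%N ->
  (q + D = p + i)%N -> liouville q = 1.
have [M hM] : exists M : nat, forall i p, (i < (2 * D).+1)%N -> (M < p)%N -> Q i p.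
  apply: uniform_bound => i iD; apply: NNPP => nM.
  (* i = D is the shift 0, where p != q fails. *)
  have [e|iDn] := eqVneq i D.
    by apply: nM; exists 0%N => p _ q _ pq _ e2; move/eqP: pq; case; lia.
  apply: H; exists (Z.of_nat i - Z.of_nat D)%Z; split; first by move/eqP: iDn => iDn; lia.
  move=> M; apply: NNPP => np; apply: nM; exists M => p Mp q pp pq q0 e.
  case: (liouville_pm q) => // lq; exfalso; apply: np; exists p.
  have eq : (Z.of_nat p + (Z.of_nat i - Z.of_nat D) = Z.of_nat q)%Z by lia.
  by rewrite eq Nat2Z.id lq; do !split => //; lia.
exists M => p q Mp pp pq pqD qpD q0.
have iD : (q + D - p < (2 * D).+1)%N by lia.
by apply: (hM _ p iD Mp q pp pq q0); lia.
Qed.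

Lemma pointwise_bound (D : nat) (hs : seq nat) : no_minus D -> uniq hs ->
  all (fun h => h <= D)%N hs -> 1%N \notin hs -> (1 < D)%N ->
  exists N1 : nat, forall n, (N1 < n)%N ->
     \sum_(h <- hs) (prime (n + h))%:R <= (1 + liouville n.+1) / 2.
Proof.
move=> /no_minus_shift[M hM] uhs hsD h1 D1; exists M => n Mn.
have [/hasP[h hhs pn]|/hasPn np] := boolP (has (fun h => prime (n + h)) hs); last first.
  rewrite big_seq big1 => [|h /np/negbTE-> //].
  by case: (liouville_pm n.+1) => ->; lra.
have hD := allP hsD _ hhs.
have hn1 : h != 1%N by apply: contra h1 => /eqP <-.
have Mh : (M < n + h)%N by apply: leq_trans Mn (leq_addr _ _).
have -> : liouville n.+1 = 1.
  by apply: (hM (n + h)%N) => //; move/eqP: hn1 => hn1; try (apply/eqP); lia.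
rewrite (bigD1_seq h) //= pn big_seq_cond big1 => [|g /andP[ghs gh]].
  by rewrite addr0 /=; lra.
case: (boolP (prime (n + g))) => // pg; exfalso.
have gD := allP hsD _ ghs.
have : liouville (n + g) = 1.
  by apply: (hM (n + h)%N) => //; rewrite ?eqn_add2l 1?eq_sym //; rewrite ?prime_gt0 //; lia.
rewrite liouville_prime // => e; lra.
Qed.

(** * The numerical inequalities and the conclusion *)

(** Multiplication by (m+4)! clears all factorials and leaves a polynomial inequality that can be
    checked with numerals. *)
Lemma Fcst_le_Gcst (m : nat) (c t : R) :
  (m%:R + 2) * (m%:R + 3) * (m%:R + 4) + 2 * c * (m%:R + 3) * (m%:R + 4) + 2 * c ^+ 2 * (m%:R +
    4) <=
  t * ((m%:R + 1) * (2 * (m%:R + 3) * (m%:R + 4) + 6 * c * (m%:R + 4) + 6 * c ^+ 2)) ->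
  Fcst m c <= t * (m.+1%:R * Gcst m c).
Proof.
move=> h; have f1 : 0 < (m.+1)`!%:R :> R by exact: factr_gt0.
have m0 : 0 <= m%:R :> R by [].
have e2 : (m.+2)`!%:R = (m%:R + 2) * (m.+1)`!%:R :> R by rewrite factS natrM -natr1 -natr1; ring.
have e3 : (m.+3)`!%:R = (m%:R + 3) * (m.+2)`!%:R :> R by rewrite factS natrM -!natr1; ring.
have e4 : (m.+4)`!%:R = (m%:R + 4) * (m.+3)`!%:R :> R by rewrite factS natrM -!natr1; ring.
have d0 : 0 < (m%:R + 2) * (m%:R + 3) * (m%:R + 4) * (m.+1)`!%:R :> R by rewrite !mulr_gt0 //; lra.
rewrite /Fcst /Gcst e4 e3 e2 -(ler_pM2r d0) -natr1.
move: ((m.+1)`!%:R) f1 d0 {e2 e3 e4} => a f1 d0.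
rewrite [leLHS](_ : _ = (m%:R + 2) * (m%:R + 3) * (m%:R + 4) +
  2 * c * (m%:R + 3) * (m%:R + 4) + 2 * c ^+ 2 * (m%:R + 4)); last by field; rewrite !gt_eqF //;
    lra.
rewrite [leRHS](_ : _ = t * ((m%:R + 1) *
   (2 * (m%:R + 3) * (m%:R + 4) + 6 * c * (m%:R + 4) + 6 * c ^+ 2))) //.
by field; rewrite !gt_eqF //; lra.
Qed.

Lemma sub_quintuple_case (theta0 theta c : R) (m D : nat) (hs : seq nat) :
  (0 < m)%N -> size hs = m.+1 -> uniq hs -> {subset hs <= quintuple} ->
  all (fun h => h <= D)%N hs -> (1 < D)%N -> 0 <= c -> 0 < theta0 -> theta0 < 1 ->
  Fcst m c <= theta0 * (m.+1%:R * Gcst m c) ->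
  theta0 < theta -> condA theta -> condB theta -> ~ no_minus D.
Proof.
move=> m0 szhs uhs sub hsD D1 c0 t0 t1 FG tt HA HB H.
have G0 : 0 < m.+1%:R * Gcst m c.
  apply: mulr_gt0; first by rewrite ltr0n.
  have inv0 n : 0 < (n`!%:R)^-1 :> R by rewrite invr_gt0 factr_gt0.
  rewrite /Gcst ltr_wpDr ?ltr_wpDr ?mulr_ge0 ?mulr_gt0 ?exprn_ge0 ?(ltW (inv0 _)) //.
(* tau must stay below 1 for the total weight as well as below theta, so it is taken midway between
   theta0 and min(theta, 1). *)
pose s := Num.min theta 1.
have [s1 s2] : s <= theta /\ s <= 1 by split; rewrite ge_min lexx ?orbT.
have s0 : theta0 < s by rewrite lt_min tt.
pose tau := (theta0 + s) / 2.
have hpt := pointwise_bound H uhs hsD _ D1.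
apply: (@sieve_contradiction theta tau c m hs) => //.
- by apply/allP => h /sub; rewrite !inE => /or4P[/eqP->|/eqP->|/eqP->|/orP[]/eqP->].
- move=> w; have [b hb] := quintuple_admissible w; exists b => h /sub; exact: hb.
- by rewrite /tau; lra.
- by rewrite /tau; lra.
- by rewrite /tau; lra.
- apply: le_lt_trans FG _; rewrite -mulrA ltr_pM2r // /tau; lra.
- by apply: hpt; apply/negP => /sub.
Qed.

Lemma IZR_natr (n : nat) : IZR (Z.of_nat n) = n%:R.
Proof. by rewrite -INR_IZR_INZ INRE. Qed.

Lemma four_exponents (theta0 theta : R) (D : nat) :
  (theta0 = 729 / 1000 /\ D = 2%N) \/ (theta0 = 616 / 1000 /\ D = 6%N) \/
  (theta0 = 554 / 1000 /\ D = 8%N) \/ (theta0 = 515 / 1000 /\ D = 12%N) ->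
  theta0 < theta -> condA theta -> condB theta -> ~ no_minus D.
Proof.
move=> H tt HA HB nm.
case: H => [[e eD]|[[e eD]|[[e eD]|[e eD]]]]; rewrite {}eD in nm;
  have [t0 t1] : 0 < theta0 /\ theta0 < 1 by (split; rewrite e; lra).
(* The ratios F/(kG) in the four cases are 110/152, 408/666, 1218/2208 and 2640/5150, that is about
   0.7237, 0.6126, 0.5516 and 0.5126, each slightly below the stated exponent. *)
- have FG := @Fcst_le_Gcst 1 1 theta0 _.
  apply: (@sub_quintuple_case theta0 theta 1 1 2 [:: 0; 2]%N isT erefl isT _ isT isT
    (ler0n _ 1) t0 t1 (FG _) tt HA HB nm).
    by move=> h; rewrite !inE => /orP[]/eqP->.
  by rewrite e; lra.
- have FG := @Fcst_le_Gcst 2 3 theta0 _.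
  apply: (@sub_quintuple_case theta0 theta 3 2 6 [:: 0; 2; 6]%N isT erefl isT _ isT isT
    (ler0n _ 3) t0 t1 (FG _) tt HA HB nm).
    by move=> h; rewrite !inE => /or3P[]/eqP->.
  by rewrite e; lra.
- have FG := @Fcst_le_Gcst 3 6 theta0 _.
  apply: (@sub_quintuple_case theta0 theta 6 3 8 [:: 0; 2; 6; 8]%N isT erefl isT _ isT isT
    (ler0n _ 6) t0 t1 (FG _) tt HA HB nm).
    by move=> h; rewrite !inE => /or4P[]/eqP->.
  by rewrite e; lra.
- have FG := @Fcst_le_Gcst 4 9 theta0 _.
  apply: (@sub_quintuple_case theta0 theta 9 4 12 quintuple isT erefl isT _ isT isT
    (ler0n _ 9) t0 t1 (FG _) tt HA HB nm).
    by [].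
  by rewrite e; lra.
Qed.

Local Open Scope R_scope.

Theorem theorem7 (theta0 : R) (D : nat) :
  ((theta0 = 729 / 1000 /\ D = 2%N) \/ (theta0 = 616 / 1000 /\ D = 6%N) \/
   (theta0 = 554 / 1000 /\ D = 8%N) \/ (theta0 = 515 / 1000 /\ D = 12%N)) ->
  (exists theta : R, (theta0 < theta) /\ condA theta /\ condB theta) ->
  exists d : Z, (0 < Z.abs d <= Z.of_nat D)%Z /\
    forall M : nat, exists p : nat,
      (M < p)%N /\ prime p /\ (0 < Z.of_nat p + d)%Z /\
      liouville (Z.to_nat (Z.of_nat p + d)) = (-1).
Proof.
move=> H [theta [/RltP tt [HA HB]]]; apply: NNPP => nex.
(* Numerals in the statement are images of integers under [IZR]; in the ring notation used so far
   they are images of naturals. *)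
have q729 := IZR_natr 729; have q616 := IZR_natr 616; have q554 := IZR_natr 554.
have q515 := IZR_natr 515; have q1000 := IZR_natr 1000.
apply: (four_exponents _ tt HA HB nex).
by move: H; rewrite !RdivE /= q729 q616 q554 q515 q1000.
Qed.
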